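(* Let $\Omega$ be a Borel measurable subset of $\mathbb{R}^d$, endowed with the $d$-dimensional Lebesgue measure $\lambda$, and let $1 \le p < \infty$. Let $T$ be a positive and power-bounded linear operator on $L^p(\Omega,\lambda)$ and assume that there exist numbers $\varepsilon_1,\varepsilon_2 > 0$ such that $$\int_{\Omega} |Tf(x)|^{p} (1 + |x|)^{\varepsilon_2} \, d\lambda(x) < \infty \qquad \text{and} \qquad \int_{\Omega} |Tf(x)|^{p + \varepsilon_1} (1 + |x|)^{\varepsilon_2} \, d\lambda(x) < \infty$$ for each $f \in L^p(\Omega,\lambda)$. Then $r_{\mathrm{ess}}(T) < 1$.
   Context: All Banach spaces and $L^p$-spaces are over the complex scalar field. A linear operator $T$ on $L^p$ is positive if $Tf \ge 0$ almost everywhere whenever $f \ge 0$ almost everywhere. It is power-bounded if $\sup_{n \in \mathbb{N}_0} \|T^n\| < \infty$. The essential spectral radius $r_{\mathrm{ess}}(T)$ of a bounded linear operator $T$ on a complex Banach space is the smallest number $r \in [0,\infty)$ such that every complex number of modulus $> r$ is either in the resolvent set of $T$ or is a pole of the resolvent of $T$ and an eigenvalue of $T$ of finite algebraic multiplicity. *)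

(* Defs.v *)
From HB Require Import structures.
From mathcomp Require Import all_boot all_order all_algebra.
From mathcomp Require Import all_classical all_reals all_analysis.
From mathcomp Require Import measurable_realfun ring_quotient complex.
Set Implicit Arguments.
Unset Strict Implicit.
Unset Printing Implicit Defensive.
Import Order.TTheory GRing.Theory Num.Theory.
Import numFieldNormedType.Exports.
Import Normc.
Local Open Scope classical_set_scope.
Local Open Scope quotient_scope.
Local Open Scope ring_scope.
Local Open Scope complex_scope.

Section lebesgue_Rn.
Variable R : realType.
Local Notation RR := (measurableTypeR R).
Local Open Scope ereal_scope.

Definition tcons n (x : RR * n.-tuple RR) : n.+1.-tuple RR :=
  [the n.+1.-tuple RR of x.1 :: x.2].

Lemma measurable_tcons n : measurable_fun [set: RR * n.-tuple RR] (@tcons n).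
Proof. by apply: measurable_cons. Qed.

Section step.
Variables (n : nat) (mu : {sigma_finite_measure set (n.-tuple RR) -> \bar R}).

Definition lebesgueS : set (n.+1.-tuple RR) -> \bar R :=
  pushforward (@lebesgue_measure R \x mu) (@tcons n).

Let lebesgueS_measure : {measure set (n.+1.-tuple RR) -> \bar R}.
Proof.
refine (pushforward (@lebesgue_measure R \x mu) (@tcons n)
  : {measure set _ -> \bar R}).
exact: measurable_tcons.
Defined.

HB.instance Definition _ := @isMeasure.Build _ _ _ lebesgueS
  (@measure0 _ _ _ lebesgueS_measure)
  (@measure_ge0 _ _ _ lebesgueS_measure)
  (@measure_semi_sigma_additive _ _ _ lebesgueS_measure).

Let lebesgueS_sigma_finite : sigma_finite setT lebesgueS.
Proof.
have /sigma_finiteP[F [TF ndF Foo]] := sigma_finiteT (@lebesgue_measure R).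
have /sigma_finiteP[G [TG ndG Goo]] := sigma_finiteT mu.
pose hd (x : n.+1.-tuple RR) : RR := thead x.
pose tl (x : n.+1.-tuple RR) : n.-tuple RR := [tuple of behead x].
exists (fun k => (hd @^-1` F k) `&` (tl @^-1` G k)).
  apply/esym; rewrite -subTset => x _.
  have [k _ Fk] : (\bigcup_k F k) (hd x) by rewrite -TF.
  have [l _ Gl] : (\bigcup_k G k) (tl x) by rewrite -TG.
  exists (maxn k l) => //; split.
  - by have /subsetPset := ndF _ _ (leq_maxl k l); apply.
  - by have /subsetPset := ndG _ _ (leq_maxr k l); apply.
move=> k; have [mF Fk] := Foo k; have [mG Gk] := Goo k; split.
  by apply: measurableI; rewrite -[X in measurable X]setTI;
    [exact: (@measurable_tnth _ RR)|exact: (@measurable_behead _ RR)].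
rewrite /lebesgueS /pushforward.
rewrite (_ : _ @^-1` _ = (F k : set RR) `*` (G k : set (n.-tuple RR))).
  by rewrite product_measure1E// lte_mul_pinfty// ge0_fin_numE.
have tlE y : tl (tcons y) = y.2 by exact/val_inj.
by apply/seteqP; split => y /=; rewrite tlE.
Qed.

HB.instance Definition _ := @Measure_isSigmaFinite.Build _ _ _
  lebesgueS lebesgueS_sigma_finite.

End step.

(* [n.-tuple RR] carries the product of the Borel sigma-algebras of the factors,
   which is the Borel sigma-algebra of R^n; the measure below is the product
   measure, see [lebesgue_measureRn_box]. *)
Fixpoint lebesgue_measureRn n :
    {sigma_finite_measure set (n.-tuple RR) -> \bar R} :=
  match n with
  | 0 => \d_ [tuple]
  | m.+1 => lebesgueS (lebesgue_measureRn m)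
  end.

Lemma lebesgue_measureRn_box n (A : 'I_n -> set RR) :
  (forall i, measurable (A i)) ->
  lebesgue_measureRn n [set x | forall i, A i (tnth x i)] =
    \prod_(i < n) lebesgue_measure (A i).
Proof.
elim: n A => [|n IH] A mA.
  rewrite big_ord0 /= diracE mem_set//= => -[]//.
rewrite big_ord_recl -(IH (fun i => A (lift ord0 i)))// -product_measure1E//.
  rewrite /= /lebesgueS /pushforward; congr ((_ \x _) _).
  apply/seteqP; split => [[x t] /= h|[x t] /= [h0 h] i].
    split; first exact: h ord0.
    by move=> i; have := h (lift ord0 i); rewrite tnthS.
  case: (unliftP ord0 i) => [j|] ->; last exact: h0.
  by rewrite tnthS.
rewrite (_ : mkset _ =
    \bigcap_(i in [set: 'I_n]) ((@tnth n RR)^~ i @^-1` A (lift ord0 i))).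
  apply: fin_bigcap_measurable => // i _; rewrite -[X in measurable X]setTI.
  exact: measurable_tnth.
by apply/seteqP; split => t /= h i; [move=> _; exact: h|exact: h].
Qed.

Definition euclidean_norm n (x : n.-tuple RR) : R :=
  Num.sqrt (\sum_(i < n) tnth x i ^+ 2)%R.

End lebesgue_Rn.

Section complex_measurable.
Context d (X : measurableType d) (R : realType).
Implicit Types f g : X -> R[i].

Definition measurable_cfun f :=
  measurable_fun [set: X] (fun x => complex.Re (f x)) /\
  measurable_fun [set: X] (fun x => complex.Im (f x)).

Lemma measurable_cfunD f g :
  measurable_cfun f -> measurable_cfun g -> measurable_cfun (f + g).
Proof.
move=> [f1 f2] [g1 g2]; split.
  rewrite (_ : (fun _ => _) =
      (fun x => complex.Re (f x)) \+ (fun x => complex.Re (g x))).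
    exact: measurable_funD.
  by apply/funext => x /=; rewrite fctE; case: (f x) (g x) => [? ?] [].
rewrite (_ : (fun _ => _) =
    (fun x => complex.Im (f x)) \+ (fun x => complex.Im (g x))).
  exact: measurable_funD.
by apply/funext => x /=; rewrite fctE; case: (f x) (g x) => [? ?] [].
Qed.

Lemma measurable_cfunZ (a : R[i]) f :
  measurable_cfun f -> measurable_cfun (a *: f).
Proof.
move=> [f1 f2]; case: a => a b; split.
  rewrite (_ : (fun _ => _) =
      (fun x => a * complex.Re (f x)) \- (fun x => b * complex.Im (f x))).
    by apply: measurable_funB; exact: measurable_funM.
  by apply/funext => x /=; rewrite fctE; case: (f x).
rewrite (_ : (fun _ => _) =
    (fun x => a * complex.Im (f x)) \+ (fun x => b * complex.Re (f x))).
  by apply: measurable_funD; exact: measurable_funM.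
by apply/funext => x /=; rewrite fctE; case: (f x).
Qed.

Lemma measurable_normc f :
  measurable_cfun f -> measurable_fun [set: X] (fun x => normc (f x)).
Proof.
move=> [f1 f2].
rewrite (_ : (fun _ => _) =
   (@powR R ^~ 2^-1) \o (fun x => complex.Re (f x) ^+ 2 + complex.Im (f x) ^+ 2)).
  apply: measurableT_comp; first exact: measurable_powR.
  by apply: measurable_funD; exact: measurable_funX.
apply/funext => x /=; rewrite powR12_sqrt ?addr_ge0 ?sqr_ge0//.
by case: (f x).
Qed.

End complex_measurable.

Section Lp_space.
Context d (X : measurableType d) (R : realType).
Variables (mu : {measure set X -> \bar R}) (p : R) (p1 : 1 <= p).
Implicit Types f g : X -> R[i].

Definition Lp_norm f : \bar R := Lnorm mu p%:E (EFin \o (@normc R \o f)).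

(* The proof of [1 <= p] is a dummy argument: it makes the instances below, which
   rely on Minkowski's inequality, inferable from the type. *)
Definition Lp_pred (_ : 1 <= p) : {pred X -> R[i]} :=
  [pred f | `[< measurable_cfun f /\ (Lp_norm f < +oo)%E >]].

Lemma LpP f :
  reflect (measurable_cfun f /\ (Lp_norm f < +oo)%E) (f \in Lp_pred p1).
Proof. by rewrite inE; exact: asboolP. Qed.

Let p0 : p != 0. Proof. by rewrite gt_eqF// (lt_le_trans _ p1). Qed.

Let measurable_pow f :
  measurable_cfun f ->
  measurable_fun [set: X] (fun x => (`|(normc (f x))%:E| `^ p)%E).
Proof.
move=> mf; apply: (measurableT_comp (measurable_poweR p)).
by apply: measurableT_comp => //; apply/measurable_EFinP; exact: measurable_normc.
Qed.

Lemma eq_Lp_norm f g : measurable_cfun f -> measurable_cfun g ->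
  (\forall x \ae mu, f x = g x) -> Lp_norm f = Lp_norm g.
Proof.
move=> mf mg fg; rewrite /Lp_norm unlock /=; congr (_ `^ _)%E.
apply: ae_eq_integral => //; [exact: measurable_pow|exact: measurable_pow|].
by apply: filterS fg => x /= -> _.
Qed.

Lemma Lp_norm_cst0 : Lp_norm 0 = 0%E.
Proof.
rewrite -(@Lnorm0 _ _ _ mu p%:E)// /Lp_norm; congr Lnorm.
by apply/funext => x; congr EFin; exact: normc0.
Qed.

Lemma Lp_normD f g : measurable_cfun f -> measurable_cfun g ->
  (Lp_norm (f + g)%R <= Lp_norm f + Lp_norm g)%E.
Proof.
move=> mf mg.
have := @minkowski_EFin _ _ _ mu _ _ _
  (measurable_normc mf) (measurable_normc mg) p1.
apply: le_trans.
rewrite /Lp_norm unlock /=.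
have p_ge0 : 0 <= p by rewrite (le_trans _ p1).
apply: gt0_ler_poweR; rewrite ?invr_ge0//.
- by rewrite in_itv/= leey andbT integral_ge0.
- by rewrite in_itv/= leey andbT integral_ge0.
apply: ge0_le_integral => //.
- exact/measurable_pow/measurable_cfunD.
- apply/measurable_EFinP; apply: (measurableT_comp (measurable_powR p)).
  apply: measurableT_comp => //.
  by apply: measurable_funD; exact: measurable_normc.
move=> x _ /=; rewrite lee_fin; apply: ge0_ler_powR => //=; rewrite ?nnegrE//.
have n0 (z : R[i]) : 0 <= normc z by case: z => ? ? /=; exact: sqrtr_ge0.
by rewrite !ger0_norm ?addr_ge0//; exact: le_normcD.
Qed.

Lemma Lp_normZ (a : R[i]) f : f \in Lp_pred p1 ->
  Lp_norm (a *: f)%R = ((normc a)%:E * Lp_norm f)%E.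
Proof.
move=> /LpP[mf foo].
have uL : (@normc R \o f) \in Lfun mu p%:E.
  by rewrite inE; apply/andP; split; rewrite inE//=; exact: measurable_normc.
have p1E : (1 <= p%:E)%E by [].
have := LnormZ (Lfun_Sub p1E uL) (normc a).
rewrite (ger0_norm (_ : 0 <= normc a)); last by case: (a) => ? ? /=; exact: sqrtr_ge0.
move=> <-; congr Lnorm; apply/funext => x /=.
by rewrite fctE normcM.
Qed.

Lemma Lp_norm_eq0 f :
  measurable_cfun f -> Lp_norm f = 0%E -> \forall x \ae mu, f x = 0.
Proof.
move=> mf /Lnorm_eq0_eq0 h.
have : (EFin \o (@normc R \o f) = \0 %[ae mu])%E.
  apply: h; last by rewrite lte_fin (lt_le_trans _ p1).
  by apply/measurable_EFinP; exact: measurable_normc.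
by apply: filterS => x /(_ I) /= [/eq0_normc].
Qed.

Let Lp_submod_closed : submod_closed (Lp_pred p1).
Proof.
split=> [|a f g /[dup] fL /LpP[mf foo] /LpP[mg goo]].
  by apply/(LpP (0 : X -> R[i])); rewrite Lp_norm_cst0; split.
have maf := measurable_cfunZ a mf.
apply/(LpP (a *: f + g : X -> R[i])); split; first exact: measurable_cfunD.
apply: le_lt_trans (Lp_normD maf mg) _.
rewrite lte_add_pinfty// Lp_normZ// lte_mul_pinfty// lee_fin.
by case: (a) => ? ? /=; exact: sqrtr_ge0.
Qed.

HB.instance Definition _ :=
  GRing.isSubmodClosed.Build R[i] (X -> R[i]) (Lp_pred p1) Lp_submod_closed.

Record Lp_fun := LpFun { lp_fun :> X -> R[i]; _ : lp_fun \in Lp_pred p1 }.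

HB.instance Definition _ := [isSub for lp_fun].
HB.instance Definition _ := [Choice of Lp_fun by <:].
HB.instance Definition _ := [SubChoice_isSubLmodule of Lp_fun by <:].

Definition Lp_null : {pred Lp_fun} :=
  [pred f : Lp_fun | `[< \forall x \ae mu, f x = 0 >]].

Let Lp_null_zmod_closed : zmod_closed Lp_null.
Proof.
split=> [|f g /asboolP f0 /asboolP g0]; apply/asboolP.
  exact: nearW.
by apply: filterS2 f0 g0 => x fx gx; rewrite /= !fctE fx gx subr0.
Qed.

HB.instance Definition _ := GRing.isZmodClosed.Build Lp_fun Lp_null
  Lp_null_zmod_closed.

Definition Lp : Type := Quotient.quot Lp_null.
HB.instance Definition _ := Choice.on Lp.
HB.instance Definition _ := EqQuotient.on Lp.
HB.instance Definition _ := GRing.Zmodule.on Lp.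
HB.instance Definition _ := ZmodQuotient.on Lp.

Definition Lp_repr (f : Lp) : X -> R[i] := lp_fun (repr f).

Lemma Lp_eqmodP (f g : Lp_fun) :
  reflect (\forall x \ae mu, f x = g x) (f == g %[mod Lp]).
Proof.
rewrite -Quotient.idealrBE; apply: (iffP (asboolP _)); apply: filterS => x /=.
  by move=> /eqP; rewrite !fctE subr_eq0 => /eqP.
by move=> fg; rewrite !fctE fg subrr.
Qed.

Lemma Lp_repr_pi (f : Lp_fun) : \forall x \ae mu, Lp_repr (\pi_Lp f) x = f x.
Proof. by apply/Lp_eqmodP; rewrite reprK. Qed.

Lemma Lp_reprP (f : Lp) :
  measurable_cfun (Lp_repr f) /\ (Lp_norm (Lp_repr f) < +oo)%E.
Proof. exact/LpP/valP. Qed.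

Definition Lp_scale (a : R[i]) (f : Lp) : Lp := \pi_Lp (a *: repr f).

Let pi_scale a (f : Lp_fun) : Lp_scale a (\pi_Lp f) = \pi_Lp (a *: f).
Proof.
apply/eqP/Lp_eqmodP; apply: filterS (Lp_repr_pi f) => x /=.
by rewrite /Lp_repr !fctE => ->.
Qed.

Let piD (f g : Lp_fun) : \pi_Lp (f + g) = \pi_Lp f + \pi_Lp g :> Lp.
Proof. exact: (@Quotient.pi_add _ Lp_null f g). Qed.

Let Lp_scalerA a b (u : Lp) : Lp_scale a (Lp_scale b u) = Lp_scale (a * b) u.
Proof. by rewrite -[u]reprK (pi_scale b) !pi_scale scalerA. Qed.

Let Lp_scale1r : left_id 1 Lp_scale.
Proof. by move=> u; rewrite -[u]reprK pi_scale scale1r. Qed.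

Let Lp_scalerDr : right_distributive Lp_scale +%R.
Proof.
by move=> a u v; rewrite -[u]reprK -[v]reprK -piD !pi_scale scalerDr piD.
Qed.

Let Lp_scalerDl (u : Lp) : {morph Lp_scale^~ u : a b / a + b}.
Proof. by move=> a b; rewrite -[u]reprK !pi_scale scalerDl piD. Qed.

HB.instance Definition _ := GRing.Zmodule_isLmodule.Build R[i] Lp
  Lp_scalerA Lp_scale1r Lp_scalerDr Lp_scalerDl.

Lemma Lp_reprD (u v : Lp) :
  \forall x \ae mu, Lp_repr (u + v) x = Lp_repr u x + Lp_repr v x.
Proof.
have := Lp_repr_pi (repr u + repr v); rewrite piD !reprK.
by apply: filterS => x ->.
Qed.

Lemma Lp_reprZ (a : R[i]) (u : Lp) :
  \forall x \ae mu, Lp_repr (a *: u) x = a * Lp_repr u x.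
Proof. exact: Lp_repr_pi (a *: repr u). Qed.

Definition Lp_normr (u : Lp) : R[i] := (fine (Lp_norm (Lp_repr u)))%:C.

Lemma Lp_norm_fin (u : Lp) : (fine (Lp_norm (Lp_repr u)))%:E = Lp_norm (Lp_repr u).
Proof.
rewrite fineK// fin_numElt (lt_le_trans ltNy0) ?Lnorm_ge0//=.
by have [] := Lp_reprP u.
Qed.

Let ler_Lp_normrD u v : Lp_normr (u + v) <= Lp_normr u + Lp_normr v.
Proof.
have [mu1 _] := Lp_reprP u; have [mv _] := Lp_reprP v.
have [muv _] := Lp_reprP (u + v).
rewrite -rmorphD lecR -lee_fin EFinD !Lp_norm_fin.
apply: le_trans (Lp_normD mu1 mv).
by rewrite (eq_Lp_norm muv (measurable_cfunD mu1 mv) (Lp_reprD u v)).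
Qed.

Let Lp_normrZ (a : R[i]) u : Lp_normr (a *: u) = `|a| * Lp_normr u.
Proof.
have [mu1 uoo] := Lp_reprP u; have [mau _] := Lp_reprP (a *: u).
rewrite /Lp_normr (eq_Lp_norm mau (measurable_cfunZ a mu1) (Lp_reprZ a u)).
rewrite Lp_normZ; last exact/LpP.
by rewrite -Lp_norm_fin -EFinM/= rmorphM.
Qed.

Let Lp_normr0_eq0 u : Lp_normr u = 0 -> u = 0.
Proof.
move=> [u0]; have [mu1 _] := Lp_reprP u.
have /(Lp_norm_eq0 mu1) : Lp_norm (Lp_repr u) = 0%E by rewrite -Lp_norm_fin u0.
move=> u0'; rewrite -[u]reprK; apply/eqP.
have -> : 0 = \pi_Lp (0 : Lp_fun) :> Lp.
  exact: (esym (@pi_zeror _ _ _ _ _ (Quotient.quot Lp_null : zmodQuotType _ _ _ _))).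
exact/Lp_eqmodP.
Qed.

HB.instance Definition _ := Lmodule_isNormed.Build R[i] Lp
  ler_Lp_normrD Lp_normrZ Lp_normr0_eq0.

(* [<=] is the order of [R[i]]: [0 <= z] means that [z] is real and nonnegative. *)
Definition Lp_nonneg (u : Lp) := \forall x \ae mu, 0 <= Lp_repr u x.

Definition positive_op (T : Lp -> Lp) :=
  forall u, Lp_nonneg u -> Lp_nonneg (T u).

End Lp_space.

Section spectral_theory.
Context (R : realType) (V : normedModType R[i]).
Implicit Types (T S : V -> V) (z : R[i]).

(* The norm of [V] takes its values in [R[i]], hence the real part. *)
Definition opnorm T : \bar R :=
  ereal_sup [set (complex.Re `|T v|)%:E | v in [set v | `|v| <= 1]].

Definition power_bounded T :=
  (ereal_sup [set opnorm (iter n T) | n in [set: nat]] < +oo)%E.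

Definition is_resolvent T z S :=
  [/\ (opnorm S < +oo)%E, cancel (fun v => z *: v - T v) S
    & cancel S (fun v => z *: v - T v)].

Definition resolvent_set T : set R[i] := [set z | exists S, is_resolvent T z S].

(* [z0] is a pole of order [k >= 1]: on a punctured disc around [z0] the resolvent
   is the operator norm limit of a Laurent series
   \sum_(j >= 0) (z - z0) ^ (j - k) A_j with bounded A_j and A_0 <> 0. *)
Definition resolvent_pole T (z0 : R[i]) :=
  exists (k : nat) (A : nat -> {linear V -> V}) (r : R),
    [/\ (0 < k)%N, 0 < r, forall j, (opnorm (A j) < +oo)%E,
        exists v, A 0%N v <> 0
      & forall z, 0 < `|z - z0| < r%:C ->
          exists2 S, is_resolvent T z S &
            opnorm (fun v => S v -
              \sum_(j < n) (z - z0) ^ (j%:Z - k%:Z) *: A j v)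
            @[n --> \oo] --> 0%E].

Definition eigenvalue_op T z := exists2 v, v != 0 & T v = z *: v.

Definition generalized_eigenspace T z : set V :=
  [set v | exists n, iter n (fun w => z *: w - T w) v = 0].

Definition finite_dimensional (E : set V) :=
  exists (n : nat) (e : 'I_n -> V), forall v, E v ->
    exists c : 'I_n -> R[i], v = \sum_(i < n) c i *: e i.

(* The algebraic multiplicity is the dimension of the generalized eigenspace; at a
   pole this is the range of the spectral projection. *)
Definition finite_algebraic_multiplicity T z :=
  finite_dimensional (generalized_eigenspace T z).

Definition ess_bound T (r : R) := 0 <= r /\
  forall z, r%:C < `|z| ->
    resolvent_set T z \/
    [/\ resolvent_pole T z, eigenvalue_op T z
      & finite_algebraic_multiplicity T z].

(* An infimum in [\bar R], so that it is +oo if no bound exists; otherwise it is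
   attained, see [ess_spectral_radiusP]. *)
Definition ess_spectral_radius T : \bar R :=
  ereal_inf [set r%:E | r in ess_bound T].

Lemma ess_spectral_radiusP T : (exists r, ess_bound T r) ->
  exists r, [/\ ess_spectral_radius T = r%:E, ess_bound T r
    & forall s, ess_bound T s -> r <= s].
Proof.
move=> [r0 Tr0].
have lb : has_lbound (ess_bound T) by exists 0 => s [].
have hi : has_inf (ess_bound T) by split=> //; exists r0.
exists (inf (ess_bound T)); split.
- by rewrite -ereal_inf_EFin//; exists r0.
- split; first by apply: lb_le_inf; [exists r0|move=> s []].
  move=> z zr; pose m := normc z.
  have : inf (ess_bound T) < m by rewrite -ltcR.
  by move=> /(inf_lt hi.1)[s [_ +] sm]; apply; rewrite (_ : `|z| = m%:C)// ltcR.
- by move=> s Ts; exact: ge_inf.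
Qed.

End spectral_theory.

(* Main.v *)
From HB Require Import structures.
Require Import Defs.
From mathcomp Require Import all_boot all_order all_algebra.
From mathcomp Require Import all_classical all_reals all_analysis.
From mathcomp Require Import complex ring_quotient measurable_realfun lra ring.

(** As the powers of [T] are bounded, its spectrum lies in the closed unit disc. By
    compactness of the disc it is enough that every [l] of modulus 1 has a neighbourhood
    consisting of points of the resolvent set and of poles with finite-dimensional
    generalised eigenspaces ([ess_spectral_radius_lt1]).

    This follows from a compactness property at [l]: among vectors [w k] of the unit ball
    with [l *: w k - T (w k)] tending to 0, two are arbitrarily close to each other. For
    then bounded approximate eigenvectors have convergent subsequences, so that the
    Cesaro means of [T / l] converge along a subsequence, and the space is the sum of the
    eigenspace, which is finite-dimensional ([fixed_finite_dimensional]), and of the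
    range of [l - T], on which [l - T] is invertible ([reduced_resolvent]). The
    resolvent near [l] is then an explicit Laurent series with at most a simple pole
    ([local_resolvent_exists]).

    The compactness property ([approximate_eigenvectors_close]) comes from positivity
    and from the integrability of the images. Some power [l ^+ n] is close to 1, and
    thus approximate eigenvectors for [l] are approximately fixed by a power of [T], and
    even by Cesaro averages of that power. Averages being positive, real and imaginary
    parts are approximately fixed as well, and so are moduli: if [u] is nearly fixed by
    an average [P], then [P] hardly decreases the modulus of [u], and longer averages do
    not see by how much [P] increases it. In this way the sequences of real functions
    that are asymptotically fixed by the averages form a vector lattice for a seminorm
    [rho] that is an ultralimit of norms of averages ([asym_fixed_abs]).

    The first integrability condition makes the images of the unit ball uniformly small
    far from the origin, the second one where their own modulus is large; the uniformity
    comes from positivity ([weighted_bounded]). Hence [T] maps the unit ball into an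
    order interval up to any given error ([almost_order_bounded]).
    Asymptotically fixed sequences are nearly images under [T], so disjoint normalised
    members of the lattice have large parts below one function [g], and as the p-th power
    of [rho] is superadditive their number is bounded ([disjoint_count]). A vector
    lattice with this property is finite-dimensional modulo null vectors, with a maximal
    disjoint family as basis ([coordinates_exist]). Its unit ball is therefore covered by
    finitely many small sets ([asym_fixed_coloring]), and two out of infinitely many
    sequences of approximate eigenvectors must fall into the same one. *)

Set Implicit Arguments.
Unset Strict Implicit.
Unset Printing Implicit Defensive.
Import Order.TTheory GRing.Theory Num.Theory.
Import numFieldNormedType.Exports.
Import Normc.
Local Open Scope classical_set_scope.
Local Open Scope quotient_scope.
Local Open Scope ring_scope.
Local Open Scope complex_scope.

(** * Vector lattices in which disjoint families are bounded *)

Lemma bounded_coloring (R : realType) (B eta : R) : 0 < eta ->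
  exists (M : nat) (k : R -> 'I_M.+1), forall x y,
    `|x| <= B -> `|y| <= B -> k x = k y -> `|x - y| < eta.
Proof.
move=> eta0; exists (Num.truncn (2 * B / eta)).
exists (fun x => inord (Num.truncn ((x + B) / eta))).
have key x : `|x| <= B -> 0 <= (x + B) / eta /\
    (Num.truncn ((x + B) / eta) <= Num.truncn (2 * B / eta))%N.
  move=> xB; move: (xB); rewrite ler_norml => /andP[x1 x2]; split.
    by apply: divr_ge0; [lra|exact: ltW].
  by apply: le_truncn; rewrite ler_pM2r ?invr_gt0//; lra.
move=> x y /key[x0 xM] /key[y0 yM] /(congr1 val) /=; rewrite !inordK// => E.
have := truncn_itv x0; have := truncn_itv y0; rewrite E -natr1.
set n := _%:R => /andP[h1 h2] /andP[h3 h4].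
have : `|(x + B) / eta - (y + B) / eta| < 1 by rewrite ltr_norml; lra.
rewrite -mulrBl normrM (gtr0_norm (_ : 0 < eta^-1)) ?invr_gt0//.
by rewrite ltr_pdivrMr// mul1r; congr (`|_| < _); lra.
Qed.

Lemma min_scale (R : realType) (a b c : R) : 0 <= a -> 0 <= b -> 0 <= c ->
  Num.min (c * a) b <= (c + 1) * Num.min a b.
Proof.
move=> a0 b0 c0; have h1 := mulr_ge0 c0 a0; have h2 := mulr_ge0 c0 b0.
by rewrite /Num.min; case: ifPn; rewrite -?leNgt => h; case: ifPn; rewrite -?leNgt => h'; nra.
Qed.

Lemma min_norm_sub (R : realType) (a b e s : R) : 0 <= e -> Num.min `|b| e <= s ->
  Num.min `|a - b| e <= Num.min `|a| e + s.
Proof.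
move=> e0; have := ler_normB a b; have := normr_ge0 a; have := normr_ge0 b.
rewrite /Num.min => h1 h2 h3.
by do 3 (case: ifPn; rewrite -?leNgt => ?); lra.
Qed.

Lemma min_normD (R : realType) (a b e : R) : 0 <= e ->
  Num.min `|a + b| e <= Num.min `|a| e + Num.min `|b| e.
Proof.
move=> e0; have := ler_normD a b; have := normr_ge0 a; have := normr_ge0 b.
rewrite /Num.min => h1 h2 h3.
by do 3 (case: ifPn; rewrite -?leNgt => ?); lra.
Qed.

Lemma clip_lipschitz (R : realType) (a b e s : R) : 0 <= s -> a <= b + s ->
  Num.min (Num.max a 0) e <= Num.min (Num.max b 0) e + s.
Proof.
move=> s0 ab; rewrite addr_minl addr_maxl le_min !ge_min ge_max !le_max add0r.
by rewrite ab s0 orbT lerDl s0 orbT.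
Qed.

Lemma min_norm_parts (R : realType) (u e : R) : 0 <= e ->
  Num.min `|u| e <= Num.min (Num.max u 0) e + Num.min (Num.max (- u) 0) e.
Proof.
move=> e0; have [u0|u0] := ger0P u.
  by rewrite lerDl le_min e0 le_max lexx orbT.
by rewrite (@max_l _ _ (- u)) ?oppr_ge0 ?(ltW u0)// lerDr le_min e0 lexx.
Qed.

(** [F] is a vector lattice of functions and [rho] a lattice seminorm on it for which
    disjoint families have at most [N0] members. Modulo null functions such a lattice
    is finite-dimensional: a disjoint family of maximal size is a basis. *)
Section sublattice.
Variables (R : realType) (Y : Type) (F : set (Y -> R)) (rho : (Y -> R) -> R).

Definition disjoint_family m (e : 'I_m -> Y -> R) :=
  (forall i, [/\ F (e i), forall y, 0 <= e i y & 0 < rho (e i)]) /\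
  (forall i j, i != j -> rho (fun y => Num.min (e i y) (e j y)) = 0).

Hypothesis F0 : F (fun=> 0).
Hypothesis F_lin : forall a f g, F f -> F g -> F (fun y => a * f y + g y).
Hypothesis F_abs : forall f, F f -> F (fun y => `|f y|).
Hypothesis rho_mono : forall f g, F f -> F g ->
  (forall y, `|f y| <= `|g y|) -> rho f <= rho g.
Hypothesis rhoD : forall f g, F f -> F g ->
  rho (fun y => f y + g y) <= rho f + rho g.
Hypothesis rhoZ : forall a f, F f -> rho (fun y => a * f y) = `|a| * rho f.
Variable N0 : nat.
Hypothesis count : forall m (e : 'I_m -> Y -> R), disjoint_family e -> (m <= N0)%N.

Let FZ a f : F f -> F (fun y => a * f y).
Proof.
move=> Ff; have := F_lin a Ff F0; congr F.
by apply/funext => y; rewrite addr0.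
Qed.

Let FD f g : F f -> F g -> F (fun y => f y + g y).
Proof.
move=> Ff Fg; have := F_lin 1 Ff Fg; congr F.
by apply/funext => y; rewrite mul1r.
Qed.

Let FB f g : F f -> F g -> F (fun y => f y - g y).
Proof.
move=> Ff Fg; have := F_lin (-1) Fg Ff; congr F.
by apply/funext => y; rewrite mulN1r addrC.
Qed.

Let Fmin f g : F f -> F g -> F (fun y => Num.min (f y) (g y)).
Proof.
move=> Ff Fg.
have := FZ (2^-1) (FB (FD Ff Fg) (F_abs (FB Ff Fg))); congr F.
by apply/funext => y; rewrite minr_absE mulrC.
Qed.

Let Fpos f : F f -> F (fun y => Num.max (f y) 0).
Proof.
move=> Ff.
have := FZ (2^-1) (FD Ff (F_abs Ff)); congr F.
by apply/funext => y; rewrite maxr_absE subr0 addr0 mulrC.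
Qed.

Let rho0 : rho (fun=> 0) = 0.
Proof.
have := rhoZ 0 F0; rewrite normr0 [RHS]mul0r => {2}<-; congr rho.
by apply/funext => y; rewrite mul0r.
Qed.

Let rho_ge0 f : F f -> 0 <= rho f.
Proof. by move=> Ff; rewrite -rho0; apply: rho_mono => // y; rewrite normr0. Qed.

Let rho_null f g : F f -> F g -> (forall y, `|f y| <= `|g y|) ->
  rho g = 0 -> rho f = 0.
Proof.
move=> Ff Fg fg g0; apply/eqP; rewrite eq_le rho_ge0// andbT -g0.
exact: rho_mono.
Qed.

Let Fsum m (h : 'I_m -> Y -> R) (P : pred 'I_m) : (forall i, P i -> F (h i)) ->
  F (fun y => \sum_(i | P i) h i y).
Proof.
move=> Fh; rewrite (_ : (fun y => _) = \sum_(i | P i) h i); last first.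
  by apply/funext => y; rewrite fct_sumE.
by apply: big_ind => // f g; exact: FD.
Qed.

Let rho_sum m (h : 'I_m -> Y -> R) (P : pred 'I_m) : (forall i, P i -> F (h i)) ->
  rho (fun y => \sum_(i | P i) h i y) <= \sum_(i | P i) rho (h i).
Proof.
move=> Fh; rewrite (_ : (fun y => _) = \sum_(i | P i) h i); last first.
  by apply/funext => y; rewrite fct_sumE.
suff : F (\sum_(i | P i) h i) /\ rho (\sum_(i | P i) h i) <= \sum_(i | P i) rho (h i).
  by case.
elim/big_ind2 : _ => [|f a g b [Ff fa] [Fg gb]|i Pi].
- by split=> //; rewrite rho0.
- split; first exact: FD.
  by apply: (le_trans (rhoD Ff Fg)); exact: lerD.
- by split; [exact: Fh|].
Qed.

Lemma max_disjoint_family : exists m (e : 'I_m -> Y -> R), disjoint_family e /\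
  forall e' : 'I_m.+1 -> Y -> R, ~ disjoint_family e'.
Proof.
pose P m := `[< exists e : 'I_m -> Y -> R, disjoint_family e >].
have P0 : exists m, P m.
  exists 0%N; apply/asboolP; exists (fun i _ => 0).
  by split=> -[].
have Pb m : P m -> (m <= N0)%N by move=> /asboolP[e]; exact: count.
case: (ex_maxnP P0 Pb) => m /asboolP[e de] mmax.
exists m, e; split => // e' de'.
have : P m.+1 by apply/asboolP; exists e'.
by move/mmax; rewrite ltnn.
Qed.

Variables (m : nat) (e : 'I_m -> Y -> R).
Hypothesis de : disjoint_family e.
Hypothesis emax : forall e' : 'I_m.+1 -> Y -> R, ~ disjoint_family e'.

Let Fe i : F (e i). Proof. by have [] := de.1 i. Qed.
Let e_ge0 i y : 0 <= e i y. Proof. by have [] := de.1 i. Qed.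
Let re_gt0 i : 0 < rho (e i). Proof. by have [] := de.1 i. Qed.

Let minC (f g : Y -> R) : (fun y => Num.min (f y) (g y)) = (fun y => Num.min (g y) (f y)).
Proof. by apply/funext => y; rewrite minC. Qed.

(** Otherwise [f] could be adjoined to the family. *)
Lemma disjoint_complement_null f : F f -> (forall y, 0 <= f y) ->
  (forall i, rho (fun y => Num.min (f y) (e i y)) = 0) -> rho f = 0.
Proof.
move=> Ff f0 fe; apply/eqP; rewrite eq_le rho_ge0// andbT leNgt; apply/negP => f_gt0.
apply: (@emax (fun j => if unlift ord0 j is Some i then e i else f)); split.
  by move=> j; case: (unlift ord0 j) => [i|] //; have := de.1 i.
move=> i j; case: (unliftP ord0 i) => [i'|] ->; case: (unliftP ord0 j) => [j'|] ->.
- by rewrite (inj_eq lift_inj); exact: de.2.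
- by move=> _; rewrite minC.
- by move=> _.
- by rewrite eqxx.
Qed.

(** The members of a maximal family are atoms: replacing [e i] by two disjoint pieces
    of it would give a larger family. *)
Lemma disjoint_member_split i x z : F x -> F z ->
  (forall y, 0 <= x y <= e i y) -> (forall y, 0 <= z y <= e i y) ->
  rho (fun y => Num.min (x y) (z y)) = 0 -> rho x = 0 \/ rho z = 0.
Proof.
move=> Fx Fz xe ze xz; have [?|x0] := eqVneq (rho x) 0; [by left|].
have [?|z0] := eqVneq (rho z) 0; [by right|exfalso].
have lem w j : F w -> (forall y, 0 <= w y <= e i y) -> j != i ->
    rho (fun y => Num.min (w y) (e j y)) = 0.
  move=> Fw we ji; apply: rho_null (de.2 i j _); [exact: Fmin|exact: Fmin| |by rewrite eq_sym].
  move=> y; have := we y; have := e_ge0 j y => e0 /andP[w0 w1].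
  by rewrite !ger0_norm ?le_min ?w0 ?e0 ?(le_trans w0 w1)//= ge_min w1 /= ge_min lexx orbT.
apply: (@emax (fun j => if unlift ord0 j is Some k
                        then if k == i then x else e k else z)); split.
  move=> j; case: (unlift ord0 j) => [k|]; [case: eqP => _|].
  - by split => //; [move=> y; have /andP[] := xe y|rewrite lt_neqAle eq_sym x0 rho_ge0].
  - exact: de.1.
  - by split => //; [move=> y; have /andP[] := ze y|rewrite lt_neqAle eq_sym z0 rho_ge0].
move=> j k; case: (unliftP ord0 j) => [j'|] ->; case: (unliftP ord0 k) => [k'|] ->.
- rewrite (inj_eq lift_inj) => jk; case: eqP => [ji|/eqP ji]; case: eqP => [ki|/eqP ki].
  + by move: jk; rewrite ji ki eqxx.
  + exact: lem.
  + by rewrite minC; exact: lem.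
  + exact: de.2.
- by move=> _; case: eqP => [_|/eqP ji] //; rewrite minC; exact: lem.
- by move=> _; case: eqP => [_|/eqP ki]; [rewrite minC|exact: lem].
- by rewrite eqxx.
Qed.

Section coordinate.
Variables (v : Y -> R) (Fv : F v) (i : 'I_m).

Let x (t : R) y : R := Num.min (Num.max (v y - t * e i y) 0) (e i y).
Let z (t : R) y : R := Num.min (Num.max (t * e i y - v y) 0) (e i y).

Let Fx t : F (x t). Proof. exact/Fmin/Fe/Fpos/FB/FZ/Fe. Qed.
Let Fz t : F (z t). Proof. by apply/Fmin/Fe/Fpos/FB/Fv; exact/FZ/Fe. Qed.

Let x_or_z t : rho (x t) = 0 \/ rho (z t) = 0.
Proof.
apply: (@disjoint_member_split i) => // [y|y|]; have e0 := e_ge0 i.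
- by rewrite /x le_min e0 le_max lexx orbT ge_min lexx orbT.
- by rewrite /z le_min e0 le_max lexx orbT ge_min lexx orbT.
rewrite -[RHS]rho0; congr rho; apply/funext => y.
rewrite /x /z; have := e0 y; rewrite /Num.min /Num.max /=.
by do ! case: ifPn; rewrite -?leNgt; lra.
Qed.

(* Applied to w = x t and w = z t with s = |t| - 1: where w falls short of e i, the
   modulus of v is at least s times e i. *)
Let bound (w : Y -> R) (s : R) : F w -> 0 < s ->
  (forall y, 0 <= w y) -> (forall y, s * e i y <= s * w y + `|v y|) ->
  rho w = 0 -> s <= rho v / rho (e i).
Proof.
move=> Fw s0 w0 h rw0; rewrite ler_pdivlMr// -(gtr0_norm s0) -rhoZ//.
apply: (@le_trans _ _ (rho (fun y => s * w y + `|v y|))).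
  apply: rho_mono; [exact: FZ|exact/FD/F_abs/Fv/FZ/Fw|move=> y].
  rewrite ger0_norm ?mulr_ge0 ?e_ge0 ?(ltW s0)// ger0_norm ?addr_ge0 ?mulr_ge0//.
  exact: ltW.
apply: (le_trans (rhoD (FZ s Fw) (F_abs Fv))).
rewrite rhoZ// rw0 mulr0 add0r; apply: rho_mono => //; first exact: F_abs.
by move=> y; rewrite normr_id.
Qed.

Let bound_x (t : R) : t < -1 -> rho (x t) = 0 -> - t - 1 <= rho v / rho (e i).
Proof.
move=> t1; apply: bound => //; first lra.
  by move=> y; rewrite /x le_min e_ge0 le_max lexx orbT.
move=> y; rewrite /x; have := e_ge0 i y.
have := ler_norm (v y); have := ler_norm (- v y); rewrite normrN /Num.min /Num.max.
by move=> h1 h2 h3; do ! case: ifPn; rewrite -?leNgt -?leNgt => h4 h5; nra.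
Qed.

Let bound_z (t : R) : 1 < t -> rho (z t) = 0 -> t - 1 <= rho v / rho (e i).
Proof.
move=> t1; apply: bound => //; first lra.
  by move=> y; rewrite /z le_min e_ge0 le_max lexx orbT.
move=> y; rewrite /z; have := e_ge0 i y.
have := ler_norm (v y); have := ler_norm (- v y); rewrite normrN /Num.min /Num.max.
by move=> h1 h2 h3; do ! case: ifPn; rewrite -?leNgt -?leNgt => h4 h5; nra.
Qed.

(** As [e i] is an atom, for each [t] one of the two parts of [v - t e_i] is disjoint
    from it. The coordinate is the point [c] where this changes over; there both parts
    are null, because [x] and [z] are Lipschitz in [t] ([clip_lipschitz]). *)
Lemma coordinate_exists : exists c, `|c| <= 2 + rho v / rho (e i) /\
  rho (fun y => Num.min `|v y - c * e i y| (e i y)) = 0.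
Proof.
have b0 : 0 <= rho v / rho (e i) by apply: divr_ge0; [exact: rho_ge0|exact: ltW].
set b := rho v / _ in b0 *.
pose A := [set t | rho (z t) = 0].
have Ab t : A t -> t <= 1 + b.
  move=> At; case: (leP t 1) => t1; first by rewrite (le_trans t1)// lerDl.
  by have := bound_z t1 At; rewrite -/b; lra.
have A1 : A (- (2 + b)).
  case: (x_or_z (- (2 + b))) => // /bound_x; rewrite -/b => h.
  have h1 : - (2 + b) < -1 by lra.
  by have := h h1; lra.
have supA : has_sup A by split; [exists (- (2 + b))|exists (1 + b) => t /Ab].
set c := sup A; exists c; split.
  rewrite ler_norml; apply/andP; split; first exact: (sup_upper_bound supA A1).
  apply: (@le_trans _ _ (1 + b)); last by rewrite lerD2r ler1n.
  by apply: ge_sup; [exact: supA.1|move=> t /Ab].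
have lem (w w' : Y -> R) (s : R) : F w -> F w' -> (forall y, 0 <= w y) ->
    (forall y, w y <= w' y + `|s| * e i y) -> rho w' = 0 -> rho w <= `|s| * rho (e i).
  move=> Fw Fw' w0 ww' rw'.
  rewrite -[`|s|]normr_id -rhoZ// -[leRHS]add0r -rw'.
  apply: le_trans (rhoD Fw' (FZ _ (Fe i))); apply: rho_mono => //.
    exact/FD/FZ/Fe.
  by move=> y; rewrite ger0_norm//; apply: le_trans (ww' y) _; exact: ler_norm.
have small w : F w -> (forall d, 0 < d -> rho w <= d * rho (e i)) -> rho w = 0.
  move=> Fw wd; apply/eqP; rewrite eq_le rho_ge0// andbT; apply/ler_addgt0Pl => d d0.
  have := wd (d / rho (e i)); rewrite divr_gt0// => /(_ isT).
  by rewrite -mulrA mulVf ?mulr1 ?addr0 ?gt_eqF.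
have zc : rho (z c) = 0.
  apply: small => // d d0; have [t At ct] := sup_adherent d0 supA.
  have tc : t <= c by exact: (sup_upper_bound supA At).
  apply: (@le_trans _ _ (`|c - t| * rho (e i))); last first.
    by rewrite ler_wpM2r ?(ltW (re_gt0 i))// ger0_norm; move: ct; rewrite -/c; lra.
  apply: (lem (z c) (z t) (c - t)) => // y; rewrite /z.
    by rewrite le_min e_ge0 le_max lexx orbT.
  rewrite ger0_norm ?subr_ge0//; apply: clip_lipschitz.
    by rewrite mulr_ge0 ?subr_ge0 ?e_ge0.
  by rewrite mulrBl; lra.
have xc : rho (x c) = 0.
  apply: small => // d d0.
  have [xt|zt] := x_or_z (c + d); last first.
    have h : c + d <= c by exact: (sup_upper_bound supA zt).
    by exfalso; lra.
  rewrite -(gtr0_norm d0).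
  apply: (lem (x c) (x (c + d)) d) => // y; rewrite /x.
    by rewrite le_min e_ge0 le_max lexx orbT.
  rewrite gtr0_norm//; apply: clip_lipschitz.
    by rewrite mulr_ge0 ?e_ge0 ?ltW.
  by rewrite mulrDl; lra.
have Fvc : F (fun y => `|v y - c * e i y|) by exact/F_abs/FB/FZ/Fe.
apply/eqP; rewrite eq_le rho_ge0 ?andbT; last exact: Fmin.
apply: (@le_trans _ _ (rho (fun y => x c y + z c y))).
  apply: rho_mono; [exact: Fmin|exact: FD|move=> y].
  rewrite /x /z; have e0 := e_ge0 i y.
  rewrite ger0_norm ?le_min ?normr_ge0 ?e0//.
  by apply: le_trans (ler_norm _); rewrite -[c * _ - _]opprB; exact: min_norm_parts.
by apply: (le_trans (rhoD (Fx c) (Fz c))); rewrite xc zc addr0.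
Qed.
End coordinate.

(** Subtracting all the coordinates leaves a vector disjoint from the whole family. *)
Lemma coordinates_exist v : F v -> exists c : 'I_m -> R,
  (forall i, `|c i| <= 2 + rho v / rho (e i)) /\
  rho (fun y => v y - \sum_i c i * e i y) = 0.
Proof.
move=> Fv; have /choice[c cP] i := coordinate_exists Fv i.
exists c; split; first by move=> i; case: (cP i).
have Fce i : F (fun y => c i * e i y) by exact: FZ.
have Fu : F (fun y => v y - \sum_i c i * e i y) by apply: FB => //; exact: Fsum.
apply: (rho_null _ (F_abs Fu)) => //; first by move=> y; rewrite normr_id.
apply: disjoint_complement_null; [exact: F_abs|by []|move=> i].
pose q y := Num.min `|v y - c i * e i y| (e i y)
  + \sum_(j | j != i) (`|c j| + 1) * Num.min (e j y) (e i y).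
have Fq1 : F (fun y => Num.min `|v y - c i * e i y| (e i y)).
  by apply: Fmin => //; exact/F_abs/FB/FZ.
have Fq2 j : F (fun y => (`|c j| + 1) * Num.min (e j y) (e i y)).
  by apply: FZ; exact: Fmin.
have Fq3 : F (fun y => \sum_(j | j != i) (`|c j| + 1) * Num.min (e j y) (e i y)).
  by apply: Fsum => j _.
have Fq : F q by exact: FD.
apply: (rho_null _ Fq) => //; first by apply: Fmin => //; exact: F_abs.
  move=> y; rewrite ger0_norm ?le_min ?normr_ge0 ?e_ge0//.
  apply: le_trans (ler_norm _).
  have [_ Sle] : 0 <= \sum_(j | j != i) (`|c j| + 1) * Num.min (e j y) (e i y) /\
    Num.min `|\sum_(j | j != i) c j * e j y| (e i y) <=
    \sum_(j | j != i) (`|c j| + 1) * Num.min (e j y) (e i y).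
    have ei := e_ge0 i y.
    elim/big_ind2 : _ => [|a a' b b'|j _]; first by rewrite normr0 ge_min lexx.
      move=> [a0 ha] [b0 hb]; split; first exact: addr_ge0.
      exact: le_trans (min_normD _ _ ei) (lerD ha hb).
    have ej := e_ge0 j y; have cj := normr_ge0 (c j); split.
      by rewrite mulr_ge0 ?le_min ?ei ?ej ?addr_ge0.
    by rewrite normrM (ger0_norm ej); exact: min_scale.
  by rewrite /q (bigD1 i)//= opprD addrA; exact: min_norm_sub.
apply/eqP; rewrite eq_le rho_ge0// andbT.
apply: (le_trans (rhoD Fq1 Fq3)); rewrite (cP i).2 add0r.
apply: (le_trans (rho_sum _)) => //; rewrite big1// => j ji.
by rewrite rhoZ ?de.2 ?mulr0//; exact: Fmin.
Qed.

(** The unit ball has bounded coordinates, so rounding them to a grid leaves finitely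
    many colours. *)
Lemma coloring_from_family delta : 0 < delta -> exists (Q : finType) (k : (Y -> R) -> Q),
  forall v v', F v -> F v' -> rho v <= 1 -> rho v' <= 1 -> k v = k v' ->
    rho (fun y => v y - v' y) < delta.
Proof.
move=> delta0.
pose s := \sum_i rho (e i); have s0 : 0 <= s by apply: sumr_ge0 => i _; exact: rho_ge0.
pose eta := delta / (s + 1).
have eta0 : 0 < eta by rewrite divr_gt0// ltr_wpDl.
pose B := \sum_i (2 + 1 / rho (e i)).
have [M [k kP]] := bounded_coloring B eta0.
have /choice[c cP] : forall v, exists c : 'I_m -> R, F v -> rho v <= 1 ->
    (forall i, `|c i| <= B) /\ rho (fun y => v y - \sum_i c i * e i y) = 0.
  move=> v; have [Fv|nFv] := pselect (F v); last by exists (fun=> 0).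
  have [c [c1 c2]] := coordinates_exist Fv; exists c => _ v1; split => // i.
  apply: (le_trans (c1 i)); rewrite /B (bigD1 i)//= -[leLHS]addr0 lerD//.
    by rewrite lerD2l ler_pM2r// invr_gt0.
  by apply: sumr_ge0 => j _; rewrite addr_ge0// divr_ge0// ltW.
exists {ffun 'I_m -> 'I_M.+1}, (fun v => [ffun i => k (c v i)]).
move=> v v' Fv Fv' v1 v1' kvv'.
have [cv1 cv2] := cP v Fv v1; have [cv1' cv2'] := cP v' Fv' v1'.
have cc i : `|c v i - c v' i| < eta.
  by apply: kP => //; move/ffunP: kvv' => /(_ i); rewrite !ffunE.
have FS w : F (fun y => \sum_i c w i * e i y) by apply: Fsum => i _; exact: FZ.
have Fd i : F (fun y => (c v i - c v' i) * e i y) by exact: FZ.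
pose a y := v y - \sum_i c v i * e i y; pose b y := v' y - \sum_i c v' i * e i y.
have Fa : F a by exact: FB.
have Fb : F b by exact: FB.
have Fs : F (fun y => \sum_i (c v i - c v' i) * e i y) by apply: Fsum => i _.
have -> : (fun y => v y - v' y) =
    (fun y => (a y - b y) + \sum_i (c v i - c v' i) * e i y).
  apply/funext => y; rewrite /a /b.
  under [X in _ = _ + X]eq_bigr do rewrite mulrBl.
  by rewrite sumrB; lra.
apply: (le_lt_trans (rhoD (FB Fa Fb) Fs)).
have -> : rho (fun y => a y - b y) = 0.
  apply/eqP; rewrite eq_le rho_ge0 ?andbT; last exact: FB.
  have -> : (fun y => a y - b y) = (fun y => a y + (-1) * b y).
    by apply/funext => y; rewrite mulN1r.
  by apply: (le_trans (rhoD Fa (FZ _ Fb))); rewrite rhoZ// cv2 cv2' mulr0 addr0.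
rewrite add0r; apply: (le_lt_trans (rho_sum _)) => //.
apply: (@le_lt_trans _ _ (eta * s)); last first.
  by rewrite /eta mulrAC ltr_pdivrMr ?ltr_wpDl// ltr_pM2l// ltrDl.
rewrite mulr_sumr; apply: ler_sum => i _.
by rewrite rhoZ// ler_wpM2r ?rho_ge0// ltW.
Qed.
End sublattice.

(** * Real-valued norms, sequences and total boundedness *)

Lemma subrACA (V : zmodType) (a b c d : V) : a - b - (c - d) = a - c - (b - d).
Proof. by rewrite !opprB addrACA [RHS]addrACA [- b - _]addrC. Qed.

Section real_norm.
Variables (R : realType) (V : normedModType R[i]).
Implicit Types (u v : V) (a : R[i]).

(** The norm of a space over [R[i]] takes its values in [R[i]]; its real part is the
    usual norm, with values in an ordered field. *)
Definition nr (v : V) : R := complex.Re `|v|.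

Lemma nrE v : `|v| = (nr v)%:C.
Proof.
have := normr_ge0 v; rewrite /nr; case: `|v| => a b /=.
by rewrite lecE /= => /andP[/eqP -> _].
Qed.

Lemma nr_ge0 v : 0 <= nr v.
Proof. by have := normr_ge0 v; rewrite nrE lecR. Qed.

Lemma nrD u v : nr (u + v) <= nr u + nr v.
Proof. by have := ler_normD u v; rewrite !nrE -rmorphD lecR. Qed.

Lemma nrZ a v : nr (a *: v) = normc a * nr v.
Proof.
by have := normrZ a v; rewrite !nrE (_ : `|a| = (normc a)%:C)// -rmorphM => -[].
Qed.

Lemma nrN v : nr (- v) = nr v.
Proof. by rewrite /nr normrN. Qed.

Lemma nr0 : nr 0 = 0.
Proof. by rewrite /nr normr0. Qed.

Lemma nr_distC u v : nr (u - v) = nr (v - u).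
Proof. by rewrite /nr distrC. Qed.

Lemma nrB u v : nr (u - v) <= nr u + nr v.
Proof. by rewrite -(nrN v) nrD. Qed.

Lemma nr_eq0 v : nr v = 0 -> v = 0.
Proof. by move=> v0; apply/eqP; rewrite -normr_eq0 nrE v0. Qed.

Lemma nr_small_eq0 v : (forall e, 0 < e -> nr v <= e) -> v = 0.
Proof.
move=> h; apply: nr_eq0; apply/eqP; rewrite eq_le nr_ge0 andbT.
by apply/ler_addgt0Pl => e /h; rewrite addr0.
Qed.

Lemma nr_triangle w u v : nr (u - v) <= nr (u - w) + nr (w - v).
Proof. by rewrite (le_trans _ (nrD _ _))// addrA subrK. Qed.

Lemma nr_sum n (f : 'I_n -> V) : nr (\sum_i f i) <= \sum_i nr (f i).
Proof.
elim/big_ind2 : _ => [|a a' b b' h1 h2|//]; first by rewrite nr0.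
exact: le_trans (nrD _ _) (lerD h1 h2).
Qed.

Lemma normc_ge0 a : 0 <= normc a.
Proof. by case: a => x y; rewrite sqrtr_ge0. Qed.

Lemma normcD a b : normc (a + b) <= normc a + normc b.
Proof. exact: le_normcD. Qed.

Lemma normcR (x : R) : 0 <= x -> normc x%:C = x.
Proof. by move=> x0 /=; rewrite expr0n /= addr0 sqrtr_sqr ger0_norm. Qed.

Lemma normc_Re a : `|complex.Re a| <= normc a.
Proof.
case: a => x y /=; rewrite -sqrtr_sqr ler_sqrt ?lerDl ?sqr_ge0//.
by rewrite addr_ge0 ?sqr_ge0.
Qed.

Lemma normc_Im a : `|complex.Im a| <= normc a.
Proof.
case: a => x y /=; rewrite -sqrtr_sqr ler_sqrt ?lerDr ?sqr_ge0//.
by rewrite addr_ge0 ?sqr_ge0.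
Qed.

Lemma normc_le_ReIm a : normc a <= `|complex.Re a| + `|complex.Im a|.
Proof.
case: a => x y /=; rewrite -[leRHS]ger0_norm ?addr_ge0// -sqrtr_sqr.
rewrite ler_sqrt ?sqr_ge0// -(real_normK (num_real x)) -(real_normK (num_real y)).
by rewrite sqrrD -addrA lerD2l lerDr mulrn_wge0// mulr_ge0.
Qed.

Lemma opnorm_le (f : V -> V) (K : R) :
  (forall v, nr v <= 1 -> nr (f v) <= K) -> (opnorm f <= K%:E)%E.
Proof.
move=> h; apply: ge_ereal_sup => _ [v /= v1 <-]; rewrite lee_fin; apply: h.
by move: v1; rewrite nrE -[1]/(1%:C) lecR.
Qed.

Lemma opnorm_lty (f : V -> V) (K : R) :
  (forall v, nr (f v) <= K * nr v) -> (opnorm f < +oo)%E.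
Proof.
move=> h; apply: (@le_lt_trans _ _ `|K|%:E); last exact: ltry.
apply: opnorm_le => v v1; apply: le_trans (h v) _.
apply: le_trans (ler_wpM2r (nr_ge0 v) (ler_norm K)) _.
by rewrite -[leRHS]mulr1 ler_wpM2l.
Qed.

Lemma opnorm_ge0 (f : V -> V) : (0 <= opnorm f)%E.
Proof.
apply: (@le_trans _ _ (nr (f 0))%:E); first by rewrite lee_fin nr_ge0.
by apply: ereal_sup_ubound; exists 0 => //=; rewrite normr0 ler01.
Qed.

(** Homogeneity is what makes the supremum over the ball control all vectors. *)
Lemma opnorm_bound (f : V -> V) (K : R) : (forall a v, f (a *: v) = a *: f v) ->
  (opnorm f <= K%:E)%E -> forall v, nr (f v) <= K * nr v.
Proof.
move=> fZ fK v; have [v0|v0] := eqVneq (nr v) 0.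
  rewrite (nr_eq0 v0) -[X in f X](scale0r 0) fZ scale0r nr0 mulr0//.
have v_gt0 : 0 < nr v by rewrite lt_neqAle eq_sym v0 nr_ge0.
have : ((nr (f ((nr v)^-1%:C *: v)))%:E <= K%:E)%E.
  apply: le_trans fK; apply: ereal_sup_ubound; exists ((nr v)^-1%:C *: v) => //=.
  by rewrite nrE nrZ normcR ?invr_ge0 ?nr_ge0// mulVf.
by rewrite fZ nrZ normcR ?invr_ge0 ?nr_ge0// lee_fin mulrC ler_pdivrMr.
Qed.

End real_norm.

(** The condition on the n-th term reads only the first n terms, so the sequence can be
    built by recursion on its prefixes. *)
Lemma prefix_choice (T : Type) (x0 : T) (P : nat -> (nat -> T) -> T -> Prop) :
  (forall n f g x, (forall i, (i < n)%N -> f i = g i) -> P n f x -> P n g x) ->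
  (forall n f, exists x, P n f x) ->
  exists f : nat -> T, forall n, P n f (f n).
Proof.
move=> Pext h.
have /choice[g gP] : forall ns : nat * (nat -> T), exists x, P ns.1 ns.2 x.
  by move=> [].
pose s := fix s n := if n is m.+1 then rcons (s m) (g (m, nth x0 (s m))) else [::].
have ss n : size (s n) = n by elim: n => //= n IH; rewrite size_rcons IH.
pose f n := g (n, nth x0 (s n)); exists f => n.
apply: Pext (gP (n, nth x0 (s n))) => i /=.
elim: n => // n IH; rewrite ltnS leq_eqVlt => /predU1P[->|i_n].
  by rewrite /= nth_rcons ss ltnn eqxx.
by rewrite /= nth_rcons ss i_n IH.
Qed.

Section subsequences.
Variable R : realType.

Lemma increasing_ge (f : nat -> nat) : increasing_seq f -> forall n, (n <= f n)%N.
Proof.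
move=> /increasing_seqP fi; elim=> // n IH.
by apply: leq_ltn_trans IH _; have := fi n; rewrite ltEnat.
Qed.

Lemma cvg_index (f : nat -> nat) : (forall n, (n <= f n)%N) -> f @ \oo --> \oo.
Proof.
move=> fn; apply/cvgnyPge => A; near=> n.
by apply: leq_trans (fn n); near: n; exact: nbhs_infty_ge.
Unshelve. all: by end_near. Qed.

Lemma nullP (x : nat -> R) : x @ \oo --> (0 : R) <->
  (forall e, 0 < e -> exists N, forall n, (N <= n)%N -> `|x n| < e).
Proof.
split=> [/cvgr0Pnorm_lt h e /h [N _ hN]|h]; first by exists N.
by apply/cvgr0Pnorm_lt => e /h[N hN]; exists N.
Qed.

Lemma null_cst_div (K : R) : (fun n => K / n.+1%:R) @ \oo --> (0 : R).
Proof. by rewrite -[X in _ --> X](mulr0 K); apply: cvgM; [exact: cvg_cst|exact: cvg_harmonic]. Qed.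

Lemma null_squeeze (x y : nat -> R) : (forall n, 0 <= x n <= y n) ->
  y @ \oo --> (0 : R) -> x @ \oo --> (0 : R).
Proof.
move=> xy y0; apply: (@squeeze_cvgr _ _ _ _ (cst 0) y) => //; last exact: cvg_cst.
exact: nearW.
Qed.

Lemma complex_bolzano_weierstrass (z : nat -> R[i]) (K : R) :
  (forall n, normc (z n) <= K) ->
  exists f : nat -> nat, (forall n, (n <= f n)%N) /\
  exists l, (fun n => normc (z (f n) - l)) @ \oo --> (0 : R).
Proof.
move=> zK.
have bd (x : nat -> R) : (forall n, `|x n| <= K) -> bounded_fun x.
  move=> xK; exists K; split; first exact: num_real.
  by move=> M KM n _ /=; rewrite (le_trans (xK n))// ltW.
have [f fi /cvg_ex[/= a fa]] := bolzano_weierstrass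
  (bd (@complex.Re R \o z) (fun n => le_trans (normc_Re _) (zK n))).
have [g gi /cvg_ex[/= b gb]] := bolzano_weierstrass
  (bd (@complex.Im R \o z \o f) (fun n => le_trans (normc_Im _) (zK (f n)))).
exists (f \o g); split.
  by move=> n; apply: leq_trans (increasing_ge gi n) (increasing_ge fi _).
exists (a +i* b).
have ga : (@complex.Re R \o z \o f \o g) @ \oo --> a.
  by apply: (cvg_comp _ _ _ fa); by apply/cvg_index/increasing_ge.
apply: (@squeeze_cvgr _ _ _ _ (cst 0)
  (fun n => `|complex.Re (z (f (g n))) - a| + `|complex.Im (z (f (g n))) - b|)).
- apply: nearW => n /=; rewrite normc_ge0 (le_trans (normc_le_ReIm _))//.
  by case: (z (f (g n))).
- exact: cvg_cst.
- rewrite -[X in _ --> X]addr0; apply: cvgD.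
  + by apply/norm_cvg0P/subr_cvg0; exact: ga.
  + by apply/norm_cvg0P/subr_cvg0; exact: gb.
Qed.
End subsequences.

Lemma free_ultrafilter_exists : exists U : set_system nat,
  UltraFilter U /\ (forall m, U [set n | (m <= n)%N]).
Proof.
have [U [UU sU]] := ultraFilterLemma (_ : ProperFilter (nbhs (\oo : set_system nat))).
by exists U; split => // m; apply: sU; exact: nbhs_infty_ge.
Qed.

Section total_boundedness.
Variables (R : realType) (V : normedModType R[i]).

Definition nr_cauchy (u : nat -> V) := forall e : R, 0 < e ->
  exists N, forall i j, (N <= i)%N -> (N <= j)%N -> nr (u i - u j) < e.

Definition nr_complete := forall u : nat -> V, nr_cauchy u ->
  exists l, (fun n => nr (u n - l)) @ \oo --> (0 : R).

(** Fix a free ultrafilter. At each scale some term has almost all terms, in the sense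
    of the ultrafilter, within that distance: otherwise terms pairwise far apart could
    be chosen one after the other. The subsequence is taken inside these balls. *)
Lemma cauchy_subsequence (u : nat -> V) :
  (forall f : nat -> nat, (forall n, (n <= f n)%N) -> forall e : R, 0 < e ->
     exists i j, (i < j)%N /\ nr (u (f i) - u (f j)) < e) ->
  exists f : nat -> nat, (forall n, (n <= f n)%N) /\ nr_cauchy (u \o f).
Proof.
move=> H.
have [U [UU Uge]] := free_ultrafilter_exists.
have ball e : 0 < e -> exists i, U [set j | nr (u i - u j) < e].
  move=> e0; apply: contrapT => nex.
  have far i : U [set j | e <= nr (u i - u j)].
    have [Ui|] := in_ultra_setVsetC [set j | nr (u i - u j) < e] UU.
      by case: nex; exists i.
    by apply: filterS => j /= /negP; rewrite -leNgt.
  have [f fP] : exists f : nat -> nat, forall n, (n <= f n)%N /\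
      (forall i, (i < n)%N -> e <= nr (u (f i) - u (f n))).
    apply: (@prefix_choice nat 0%N (fun n f x => (n <= x)%N /\
      (forall i, (i < n)%N -> e <= nr (u (f i) - u x)))).
      by move=> n f g x fg [nx h]; split => // i i_n; rewrite -fg//; exact: h.
    move=> n f.
    have : U [set x | (n <= x)%N /\ (forall i, (i < n)%N -> e <= nr (u (f i) - u x))].
      apply: filterI; first exact: Uge.
      elim: n => [|n IH]; first by apply: filterS filterT => x _ i.
      apply: filterS (filterI IH (far (f n))) => x [h1 h2] i.
      by rewrite ltnS leq_eqVlt => /predU1P[->//|]; exact: h1.
    by move=> /filter_ex[x ?]; exists x.
  have [i [j [ij]]] := H f (fun n => (fP n).1) e e0.
  by rewrite ltNge (fP j).2.
have half n : 0 < n.+1%:R^-1 / 2 :> R by rewrite divr_gt0 ?invr_gt0.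
have /choice[c cP] := fun n => ball _ (half n).
have [f fP] : exists f : nat -> nat, forall n, (n <= f n)%N /\
    (forall m, (m <= n)%N -> nr (u (c m) - u (f n)) < m.+1%:R^-1 / 2).
  suff /choice[f fP] : forall n, exists k, (n <= k)%N /\
    (forall m, (m <= n)%N -> nr (u (c m) - u k) < m.+1%:R^-1 / 2) by exists f.
  move=> n; apply: (@filter_ex _ U); apply: filterI; first exact: Uge.
  elim: n => [|n IH]; first by apply: filterS (cP 0%N) => k ? m; rewrite leqn0 => /eqP ->.
  apply: filterS (filterI IH (cP n.+1)) => k [h1 h2] m.
  by rewrite leq_eqVlt => /predU1P[->//|]; exact: h1.
exists f; split; first by move=> n; exact: (fP n).1.
move=> e e0; have [N Ne] : exists N : nat, N.+1%:R^-1 < e.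
  by have /nullP/(_ e e0)[N /(_ N (leqnn N))] := @cvg_harmonic R;
    rewrite ger0_norm ?harmonic_ge0// => h; exists N.
exists N => i j Ni Nj; apply: lt_trans Ne.
rewrite [ltRHS]splitr; apply: le_lt_trans (nr_triangle (u (c N)) _ _) _.
rewrite ltrD//; last by have [_ h] := fP j; exact: h.
by rewrite nr_distC; have [_ h] := fP i; exact: h.
Qed.

Definition spanned n (e : 'I_n -> V) (v : V) :=
  exists c : 'I_n -> R[i], v = \sum_i c i *: e i.

Lemma spanned_lin n (e : 'I_n -> V) a u v :
  spanned e u -> spanned e v -> spanned e (a *: u + v).
Proof.
move=> [c ->] [c' ->]; exists (fun i => a * c i + c' i).
by rewrite scaler_sumr -big_split; apply: eq_bigr => i _; rewrite scalerDl scalerA.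
Qed.

Lemma spanned0 n (e : 'I_n -> V) : spanned e 0.
Proof. by exists (fun=> 0); rewrite big1// => i _; rewrite scale0r. Qed.

(** A line added to a closed subspace: coefficients along the new direction are
    controlled by its positive distance to the subspace, hence have a cluster
    point. *)
Lemma spanned_closed n (e : 'I_n -> V) v :
  (forall d : R, 0 < d -> exists2 m, spanned e m & nr (v - m) < d) -> spanned e v.
Proof.
elim: n e v => [|n IH] e v h.
  suff -> : v = 0 by exact: spanned0.
  apply: nr_small_eq0 => d /h[m [c ->]]; rewrite big_ord0 subr0; exact: ltW.
pose e' i := e (lift ord0 i).
have sub m : spanned e' m -> spanned e m.
  move=> [c ->]; exists (fun i => if unlift ord0 i is Some j then c j else 0).
  rewrite big_ord_recl unlift_none scale0r add0r.
  by apply: eq_bigr => i _; rewrite liftK.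
have e0s : spanned e (e ord0).
  exists (fun i => if unlift ord0 i is Some j then 0 else 1).
  rewrite big_ord_recl unlift_none scale1r big1 ?addr0// => i _.
  by rewrite liftK scale0r.
have dec m : spanned e m -> exists c m', spanned e' m' /\ m = c *: e ord0 + m'.
  move=> [c ->]; rewrite big_ord_recl; exists (c ord0); eexists; split; last by [].
  by exists (fun i => c (lift ord0 i)).
have [e0in|e0out] := pselect (spanned e' (e ord0)).
  apply: sub; apply: IH => d /h[m /dec[c [m' [m's ->]]] hm].
  by exists (c *: e ord0 + m') => //; exact: spanned_lin.
have [d d0 hd] : exists2 d : R, 0 < d & forall m, spanned e' m -> d <= nr (e ord0 - m).
  apply: contrapT => nd; apply: e0out; apply: IH => d d0; apply: contrapT => nm.
  by apply: nd; exists d => // m ms; rewrite leNgt; apply/negP => hm; apply: nm; exists m.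
have hd' c m : spanned e' m -> normc c * d <= nr (c *: e ord0 + m).
  move=> ms; have [->|c0] := eqVneq c 0; first by rewrite normc0 mul0r nr_ge0.
  have -> : c *: e ord0 + m = c *: (e ord0 - (- c^-1) *: m).
    by rewrite scaleNr opprK scalerDr scalerA divff// scale1r.
  rewrite nrZ ler_wpM2l ?normc_ge0//; apply: hd.
  by rewrite -[_ *: m]addr0; apply: spanned_lin => //; exact: spanned0.
have /choice[c /choice[m cm]] : forall k : nat, exists c m, spanned e' m /\
    nr (v - (c *: e ord0 + m)) < k.+1%:R^-1.
  move=> k; have [//|m /dec[c [m' [m's ->]]] hm] := h k.+1%:R^-1.
  by exists c, m'.
have [f [fge [l cl]]] : exists f : nat -> nat, (forall n, (n <= f n)%N) /\
    exists l, (fun n => normc (c (f n) - l)) @ \oo --> (0 : R).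
  apply: (@complex_bolzano_weierstrass _ _ ((nr v + 1) / d)) => k.
  rewrite ler_pdivlMr//; have [ms hk] := cm k.
  apply: le_trans (hd' _ _ ms) _; rewrite -lerBlDl.
  have k1 : k.+1%:R^-1 <= 1 :> R by rewrite invf_le1// ler1n.
  apply: le_trans (le_trans (ltW hk) k1).
  by rewrite lerBlDl; set w := _ + _; have := nrB v (v - w); rewrite subKr.
suff /sub h' : spanned e' (v - l *: e ord0).
  by rewrite -(subrK (l *: e ord0) v) addrC; exact: spanned_lin.
apply: IH => g g0.
have g2 : 0 < g / 2 / (nr (e ord0) + 1) by rewrite !divr_gt0// ltr_wpDl// nr_ge0.
have /nullP/(_ _ g2)[N1 hN1] := cl.
have g2' : 0 < g / 2 by rewrite divr_gt0.
have /nullP/(_ _ g2')[N2 hN2] := @cvg_harmonic R.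
pose N := maxn N1 N2; exists (m (f N)); first exact: (cm _).1.
have -> : v - l *: e ord0 - m (f N) =
  (v - (c (f N) *: e ord0 + m (f N))) + (c (f N) - l) *: e ord0.
  rewrite scalerBl opprD; set A := c _ *: _; set B := l *: _; set D := m _.
  by rewrite -[RHS]addrA addrACA addNr add0r [- D - B]addrC addrA.
apply: le_lt_trans (nrD _ _) _; rewrite [ltRHS]splitr ltr_leD//.
  apply: lt_trans (cm _).2 _; have := hN2 (f N); rewrite ger0_norm ?harmonic_ge0//; apply.
  exact: leq_trans (leq_maxr _ _) (fge _).
rewrite nrZ; have := hN1 N (leq_maxl _ _); rewrite ger0_norm ?normc_ge0//.
rewrite ltr_pdivlMr ?ltr_wpDl ?nr_ge0// => /ltW; apply: le_trans.
by rewrite ler_wpM2l ?normc_ge0// lerDl.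
Qed.
End total_boundedness.

(** * Mean ergodic decomposition *)

(** Here [tb] is the compactness of approximately fixed sequences. It makes the Cesaro
    means of [S] converge along a subsequence, and 1 an isolated point of the spectrum. *)
Section mean_ergodic.
Variables (R : realType) (V : normedModType R[i]) (S : {linear V -> V}) (C : R).
Hypothesis Vc : @nr_complete R V.
Hypothesis C1 : 1 <= C.
Hypothesis SC : forall n v, nr (iter n S v) <= C * nr v.
Hypothesis tb : forall w : nat -> V, (forall k, nr (w k) <= 1) ->
  (fun k => nr (w k - S (w k))) @ \oo --> (0 : R) ->
  forall d : R, 0 < d -> exists i j, (i < j)%N /\ nr (w i - w j) < d.

Let C0 : 0 < C. Proof. exact: lt_le_trans C1. Qed.

Lemma iter_lin n (a : R[i]) u v : iter n S (a *: u + v) = a *: iter n S u + iter n S v.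
Proof. by elim: n => //= n ->; rewrite linearP. Qed.

Lemma iter_fix n v : S v = v -> iter n S v = v.
Proof. by move=> Sv; elim: n => //= n ->. Qed.

Definition cesaro_mean N v : V := (N.+1%:R^-1)%:C *: \sum_(j < N.+1) iter j S v.

Lemma cesaro_lin N a u v : cesaro_mean N (a *: u + v) = a *: cesaro_mean N u + cesaro_mean N v.
Proof.
rewrite /cesaro_mean (eq_bigr (fun j : 'I_N.+1 => a *: iter j S u + iter j S v)); last first.
  by move=> j _; rewrite iter_lin.
by rewrite big_split -scaler_sumr scalerDr !scalerA mulrC.
Qed.

Lemma cesaroD N u v : cesaro_mean N (u + v) = cesaro_mean N u + cesaro_mean N v.
Proof. by have := cesaro_lin N 1 u v; rewrite !scale1r. Qed.

Lemma cesaroB N u v : cesaro_mean N (u - v) = cesaro_mean N u - cesaro_mean N v.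
Proof. by have := cesaro_lin N (-1) v u; rewrite !scaleN1r addrC => ->; rewrite addrC. Qed.

Lemma cesaro_bound N v : nr (cesaro_mean N v) <= C * nr v.
Proof.
rewrite /cesaro_mean nrZ normcR ?invr_ge0// mulrC ler_pdivrMr//.
apply: le_trans (nr_sum _) _.
apply: le_trans (ler_sum _ (fun (j : 'I_N.+1) _ => SC j v)) _.
by rewrite sumr_const card_ord mulr_natr.
Qed.

Lemma cesaro_fix N v : S v = v -> cesaro_mean N v = v.
Proof.
move=> Sv; rewrite /cesaro_mean (eq_bigr (fun=> v)) => [|j _]; last exact: iter_fix.
rewrite sumr_const card_ord -(scaler_nat N.+1 v) scalerA.
have -> : N.+1%:R = (N.+1%:R : R)%:C :> R[i] by rewrite rmorph_nat.
by rewrite -rmorphM /= mulVf// scale1r.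
Qed.

Lemma cesaro_comm N v : cesaro_mean N (S v) = S (cesaro_mean N v).
Proof.
rewrite /cesaro_mean (linearZ_LR S) (raddf_sum S); congr (_ *: _).
by apply: eq_bigr => j _; rewrite -iterS iterSr.
Qed.

Lemma cesaro_sub N v : nr (cesaro_mean N v - S (cesaro_mean N v)) <= (1 + C) * nr v / N.+1%:R.
Proof.
have -> : cesaro_mean N v - S (cesaro_mean N v) =
    (N.+1%:R^-1)%:C *: (v - iter N.+1 S v).
  rewrite /cesaro_mean (linearZ_LR S) -scalerBr (raddf_sum S); congr (_ *: _).
  by rewrite big_ord_recl [X in _ - X]big_ord_recr /= opprD addrA addrK.
rewrite nrZ normcR ?invr_ge0// mulrC ler_wpM2r ?invr_ge0//.
apply: le_trans (nrB _ _) _; rewrite mulrDl mul1r lerD2l; exact: SC.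
Qed.

Lemma cesaro_sub_null v : (fun N => nr (cesaro_mean N v - S (cesaro_mean N v))) @ \oo --> (0 : R).
Proof.
apply: null_squeeze (null_cst_div ((1 + C) * nr v)) => N.
by rewrite nr_ge0 cesaro_sub.
Qed.

(** This turns out to be the range of [1 - S], but its closedness needs only the uniform
    bound on the means. *)
Definition ergodic_kernel z := (fun N => nr (cesaro_mean N z)) @ \oo --> (0 : R).

Lemma ergodic_kernel_range x : ergodic_kernel (x - S x).
Proof.
rewrite /ergodic_kernel.
under eq_fun do rewrite cesaroB cesaro_comm; exact: cesaro_sub_null.
Qed.

Lemma ergodic_kernel_lin a u v : ergodic_kernel u -> ergodic_kernel v ->
  ergodic_kernel (a *: u + v).
Proof.
move=> ku kv; apply: (@null_squeeze R _ (fun N => normc a * nr (cesaro_mean N u) + nr (cesaro_mean N v))).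
  by move=> N; rewrite nr_ge0 cesaro_lin (le_trans (nrD _ _))// nrZ.
rewrite -[X in _ --> X]addr0; apply: cvgD => //.
by rewrite -[X in _ --> X](mulr0 (normc a)); apply: cvgM => //; exact: cvg_cst.
Qed.

Lemma ergodic_kernel0 : ergodic_kernel 0.
Proof.
rewrite /ergodic_kernel (_ : (fun _ => _) = cst 0); first exact: cvg_cst.
by apply/funext => N; rewrite cesaro_fix ?linear0// nr0.
Qed.

Lemma ergodic_kernelS z : ergodic_kernel z -> ergodic_kernel (S z).
Proof.
move=> kz; have := ergodic_kernel_lin (-1) (ergodic_kernel_range z) kz.
by rewrite scaleN1r opprB subrK.
Qed.

(** The Cesaro means are uniformly bounded, so the vectors on which they vanish
    asymptotically form a closed subspace. *)
Lemma ergodic_kernel_closed z :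
  (forall d : R, 0 < d -> exists2 w, ergodic_kernel w & nr (z - w) < d) -> ergodic_kernel z.
Proof.
move=> h; apply/nullP => e e0.
have [|w kw zw] := h (e / 2 / C); first by rewrite !divr_gt0.
have e2 : 0 < e / 2 by rewrite divr_gt0.
have /nullP/(_ _ e2)[N hN] := kw; exists N => n /hN.
rewrite !ger0_norm ?nr_ge0// => h1.
rewrite -(subrK w z) cesaroD; apply: le_lt_trans (nrD _ _) _.
rewrite [ltRHS]splitr ltrD//; apply: le_lt_trans (cesaro_bound _ _) _.
by rewrite mulrC -ltr_pdivlMr.
Qed.

Lemma ergodic_kernel_fix z : ergodic_kernel z -> S z = z -> z = 0.
Proof.
move=> /nullP kz Sz; apply: nr_small_eq0 => e /kz[N /(_ N (leqnn N))].
by rewrite cesaro_fix// ger0_norm ?nr_ge0// => /ltW.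
Qed.

Lemma approx_fixed_subsequence (w : nat -> V) (K : R) : (forall k, nr (w k) <= K) ->
  (fun k => nr (w k - S (w k))) @ \oo --> (0 : R) ->
  exists f : nat -> nat, (forall n, (n <= f n)%N) /\
  exists2 l, S l = l & (fun k => nr (w (f k) - l)) @ \oo --> (0 : R).
Proof.
move=> wK w0.
have [f [fge fc]] : exists f : nat -> nat, (forall n, (n <= f n)%N) /\ nr_cauchy (w \o f).
  apply: cauchy_subsequence => g gge e e0.
  have K1 : 0 < `|K| + 1 by rewrite ltr_wpDl.
  have s0 : 0 < (`|K| + 1)^-1 by rewrite invr_gt0.
  have [|||i [j [ij h]]] := @tb (fun k => ((`|K| + 1)^-1)%:C *: w (g k)) _ _ (e / (`|K| + 1)).
  - move=> k; rewrite nrZ normcR ?(ltW s0)// mulrC ler_pdivrMr// mul1r.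
    by apply: le_trans (wK _) _; apply: le_trans (ler_norm K) _; rewrite lerDl.
  - apply: (@null_squeeze R _ (fun k => (`|K| + 1)^-1 * nr (w (g k) - S (w (g k))))).
      by move=> k; rewrite nr_ge0 (linearZ_LR S) -scalerBr nrZ normcR ?(ltW s0)/=.
    rewrite -[X in _ --> X](mulr0 (`|K| + 1)^-1); apply: cvgM; first exact: cvg_cst.
    by apply: cvg_comp w0; exact: cvg_index.
  - by rewrite divr_gt0.
  - exists i, j; split => //; move: h; rewrite -scalerBr nrZ normcR ?(ltW s0)//.
    by rewrite mulrC ltr_pM2r.
have [l hl] := Vc fc; exists f; split => //; exists l => //.
apply/esym/eqP; rewrite -subr_eq0; apply/eqP; apply: nr_small_eq0 => e e0.
have e2 : 0 < e / 2 / (1 + C) by rewrite !divr_gt0// addr_gt0.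
have e2' : 0 < e / 2 by rewrite divr_gt0.
have /nullP/(_ _ e2)[N1 hN1] := hl; have /nullP/(_ _ e2')[N2 hN2] := w0.
pose n := maxn N1 N2.
have := hN1 n (leq_maxl _ _); have := hN2 (f n) (leq_trans (leq_maxr _ _) (fge _)).
rewrite !ger0_norm ?nr_ge0//= => h2 h1.
have -> : l - S l = (w (f n) - S (w (f n))) - ((w (f n) - l) - S (w (f n) - l)).
  have -> : w (f n) - l - S (w (f n) - l) = (w (f n) - S (w (f n))) - (l - S l).
    by rewrite linearB /= subrACA.
  by rewrite subKr.
apply: le_trans (nrB _ _) _; rewrite [leRHS]splitr lerD// ?(ltW h2)//.
apply: le_trans (nrB _ _) _; have /= := SC 1 (w (f n) - l).
by move: h1; rewrite ltr_pdivlMr ?addr_gt0//; lra.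
Qed.

(** The explicit preimage, under [1 - S], of the difference between a vector and its
    N-th mean; see [cesaro_potentialE]. *)
Definition cesaro_potential N v : V :=
  (N.+1%:R^-1)%:C *: \sum_(j < N.+1) \sum_(i < j) iter i S v.

Lemma cesaro_potentialE N v :
  v - cesaro_mean N v = cesaro_potential N v - S (cesaro_potential N v).
Proof.
rewrite /cesaro_potential (linearZ_LR S) -scalerBr (raddf_sum S) -sumrB.
rewrite (eq_bigr (fun j : 'I_N.+1 => v - iter j S v)); last first.
  move=> j _; rewrite (raddf_sum S) -sumrB; case: j => j /= _.
  elim: j => [|j IH]; first by rewrite big_ord0 subrr.
  by rewrite big_ord_recr /= IH addrA subrK.
rewrite sumrB scalerBr -/(cesaro_mean N v); congr (_ - _).
rewrite sumr_const card_ord -(scaler_nat N.+1 v) scalerA.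
have -> : N.+1%:R = (N.+1%:R : R)%:C :> R[i] by rewrite rmorph_nat.
by rewrite -rmorphM /= mulVf// scale1r.
Qed.

Lemma ergodic_kernel_sum n (f : nat -> V) : (forall i, ergodic_kernel (f i)) ->
  ergodic_kernel (\sum_(i < n) f i).
Proof.
move=> h; elim/big_ind: _ => // [|u v ku kv]; first exact: ergodic_kernel0.
by have := ergodic_kernel_lin 1 ku kv; rewrite scale1r.
Qed.

Lemma ergodic_kernel_potential N z : ergodic_kernel z ->
  ergodic_kernel (cesaro_potential N z).
Proof.
move=> kz; rewrite /cesaro_potential -[_ *: _]addr0.
apply: ergodic_kernel_lin ergodic_kernel0.
apply: (@ergodic_kernel_sum _ (fun j => \sum_(i < j) iter i S z)) => j.
by apply: (@ergodic_kernel_sum _ (fun i => iter i S z)); elim=> //= i; exact: ergodic_kernelS.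
Qed.

(** The fixed part is a limit point of the means of [u]. *)
Lemma ergodic_decomposition u : exists y,
  [/\ S y = y, ergodic_kernel (u - y) & nr y <= C * nr u].
Proof.
have [f [fge [y Sy fy]]] :=
  approx_fixed_subsequence (cesaro_bound ^~ u) (cesaro_sub_null u).
exists y; split => //.
- apply: ergodic_kernel_closed => d d0; have /nullP/(_ d d0)[N hN] := fy.
  exists (u - cesaro_mean (f N) u).
    by rewrite cesaro_potentialE; exact: ergodic_kernel_range.
  have := hN N (leqnn N); rewrite ger0_norm ?nr_ge0//; congr (nr _ < _).
  by rewrite opprB [RHS]addrC subrKA.
- apply/ler_addgt0Pl => e e0; have /nullP/(_ e e0)[N /(_ N (leqnn N))] := fy.
  rewrite ger0_norm ?nr_ge0// => h.
  rewrite -(subrK (cesaro_mean (f N) u) y); apply: le_trans (nrD _ _) _.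
  by rewrite lerD ?cesaro_bound// nr_distC ltW.
Qed.

(** Otherwise unit vectors of the kernel are approximately fixed, and a limit point of
    them is a fixed unit vector of the kernel. *)
Lemma ergodic_kernel_lower_bound : exists2 c : R, 0 < c &
  forall w, ergodic_kernel w -> nr w <= c * nr (w - S w).
Proof.
apply: contrapT => nc.
have /choice[w wP] : forall k : nat, exists w,
    [/\ ergodic_kernel w, nr w = 1 & nr (w - S w) <= k.+1%:R^-1].
  move=> k; apply: contrapT => nw; apply: nc; exists k.+1%:R => // w kw.
  rewrite leNgt; apply/negP => h; apply: nw.
  have w0 : 0 < nr w by apply: le_lt_trans h; rewrite mulr_ge0// nr_ge0.
  have i0 : 0 <= (nr w)^-1 by rewrite invr_ge0 ltW.
  exists ((nr w)^-1%:C *: w); split.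
  - by rewrite -[_ *: _]addr0; apply: ergodic_kernel_lin => //; exact: ergodic_kernel0.
  - by rewrite nrZ normcR// mulVf// gt_eqF.
  - rewrite (linearZ_LR S) -scalerBr nrZ normcR// mulrC ler_pdivrMr// mulrC.
    by rewrite ler_pdivlMr// mulrC ltW.
have w1 k : nr (w k) <= 1 by have [_ -> _] := wP k.
have w0 : (fun k => nr (w k - S (w k))) @ \oo --> (0 : R).
  apply: null_squeeze (null_cst_div 1) => k; rewrite nr_ge0 mul1r.
  by have [_ _ ->] := wP k.
have [f [fge [l Sl fl]]] := approx_fixed_subsequence w1 w0.
have l0 : l = 0.
  apply: ergodic_kernel_fix => //; apply: ergodic_kernel_closed => d d0.
  have /nullP/(_ d d0)[N /(_ N (leqnn N))] := fl.
  rewrite ger0_norm ?nr_ge0// nr_distC => h; exists (w (f N)) => //.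
  by have [] := wP (f N).
have /nullP/(_ 1 ltr01)[N /(_ N (leqnn N))] := fl.
by rewrite l0 subr0; have [_ -> _] := wP (f N); rewrite normr1 ltxx.
Qed.

(** The potentials solve the equation up to the means of [z], which vanish; the lower
    bound makes them a Cauchy sequence. *)
Lemma ergodic_kernel_surj z : ergodic_kernel z ->
  exists2 x, ergodic_kernel x & x - S x = z.
Proof.
move=> kz; have [c c0 hc] := ergodic_kernel_lower_bound.
pose x N := cesaro_potential N z.
have kx N : ergodic_kernel (x N) by exact: ergodic_kernel_potential.
have kB u v : ergodic_kernel u -> ergodic_kernel v -> ergodic_kernel (u - v).
  by move=> ku kv; rewrite addrC -scaleN1r; exact: ergodic_kernel_lin.
have xE N : x N - S (x N) = z - cesaro_mean N z by rewrite -cesaro_potentialE.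
have xc : nr_cauchy x.
  move=> e e0; have e2 : 0 < e / 2 / c by rewrite !divr_gt0.
  have /nullP/(_ _ e2)[N hN] := kz; exists N => i j Ni Nj.
  apply: le_lt_trans (hc _ (kB _ _ (kx i) (kx j))) _.
  have -> : x i - x j - S (x i - x j) = cesaro_mean j z - cesaro_mean i z.
    by rewrite linearB /= subrACA !xE opprB addrC subrKA.
  rewrite mulrC -ltr_pdivlMr// (splitr e) mulrDl.
  apply: le_lt_trans (nrB _ _) _.
  have := hN i Ni; have := hN j Nj; rewrite !ger0_norm ?nr_ge0//; lra.
have [l hl] := Vc xc; exists l.
  apply: ergodic_kernel_closed => d d0; have /nullP/(_ d d0)[N /(_ N (leqnn N))] := hl.
  by rewrite ger0_norm ?nr_ge0// nr_distC; exists (x N).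
apply/eqP; rewrite -subr_eq0; apply/eqP; apply: nr_small_eq0 => e e0.
have e2 : 0 < e / 2 / (1 + C) by rewrite !divr_gt0// addr_gt0.
have e2' : 0 < e / 2 by rewrite divr_gt0.
have /nullP/(_ _ e2)[N1 hN1] := hl; have /nullP/(_ _ e2')[N2 hN2] := kz.
pose n := maxn N1 N2.
have := hN1 n (leq_maxl _ _); have := hN2 n (leq_maxr _ _).
rewrite !ger0_norm ?nr_ge0//= => h2 h1.
have -> : l - S l - z = - ((x n - l) - S (x n - l)) - cesaro_mean n z.
  have -> : x n - l - S (x n - l) = (x n - S (x n)) - (l - S l).
    by rewrite linearB /= subrACA.
  by rewrite xE !opprB [RHS]addrAC subrKA.
apply: le_trans (nrB _ _) _; rewrite nrN [leRHS]splitr lerD// ?(ltW h2)//.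
apply: le_trans (nrB _ _) _; have /= := SC 1 (x n - l).
by move: h1; rewrite ltr_pdivlMr ?addr_gt0//; lra.
Qed.

(** The space splits into fixed vectors and the range of 1 - S, on which 1 - S is
    invertible: P is the spectral projection at 1, and G is the reduced resolvent. *)
Lemma reduced_resolvent : exists (P G : V -> V) (K : R),
  [/\ linear P, linear G, forall v, nr (P v) <= C * nr v
    & forall v, nr (G v) <= K * nr v] /\
  [/\ forall v, S (P v) = P v, forall v, P (S v) = P v,
    forall v, G v - S (G v) = v - P v, forall v, G (v - S v) = v - P v
    & forall v, P (G v) = 0] /\
  forall v, S v = v -> P v = v.
Proof.
have [c c0 hc] := ergodic_kernel_lower_bound.
have /choice[P /choice[G PG]] : forall u, exists y x,
    [/\ S y = y, ergodic_kernel x, x - S x = u - y & nr y <= C * nr u].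
  move=> u; have [y [Sy ky yC]] := ergodic_decomposition u.
  by have [x kx xE] := ergodic_kernel_surj ky; exists y, x.
have uniq u y x : S y = y -> ergodic_kernel x -> x - S x = u - y -> P u = y /\ G u = x.
  move=> Sy kx xE; have [SP kG GE _] := PG u.
  have kB : ergodic_kernel (G u - x).
    by rewrite addrC -scaleN1r; exact: ergodic_kernel_lin.
  have E : (G u - x) - S (G u - x) = y - P u.
    have -> : G u - x - S (G u - x) = (G u - S (G u)) - (x - S x).
      by rewrite linearB /= subrACA.
    by rewrite GE xE opprB addrC subrKA.
  have yP : y - P u = 0.
    apply: ergodic_kernel_fix; last by rewrite linearB /= Sy SP.
    by rewrite -E; exact: ergodic_kernel_range.
  split; first by apply/eqP; rewrite -subr_eq0 -opprB yP oppr0.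
  apply/eqP; rewrite -subr_eq0; apply/eqP; apply: ergodic_kernel_fix => //.
  by apply/esym/eqP; rewrite -subr_eq0 E yP.
have lin a u v : P (a *: u + v) = a *: P u + P v /\ G (a *: u + v) = a *: G u + G v.
  have [SPu kGu GEu _] := PG u; have [SPv kGv GEv _] := PG v.
  apply: uniq; [by rewrite linearP /= SPu SPv|exact: ergodic_kernel_lin|].
  rewrite linearP /= opprD addrACA -scalerBr GEu GEv.
  by rewrite scalerBr opprD addrACA.
exists P, G, (c * (1 + C)); split; [split|split; [split|]].
- by move=> a u v; have [] := lin a u v.
- by move=> a u v; have [] := lin a u v.
- by move=> v; have [] := PG v.
- move=> v; have [_ kG GE PC] := PG v.
  apply: le_trans (hc _ kG) _; rewrite GE -mulrA ler_wpM2l ?(ltW c0)//.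
  by apply: le_trans (nrB _ _) _; rewrite mulrDl mul1r lerD2l.
- by move=> v; have [] := PG v.
- move=> v; have [SP kG GE _] := PG v.
  have [] // := uniq (S v) (P v) (S (G v)) SP (ergodic_kernelS kG).
  by rewrite -linearB GE linearB /= SP.
- by move=> v; have [] := PG v.
- move=> v; have [SP kG GE _] := PG v.
  have kP : ergodic_kernel (v - P v) by rewrite -GE; exact: ergodic_kernel_range.
  by have [] // := uniq (v - S v) 0 (v - P v) (linear0 S) kP;
    rewrite linearB /= SP subr0 subrACA subrr subr0.
- move=> v; have [_ kG _ _] := PG v; have [x kx xE] := ergodic_kernel_surj kG.
  by have [] // := uniq (G v) 0 x (linear0 S) kx; rewrite subr0.
- move=> v Sv; have [] // := uniq v v 0 Sv ergodic_kernel0.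
  by rewrite linear0 !subrr.
Qed.

(** Near-fixed bounded sequences being totally bounded, the fixed space has a
    finite 1/2-net of its ball, whose span is closed and 1/2-dense at every scale. *)
Lemma fixed_finite_dimensional : finite_dimensional [set v | S v = v].
Proof.
have [n [e eP]] : exists n (e : 'I_n -> V), forall v, S v = v -> nr v <= 1 ->
    exists i, S (e i) = e i /\ nr (v - e i) < 1 / 2.
  apply: contrapT => nnet.
  have [f fP] : exists f : nat -> V, forall n, [/\ S (f n) = f n, nr (f n) <= 1 &
      forall i, (i < n)%N -> S (f i) = f i -> 1 / 2 <= nr (f n - f i)].
    apply: (@prefix_choice V 0 (fun n f x => [/\ S x = x, nr x <= 1 &
      forall i, (i < n)%N -> S (f i) = f i -> 1 / 2 <= nr (x - f i)])).
      move=> n f g x fg [h1 h2 h3]; split => // i i_n.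
      by rewrite -fg//; exact: h3.
    move=> n f; apply: contrapT => nx; apply: nnet; exists n, (fun i => f i).
    move=> v Sv v1; apply: contrapT => ni; apply: nx; exists v; split => // i i_n Sfi.
    by rewrite leNgt; apply/negP => h; apply: ni; exists (Ordinal i_n).
  have [|||i [j [ij]]] := @tb f _ _ (1 / 2).
  - by move=> k; have [] := fP k.
  - rewrite (_ : (fun _ => _) = cst 0); first exact: cvg_cst.
    by apply/funext => k; have [-> _ _] := fP k; rewrite subrr nr0.
  - by rewrite divr_gt0.
  - have [Sfi _ _] := fP i; have [_ _ h] := fP j.
    by rewrite nr_distC ltNge h.
pose e' i := if `[< S (e i) = e i >] then e i else 0.
have e'S i : S (e' i) = e' i.
  by rewrite /e'; case: asboolP => //; rewrite linear0.
have Sm m : spanned e' m -> S m = m.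
  move=> [c ->]; rewrite (linear_sum S); apply: eq_bigr => i _.
  by rewrite (linearZ_LR S) e'S.
exists n, e' => v Sv; apply: spanned_closed => d d0.
have half w : S w = w -> exists2 m, spanned e' m & nr (w - m) <= nr w / 2.
  move=> Sw; have [w0|w0] := eqVneq (nr w) 0.
    by exists 0; [exact: spanned0|rewrite subr0 w0 mul0r].
  have w_gt0 : 0 < nr w by rewrite lt_neqAle eq_sym w0 nr_ge0.
  have i0 : 0 <= (nr w)^-1 by rewrite invr_ge0 ltW.
  have [||i [Sei h]] := eP ((nr w)^-1%:C *: w).
  - by rewrite (linearZ_LR S) Sw.
  - by rewrite nrZ normcR// mulVf.
  exists ((nr w)%:C *: e' i).
    rewrite -[_ *: _]addr0; apply: spanned_lin; last exact: spanned0.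
    exists (fun j => (j == i)%:R); rewrite (bigD1 i)//= eqxx scale1r big1 ?addr0//.
    by move=> j /negbTE ->; rewrite scale0r.
  have -> : w - (nr w)%:C *: e' i = (nr w)%:C *: ((nr w)^-1%:C *: w - e i).
    rewrite scalerBr scalerA -rmorphM divff// scale1r /e'.
    by case: asboolP => // /(_ Sei).
  rewrite nrZ normcR ?nr_ge0// ler_wpM2l ?nr_ge0//.
  by move: h; rewrite mul1r => /ltW.
have [k hk] : exists k : nat, nr v / 2 ^+ k < d.
  have h2 : `|1 / 2 : R| < 1 by rewrite ger0_norm; lra.
  have dv : 0 < d / (nr v + 1) by rewrite divr_gt0// ltr_wpDl ?nr_ge0.
  have /nullP/(_ _ dv)[k /(_ k (leqnn k))] := cvg_geometric 1 h2.
  rewrite /geometric /= !mul1r ger0_norm ?exprn_ge0// ?divr_ge0// => h.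
  exists k; move: h; rewrite ltr_pdivlMr ?ltr_wpDl ?nr_ge0//; apply: le_lt_trans.
  by rewrite exprVn mulrC ler_wpM2l ?invr_ge0 ?exprn_ge0// lerDl.
suff [m ms h] : exists2 m, spanned e' m & nr (v - m) <= nr v / 2 ^+ k.
  by exists m => //; exact: le_lt_trans h hk.
elim: k {hk} => [|k [m ms h]].
  by exists 0; [exact: spanned0|rewrite subr0 expr0 divr1].
have [|m' ms' h'] := half (v - m); first by rewrite linearB /= Sv Sm.
exists (m + m'); first by have := spanned_lin 1 ms ms'; rewrite scale1r.
rewrite opprD addrA; apply: le_trans h' _.
by rewrite exprSr invfM mulrA ler_pM2r ?invr_gt0.
Qed.
End mean_ergodic.

(** * Resolvents near the unit circle *)

Lemma normcX (R : rcfType) (a : R[i]) n : normc (a ^+ n) = normc a ^+ n.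
Proof. by elim: n => [|n IH]; [exact: normc1|rewrite !exprS normcM IH]. Qed.

Section spectrum.
Variables (R : realType) (V : normedModType R[i]).
Hypothesis Vc : @nr_complete R V.

Lemma linear_pack (f : V -> V) : linear f -> exists g : {linear V -> V}, g = f :> (V -> V).
Proof.
move=> lf; pose g := GRing.isLinear.Build R[i] V V *:%R f lf.
pose h : {linear V -> V} := HB.pack f g.
by exists h.
Qed.

Lemma geometric_sum_le (q : R) n : 0 <= q < 1 -> \sum_(i < n) q ^+ i <= (1 - q)^-1.
Proof.
move=> /andP[q0 q1]; rewrite -[leRHS]mul1r ler_pdivlMr ?subr_gt0//.
have -> : (\sum_(i < n) q ^+ i) * (1 - q) = 1 - q ^+ n.
  elim: n => [|n IH]; first by rewrite big_ord0 mul0r expr0 subrr.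
  by rewrite big_ord_recr /= mulrDl IH exprS; ring.
by rewrite gerBl exprn_ge0.
Qed.

Lemma null_geometric (K q : R) : 0 <= q < 1 -> (fun n => K * q ^+ n) @ \oo --> (0 : R).
Proof. by move=> /andP[q0 q1]; apply: cvg_geometric; rewrite ger0_norm. Qed.

(** The bound on the iterates of [B] allows operators whose norm exceeds 1, such as a
    power-bounded operator divided by a number of modulus above 1. *)
Section neumann.
Variables (B : {linear V -> V}) (K q : R).
Hypotheses (K0 : 0 <= K) (q01 : 0 <= q < 1).
Hypothesis BK : forall n v, nr (iter n B v) <= K * q ^+ n * nr v.

Let q0 : 0 <= q. Proof. by case/andP: q01. Qed.

Lemma neumann_inj x : B x = x -> x = 0.
Proof.
move=> Bx; apply: nr_small_eq0 => e e0.
have /nullP/(_ e e0)[n /(_ n (leqnn n))] := null_geometric (K * nr x) q01.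
rewrite ger0_norm ?mulr_ge0 ?nr_ge0 ?exprn_ge0// => /ltW; apply: le_trans.
by have := BK n x; rewrite iter_fix// mulrAC.
Qed.

Lemma neumann_series v : exists x, x - B x = v /\
  forall n, nr (x - \sum_(i < n) iter i B v) <= K / (1 - q) * nr v * q ^+ n.
Proof.
pose s n := \sum_(i < n) iter i B v.
have tail n m : nr (s (n + m)%N - s n) <= K / (1 - q) * nr v * q ^+ n.
  have -> : s (n + m)%N - s n = \sum_(i < m) iter (n + i) B v.
    by rewrite /s big_split_ord /= addrAC subrr add0r.
  apply: le_trans (nr_sum _) _.
  apply: (@le_trans _ _ (K * nr v * q ^+ n * \sum_(i < m) q ^+ i)).
    rewrite mulr_sumr; apply: ler_sum => i _; apply: le_trans (BK _ _) _.
    rewrite exprD [X in X <= _](_ : _ = K * nr v * q ^+ n * q ^+ i)//; ring.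
  have -> : K / (1 - q) * nr v * q ^+ n = K * nr v * q ^+ n * (1 - q)^-1 by ring.
  by rewrite ler_wpM2l ?geometric_sum_le// !mulr_ge0 ?nr_ge0 ?exprn_ge0.
have nul := null_geometric (K / (1 - q) * nr v) q01.
have b0 n : 0 <= K / (1 - q) * nr v * q ^+ n.
  by apply: le_trans (tail n 0%N); exact: nr_ge0.
have sc : nr_cauchy s.
  move=> e e0; have e2 : 0 < e / 2 by rewrite divr_gt0.
  have /nullP/(_ _ e2)[N /(_ N (leqnn N))] := nul.
  rewrite ger0_norm// => hN; exists N => i j Ni Nj.
  apply: le_lt_trans (nr_triangle (s N) _ _) _; rewrite [ltRHS]splitr ltrD//.
    by apply: le_lt_trans hN; rewrite -(subnKC Ni); exact: tail.
  by apply: le_lt_trans hN; rewrite nr_distC -(subnKC Nj); exact: tail.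
have [x hx] := Vc sc; exists x.
have xs n : nr (x - s n) <= K / (1 - q) * nr v * q ^+ n.
  apply/ler_addgt0Pl => e e0; have /nullP/(_ e e0)[N hN] := hx.
  have := hN (n + N)%N (leq_addl _ _); rewrite ger0_norm ?nr_ge0// nr_distC => h.
  by apply: le_trans (nr_triangle (s (n + N)%N) _ _) _; rewrite lerD ?tail// ltW.
split => //; apply/eqP; rewrite -subr_eq0; apply/eqP; apply: nr_small_eq0 => e e0.
have K1 : 0 < 1 + K * q by rewrite ltr_pwDl// mulr_ge0.
have eK : 0 < e / (1 + K * q) by rewrite divr_gt0.
have /nullP/(_ _ eK)[N hN] := nul.
have := hN N (leqnn N); have := hN N.+1 (leqnSn N); rewrite !ger0_norm// => h1 h2.
have -> : x - B x - v = (x - s N.+1) - B (x - s N).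
  rewrite linearB /= subrACA; congr (_ - _).
  by rewrite /s big_ord_recl /= linear_sum /= addrK.
apply: le_trans (nrB _ _) _.
have := BK 1 (x - s N); rewrite /= expr1 => h3.
have h4 := xs N; have h5 := xs N.+1.
move: h1 h2; rewrite !ltr_pdivlMr// => h1 h2.
have : K * q * nr (x - s N) <= K * q * (K / (1 - q) * nr v * q ^+ N).
  by rewrite ler_wpM2l// mulr_ge0.
move: h1 h2 h5 h4; set a := _ * q ^+ N.+1; set b := _ * q ^+ N => h1 h2 h5 h4 h6.
have ab : a <= b.
  have -> : a = q * b by rewrite /a /b exprS; ring.
  rewrite ler_piMl ?b0//.
  by case/andP: q01 => _ /ltW.
nra.
Qed.
End neumann.

Lemma opnorm_cvg0 (f : nat -> V -> V) (K q : R) : 0 <= q < 1 ->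
  (forall n v, nr (f n v) <= K * nr v * q ^+ n) ->
  opnorm (f n) @[n --> \oo] --> 0%E.
Proof.
move=> q01 h; have [q0 _] := andP q01.
apply: (@squeeze_cvge _ _ _ _ (cst 0%E) _ (fun n => (`|K| * q ^+ n)%:E)).
- apply: nearW => n; rewrite opnorm_ge0 /=; apply: opnorm_le => v v1.
  apply: le_trans (h n v) _; rewrite ler_wpM2r ?exprn_ge0//.
  apply: le_trans (ler_wpM2r (nr_ge0 v) (ler_norm K)) _.
  by rewrite -[leRHS]mulr1 ler_wpM2l.
- exact: cvg_cst.
- by apply/cvg_EFin; [exact: nearW|exact: null_geometric].
Qed.

Lemma is_resolvent_of_right_inverse (T S : {linear V -> V}) (z : R[i]) (K : R) :
  (forall v, nr (S v) <= K * nr v) -> (forall v, z *: v = T v -> v = 0) ->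
  (forall v, z *: S v - T (S v) = v) -> is_resolvent T z S.
Proof.
move=> SK inj h; split => //; first exact: opnorm_lty SK.
move=> v; apply/eqP; rewrite -subr_eq0; apply/eqP/inj/eqP; rewrite -subr_eq0.
by apply/eqP; rewrite scalerBr (linearB T) /= subrACA h subrr.
Qed.

Definition good_point (T : V -> V) (z : R[i]) := resolvent_set T z \/
  [/\ resolvent_pole T z, eigenvalue_op T z & finite_algebraic_multiplicity T z].

(** The resolvent at [l + h], where [T] splits at [l] as in [reduced_resolvent]: it is
    [P / h] on the eigenspace and a Neumann series in [h G] on the complement. *)
Section local_resolvent.
Variables (T P G : {linear V -> V}) (l : R[i]) (C K : R).
Hypotheses (C0 : 0 <= C) (K0 : 0 <= K).
Hypothesis PC : forall v, nr (P v) <= C * nr v.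
Hypothesis GK : forall v, nr (G v) <= K * nr v.
Hypothesis TP : forall v, T (P v) = l *: P v.
Hypothesis PT : forall v, P (T v) = l *: P v.
Hypothesis AG : forall v, l *: G v - T (G v) = v - P v.
Hypothesis GA : forall v, G (l *: v - T v) = v - P v.
Hypothesis PG : forall v, P (G v) = 0.
Hypothesis Pfix : forall v, T v = l *: v -> P v = v.
Hypothesis fin : finite_dimensional [set v | T v = l *: v].

Let PP v : P (P v) = P v. Proof. by apply: Pfix; rewrite TP. Qed.

(** The pole is simple: [P] is the identity on eigenvectors and kills the range of
    [l - T], so no nonzero vector is in both. *)
Lemma generalized_eigenvector n v :
  iter n (fun w => l *: w - T w) v = 0 -> T v = l *: v.
Proof.
have sq w : l *: (l *: w - T w) - T (l *: w - T w) = 0 -> l *: w - T w = 0.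
  set u := l *: w - T w => /eqP; rewrite subr_eq0 => /eqP Tu.
  by rewrite -(Pfix (esym Tu)) linearB linearZ_LR /= PT subrr.
have lin m w : iter m (fun w => l *: w - T w) w = 0 -> l *: w - T w = 0.
  elim: m w => [w /= ->|m IH w]; first by rewrite scaler0 linear0 subrr.
  by rewrite iterSr => /IH; exact: sq.
by move=> /lin /eqP; rewrite subr_eq0 => /eqP.
Qed.

Lemma local_resolvent_exists h : h != 0 -> normc h * K < 1 ->
  exists2 S : {linear V -> V}, is_resolvent T (l + h) S &
  forall n v, nr (S v - (h^-1 *: P v + \sum_(i < n) ((- h) ^+ i) *: iter i.+1 G v)) <=
    K / (1 - normc h * K) * nr v * (normc h * K) ^+ n.
Proof.
move=> h0 hK; have q01 : 0 <= normc h * K < 1 by rewrite hK mulr_ge0 ?normc_ge0.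
pose B : {linear V -> V} := (- h) \*: G.
have iterB n v : iter n B v = (- h) ^+ n *: iter n G v.
  elim: n => [|n IH]; first by rewrite scale1r.
  by rewrite iterS IH /B /= linearZ_LR /= scalerA -exprS.
have BK n v : nr (iter n B v) <= 1 * (normc h * K) ^+ n * nr v.
  rewrite mul1r; elim: n => [|n IH]; first by rewrite mul1r.
  rewrite iterS /B /= nrZ normcN exprS -!mulrA ler_wpM2l ?normc_ge0//.
  by apply: le_trans (GK _) _; rewrite ler_wpM2l// mulrA.
have /choice[X XP] := neumann_series ler01 q01 BK.
have XB v : X v + h *: G (X v) = v.
  by have [E _] := XP v; rewrite -[RHS]E /B /= scaleNr opprK.
have Binj := neumann_inj ler01 q01 BK.
have Xlin : linear X.
  move=> a u v; apply/eqP; rewrite -subr_eq0; apply/eqP/Binj.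
  apply/eqP; rewrite /B /= scaleNr eq_sym -addr_eq0; apply/eqP.
  rewrite (linearB G) (linearP G) scalerBr addrACA -opprD XB scalerDr scalerA.
  by rewrite [h * a]mulrC -scalerA addrACA -scalerDr !XB subrr.
have Slin : linear (fun v => h^-1 *: P v + G (X v)).
  move=> a u v; rewrite (linearP P) Xlin (linearP G) !scalerDr /= addrACA.
  by rewrite !scalerA [h^-1 * a]mulrC.
have [S SE] := linear_pack Slin.
have q1 : 0 < 1 - normc h * K by rewrite subr_gt0.
have SX v : S v = h^-1 *: P v + G (X v) by rewrite SE.
exists S.
  apply: (@is_resolvent_of_right_inverse _ _ _ (normc h^-1 * C + K / (1 - normc h * K))).
  - move=> v; rewrite SX mulrDl; apply: le_trans (nrD _ _) _; apply: lerD.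
      by rewrite nrZ -mulrA ler_wpM2l ?normc_ge0.
    apply: le_trans (GK _) _; rewrite -mulrA ler_wpM2l//.
    have [_ /(_ 0%N)] := XP v; rewrite big_ord0 subr0 expr0 mulr1; by rewrite mul1r.
  - move=> v; rewrite scalerDl => hv.
    have Av : l *: v - T v = - h *: v by rewrite -hv opprD addrA subrr sub0r scaleNr.
    have Pv0 : P v = 0.
      have : P (l *: v - T v) = 0 by rewrite linearB linearZ_LR /= PT subrr.
      rewrite Av linearZ_LR /= => /eqP; rewrite scaler_eq0 oppr_eq0 (negbTE h0) /=.
      by move/eqP.
    by apply: Binj; have := GA v; rewrite Av linearZ_LR Pv0 subr0.
  - move=> v; rewrite SX scalerDl !scalerDr (linearD T) (linearZ_LR T) /= TP.
    have PX : P (X v) = P v.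
      by have := congr1 P (XB v); rewrite linearD linearZ_LR /= PG scaler0 addr0.
    have -> : h *: (h^-1 *: P v) = P v by rewrite scalerA divff// scale1r.
    rewrite [l *: (h^-1 *: _)]scalerA [l * _]mulrC -scalerA.
    set a := h^-1 *: _; set b := l *: G _; set c := T _; set d := h *: _; set e := P v.
    have -> : a + b + (e + d) - (a + c) = (b - c) + d + e.
      by rewrite addrAC opprD [a + b + _]addrACA subrr add0r [e + d]addrC addrA.
    by rewrite /b /c AG PX /d /e addrAC subrK XB.
move=> n v; rewrite SX opprD addrACA subrr add0r.
have -> : G (X v) - \sum_(i < n) (- h) ^+ i *: iter i.+1 G v =
    G (X v - \sum_(i < n) iter i B v).
  rewrite (linearB G) (linear_sum G) /=; congr (_ - _); apply: eq_bigr => i _.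
  by rewrite iterB (linearZ_LR G).
apply: le_trans (GK _) _; rewrite -!mulrA ler_wpM2l//.
have [_ /(_ n)] := XP v; by rewrite !mulrA mul1r.
Qed.

Lemma good_neighbourhood : exists2 r : R, 0 < r &
  forall z, normc (z - l) < r -> good_point T z.
Proof.
have r0 : 0 < (K + 1)^-1 by rewrite invr_gt0 ltr_wpDl.
have small z : normc (z - l) < (K + 1)^-1 -> normc (z - l) * K < 1.
  rewrite -[(K + 1)^-1]mul1r ltr_pdivlMr ?ltr_wpDl//; apply: le_lt_trans.
  by rewrite ler_wpM2l ?normc_ge0// lerDl.
exists (K + 1)^-1 => // z zl.
have [->|zl0] := eqVneq z l; last first.
  left; have [|S SR _] := local_resolvent_exists _ (small z zl).
    by rewrite subr_eq0.
  by exists S; move: SR; rewrite addrC subrK.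
have [P0|/existsNP[v /eqP Pv]] := pselect (forall v, P v = 0).
  left; exists G; split; first exact: opnorm_lty GK.
    by move=> v; rewrite GA P0 subr0.
  by move=> v; rewrite AG P0 subr0.
right; split.
- exists 1%N.
  have /choice[A AE] : forall j, exists A : {linear V -> V},
      forall v, A v = if j is i.+1 then (-1) ^+ i *: iter i.+1 G v else P v.
    case=> [|i]; first by exists P.
    have lin : linear (fun v => (-1) ^+ i *: iter i.+1 G v).
      move=> a u w; rewrite iter_lin scalerDr !scalerA; congr (_ *: _ + _).
      exact: mulrC.
    by have [A AE] := linear_pack lin; exists A => w; rewrite AE.
  exists A, (K + 1)^-1; split => //.
  + case=> [|i]; first by apply: (@opnorm_lty _ _ _ C) => w; rewrite AE.
    apply: (@opnorm_lty _ _ _ (K ^+ i.+1)) => w; rewrite AE.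
    rewrite nrZ normcX normcN normc1 expr1n mul1r; elim: i.+1 => [|n IH]; first by rewrite mul1r.
    by rewrite iterS exprS -mulrA; apply: le_trans (GK _) _; rewrite ler_wpM2l.
  + by exists v; rewrite AE; exact/eqP.
  + move=> {zl}z; rewrite (_ : `|z - l| = (normc (z - l))%:C)//.
    rewrite -[0]/(0%:C) !ltcR => /andP[zl0 zl].
    have h0 : z - l != 0 by apply: contraTneq zl0 => ->; rewrite normc0 ltxx.
    have [S SR SE] := local_resolvent_exists h0 (small z zl).
    exists S; first by move: SR; rewrite addrC subrK.
    have q01 : 0 <= normc (z - l) * K < 1 by rewrite small// mulr_ge0 ?normc_ge0.
    rewrite -(cvg_shiftS _); apply: (opnorm_cvg0 q01) => n w.
    apply: le_trans (SE n w); rewrite big_ord_recl /= AE.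
    rewrite (_ : (z - l) ^ (0%:Z - 1%:Z) = (z - l)^-1)//.
    rewrite (eq_bigr (fun i : 'I_n => (- (z - l)) ^+ i *: iter i.+1 G w))// => i _.
    rewrite AE scalerA (_ : i.+1%:Z - 1%:Z = i%:Z); last by rewrite -addn1 PoszD addrK.
    by rewrite -exprnP mulrC -exprMn mulN1r.
- by exists (P v) => //; exact: TP.
- case: fin => n [e he]; exists n, e => w [m hm]; apply: he.
  exact: generalized_eigenvector hm.
Qed.

End local_resolvent.

Section peripheral_spectrum.
Variables (T : {linear V -> V}) (C : R).
Hypothesis C1 : 1 <= C.
Hypothesis TC : forall n v, nr (iter n T v) <= C * nr v.

Lemma outside_disc z : 1 < normc z -> resolvent_set T z.
Proof.
move=> z1; have z_gt0 : 0 < normc z by exact: lt_trans z1.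
have C0 : 0 <= C by exact: le_trans C1.
have z0 : z != 0 by apply: contraTneq z_gt0 => ->; rewrite normc0 ltxx.
pose B : {linear V -> V} := z^-1 \*: T.
have iterB n v : iter n B v = z^-1 ^+ n *: iter n T v.
  elim: n => [|n IH]; first by rewrite scale1r.
  by rewrite iterS IH /B /= linearZ_LR /= scalerA -exprS.
have q01 : 0 <= (normc z)^-1 < 1 by rewrite invr_ge0 ltW//= invf_lt1.
have BK n v : nr (iter n B v) <= C * (normc z)^-1 ^+ n * nr v.
  rewrite iterB nrZ normcX normcV mulrAC mulrC ler_wpM2r ?TC//.
  by rewrite exprn_ge0// invr_ge0 ltW.
have /choice[X XP] := neumann_series C0 q01 BK.
have XB v : X v - z^-1 *: T (X v) = v by have [] := XP v.
have inj v : B v = v -> v = 0 := neumann_inj C0 q01 BK (x := v).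
have XR v : z *: (z^-1 *: X v) - T (z^-1 *: X v) = v.
  by rewrite scalerA divff// scale1r linearZ_LR XB.
exists (fun v => z^-1 *: X v); split => //.
- apply: (@opnorm_lty _ _ _ ((normc z)^-1 * (C / (1 - (normc z)^-1)))) => v.
  rewrite nrZ normcV -mulrA ler_wpM2l ?invr_ge0 ?normc_ge0//.
  by have [_ /(_ 0%N)] := XP v; rewrite big_ord0 subr0 expr0 mulr1.
- move=> v; apply/eqP; rewrite -subr_eq0; apply/eqP/inj.
  set u := _ - v; have : z *: u - T u = 0.
    by rewrite /u scalerBr (linearB T) subrACA XR subrr.
  move=> /eqP; rewrite subr_eq0 => /eqP Tu.
  by rewrite /B /= -Tu scalerA mulVf// scale1r.
Qed.

(** Rotating [T] by [l] moves the spectral point [l] to 1. *)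
Lemma unimodular_good (l : R[i]) : normc l = 1 ->
  (forall w : nat -> V, (forall k, nr (w k) <= 1) ->
    (fun k => nr (l *: w k - T (w k))) @ \oo --> (0 : R) ->
    forall d : R, 0 < d -> exists i j, (i < j)%N /\ nr (w i - w j) < d) ->
  exists2 r : R, 0 < r & forall z, normc (z - l) < r -> good_point T z.
Proof.
move=> l1 tb.
have l0 : l != 0 by apply: contra_eqN l1 => /eqP ->; rewrite normc0 eq_sym oner_eq0.
have C0 : 0 <= C by exact: le_trans C1.
pose S : {linear V -> V} := l^-1 \*: T.
have TS v : T v = l *: S v by rewrite /S /= scalerA divff// scale1r.
have iterS n v : iter n S v = l^-1 ^+ n *: iter n T v.
  elim: n => [|n IH]; first by rewrite scale1r.
  by rewrite iterS IH /S /= linearZ_LR /= scalerA -exprS.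
have SC n v : nr (iter n S v) <= C * nr v.
  by rewrite iterS nrZ normcX normcV l1 invr1 expr1n mul1r.
have Stb w : (forall k, nr (w k) <= 1) ->
    (fun k => nr (w k - S (w k))) @ \oo --> (0 : R) ->
    forall d : R, 0 < d -> exists i j, (i < j)%N /\ nr (w i - w j) < d.
  move=> w1 w0; apply: tb => //.
  rewrite (_ : (fun k => _) = (fun k => nr (w k - S (w k))))//.
  by apply/funext => k; rewrite TS -scalerBr nrZ l1 mul1r.
have [P' [G' [K [[lP lG PC GK] [[SP PS SG GS PG] Pfix]]]]] :=
  reduced_resolvent Vc C1 SC Stb.
have [P PE] := linear_pack lP.
have lG' : linear (fun v => l^-1 *: G' v).
  by move=> a u v; rewrite lG scalerDr !scalerA [l^-1 * a]mulrC.
have [G GE] := linear_pack lG'.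
have GE' v : G v = l^-1 *: G' v by rewrite GE.
apply: (@good_neighbourhood T P G l C `|K|) => //.
- by move=> v; rewrite PE.
- move=> v; rewrite GE' nrZ normcV l1 invr1 mul1r; apply: le_trans (GK v) _.
  by rewrite ler_wpM2r ?nr_ge0// ler_norm.
- by move=> v; rewrite PE TS SP.
- by move=> v; rewrite TS (linearZ_LR P) PE PS.
- by move=> v; rewrite TS -scalerBr GE' (linearZ_LR S) -scalerBr scalerA divff// scale1r PE SG.
- by move=> v; rewrite TS -scalerBr (linearZ_LR G) GE' scalerA divff// scale1r PE GS.
- by move=> v; rewrite GE' (linearZ_LR P) PE PG scaler0.
- by move=> v Tv; rewrite PE; apply: Pfix; rewrite /S /= Tv scalerA mulVf// scale1r.
- have [n [e he]] := fixed_finite_dimensional Stb.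
  exists n, e => v /= Tv; have h := he v; apply: h => /=.
  by rewrite Tv scalerA mulVf// scale1r.
Qed.

(** Bad points accumulate, by compactness of the closed disc, at a point of the
    unit circle, all of whose neighbours are good. *)
Theorem ess_spectral_radius_lt1 :
  (forall l : R[i], normc l = 1 -> forall w : nat -> V, (forall k, nr (w k) <= 1) ->
    (fun k => nr (l *: w k - T (w k))) @ \oo --> (0 : R) ->
    forall d : R, 0 < d -> exists i j, (i < j)%N /\ nr (w i - w j) < d) ->
  (ess_spectral_radius T < 1)%E.
Proof.
move=> tb.
suff [r r1 Tr] : exists2 r : R, r < 1 & ess_bound T r.
  apply: (@le_lt_trans _ _ r%:E); last by rewrite lte_fin.
  by apply: ereal_inf_lbound; exists r.
apply: contrapT => nr1.
have /choice[z zP] : forall k : nat, exists z, 1 - k.+1%:R^-1 < normc z /\ ~ good_point T z.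
  move=> k; apply: contrapT => nz; apply: nr1; exists (1 - k.+1%:R^-1).
    by rewrite gtrBl invr_gt0.
  split; first by rewrite subr_ge0 invf_le1// ler1n.
  move=> z; rewrite (_ : `|z| = (normc z)%:C)// ltcR => zk.
  by apply: contrapT => ng; apply: nz; exists z.
have z1 k : normc (z k) <= 1.
  rewrite leNgt; apply/negP => /outside_disc zk.
  by have [_ []] := zP k; left.
have [f [fge [l zl]]] := complex_bolzano_weierstrass z1.
have l1 : normc l = 1.
  apply/eqP; rewrite -subr_eq0 -normr_eq0 eq_le normr_ge0 andbT.
  apply/ler_addgt0Pl => e e0; rewrite addr0.
  have e2 : 0 < e / 2 by rewrite divr_gt0.
  have /nullP/(_ _ e2)[N1 hN1] := zl.
  have /nullP/(_ _ e2)[N2 hN2] := @cvg_harmonic R.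
  pose N := maxn N1 N2.
  have h1 := hN1 N (leq_maxl _ _); rewrite ger0_norm ?normc_ge0//= in h1.
  have h2 := hN2 (f N) (leq_trans (leq_maxr _ _) (fge _)).
  rewrite ger0_norm ?harmonic_ge0//= in h2.
  have [h3 _] := zP (f N); have h4 := z1 (f N).
  have h5 : normc l <= normc (z (f N)) + normc (z (f N) - l).
    have := normcD (z (f N)) (- (z (f N) - l)); rewrite normcN subKr; exact.
  have h6 : normc (z (f N)) <= normc l + normc (z (f N) - l).
    by have := normcD l (z (f N) - l); rewrite addrC subrK.
  move: h1 h2 h3 h4 h5 h6 e0; rewrite ler_norml; move: (normc (z (f N) - l)) (normc l).
  by move: (normc (z (f N))) ((f N).+1%:R^-1) => a b c g; lra.
have [r r0 hr] := unimodular_good l1 (tb l l1).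
have /nullP/(_ _ r0)[N /(_ N (leqnn N))] := zl.
rewrite ger0_norm ?normc_ge0// => /hr.
by have [] := zP (f N).
Qed.
End peripheral_spectrum.

End spectrum.

(** * The real vector lattice inside the complex Lp space *)

Lemma filterS4 (T : Type) (F : set_system T) : Filter F ->
  forall P1 P2 P3 P4 Q : set T,
  (forall x, P1 x -> P2 x -> P3 x -> P4 x -> Q x) ->
  F P1 -> F P2 -> F P3 -> F P4 -> F Q.
Proof.
move=> ? P1 P2 P3 P4 Q h h1 h2 h3 h4.
apply: filterS (filterI (filterI h1 h2) (filterI h3 h4)) => x [[? ?] [? ?]]; exact: h.
Qed.

Lemma filterS5 (T : Type) (F : set_system T) : Filter F ->
  forall P1 P2 P3 P4 P5 Q : set T,
  (forall x, P1 x -> P2 x -> P3 x -> P4 x -> P5 x -> Q x) ->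
  F P1 -> F P2 -> F P3 -> F P4 -> F P5 -> F Q.
Proof.
move=> ? P1 P2 P3 P4 P5 Q h h1 h2 h3 h4 h5.
apply: filterS2 (filterI (filterI h1 h2) (filterI h3 h4)) h5 => x [[? ?] [? ?]] ?.
exact: h.
Qed.

Section Lp_lattice.
Context d (X : measurableType d) (R : realType).
Variables (mu : {measure set X -> \bar R}) (p : R) (p1 : 1 <= p).
Local Notation E := (Lp mu p1).
Implicit Types (u v w : E) (f g : X -> R) (h k : X -> R[i]).

Let p0 : 0 < p. Proof. exact: lt_le_trans p1. Qed.

Lemma measurable_normcX h : measurable_cfun h ->
  measurable_fun [set: X] (fun x => (normc (h x) `^ p)%:E).
Proof.
move=> mh; apply/measurable_EFinP; apply: (measurableT_comp (measurable_powR p)).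
exact: measurable_normc.
Qed.

Lemma Lp_normE h : Lp_norm mu p h = ((\int[mu]_x (normc (h x) `^ p)%:E) `^ p^-1)%E.
Proof.
rewrite /Lp_norm Lnorm.unlock /=; apply: (congr1 (fun z => z `^ p^-1)%E).
apply: eq_integral => x _; congr (_ `^ _)%:E; exact: ger0_norm (normc_ge0 _).
Qed.

Lemma Lp_norm_powE h : (Lp_norm mu p h `^ p)%E = (\int[mu]_x (normc (h x) `^ p)%:E)%E.
Proof.
rewrite Lp_normE -poweRrM mulVf ?gt_eqF// poweRe1//.
by apply: integral_ge0 => x _; rewrite lee_fin powR_ge0.
Qed.

Lemma Lp_norm_ae_le h k : measurable_cfun h -> measurable_cfun k ->
  (\forall x \ae mu, normc (h x) <= normc (k x)) ->
  (Lp_norm mu p h <= Lp_norm mu p k)%E.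
Proof.
move=> mh mk hk; rewrite !Lp_normE; have i0 (w : X -> R[i]) :
    (0 <= \int[mu]_x (normc (w x) `^ p)%:E)%E.
  by apply: integral_ge0 => x _; rewrite lee_fin powR_ge0.
have i0' (w : X -> R[i]) : (\int[mu]_x (normc (w x) `^ p)%:E)%E \in `[0%E, +oo%E].
  by rewrite in_itv /= i0 leey.
apply: (gt0_ler_poweR _ (i0' h) (i0' k)); first by rewrite invr_ge0 ltW.
apply: ae_ge0_le_integral => //.
- by move=> x _; rewrite lee_fin powR_ge0.
- exact: measurable_normcX.
- by move=> x _; rewrite lee_fin powR_ge0.
- exact: measurable_normcX.
- apply: filterS hk => x hk _; rewrite lee_fin.
  by apply: ge0_ler_powR; rewrite ?nnegrE ?normc_ge0// ltW.
Qed.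

Lemma nr_LpE u : (nr u)%:E = Lp_norm mu p (Lp_repr u).
Proof. exact: Lp_norm_fin. Qed.

Lemma nr_pow u : (nr u `^ p)%:E = (\int[mu]_x (normc (Lp_repr u x) `^ p)%:E)%E.
Proof. by rewrite -Lp_norm_powE -nr_LpE. Qed.

Lemma measurable_repr u : measurable_cfun (Lp_repr u).
Proof. by have [] := Lp_reprP u. Qed.

Lemma nr_ae_le u v :
  (\forall x \ae mu, normc (Lp_repr u x) <= normc (Lp_repr v x)) -> nr u <= nr v.
Proof.
move=> uv; rewrite -lee_fin !nr_LpE.
by apply: Lp_norm_ae_le => //; exact: measurable_repr.
Qed.

Lemma Lp_eq u v : (\forall x \ae mu, Lp_repr u x = Lp_repr v x) -> u = v.
Proof. by move=> uv; rewrite -[u]reprK -[v]reprK; exact/eqP/Lp_eqmodP. Qed.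

Lemma Lp_repr0 : \forall x \ae mu, Lp_repr (0 : E) x = 0.
Proof.
have -> : (0 : E) = 0 *: 0 by rewrite scale0r.
by apply: filterS (Lp_reprZ 0 (0 : E)) => x ->; rewrite mul0r.
Qed.

Lemma Lp_reprN u : \forall x \ae mu, Lp_repr (- u) x = - Lp_repr u x.
Proof.
by rewrite -scaleN1r; apply: filterS (Lp_reprZ (-1) u) => x ->; rewrite mulN1r.
Qed.

Lemma Lp_reprB u v : \forall x \ae mu, Lp_repr (u - v) x = Lp_repr u x - Lp_repr v x.
Proof. by apply: filterS2 (Lp_reprD u (- v)) (Lp_reprN v) => x -> ->. Qed.

Lemma measurable_cfunB h k : measurable_cfun h -> measurable_cfun k ->
  measurable_cfun (fun x => h x - k x).
Proof.
move=> mh mk; have := measurable_cfunD mh (measurable_cfunZ (-1) mk).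
congr measurable_cfun; apply/funext => x /=.
by rewrite !fctE; congr (_ + _); exact: mulN1r.
Qed.

Lemma Lp_pred_le h k : measurable_cfun h -> k \in Lp_pred mu p1 ->
  (forall x, normc (h x) <= normc (k x)) -> h \in Lp_pred mu p1.
Proof.
move=> mh /LpP[mk koo] hk; apply/LpP; split => //.
by apply: le_lt_trans koo; apply: Lp_norm_ae_le => //; exact: nearW.
Qed.

Definition Lp_class h : E := \pi_E (insubd (0 : Lp_fun mu p1) h).

Lemma Lp_class_repr h : h \in Lp_pred mu p1 -> \forall x \ae mu, Lp_repr (Lp_class h) x = h x.
Proof.
move=> hL; apply: filterS (Lp_repr_pi (insubd (0 : Lp_fun mu p1) h)) => x ->.
by rewrite -[in RHS](insubdK (0 : Lp_fun mu p1) hL).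
Qed.

Lemma Lp_repr_in u : Lp_repr u \in Lp_pred mu p1.
Proof. exact/LpP/Lp_reprP. Qed.

Definition real_fun f : X -> R[i] := fun x => (f x)%:C.

(** Estimates are made on honest real functions, for which order and lattice operations
    are pointwise, and are transported to the space by [J]. *)
Definition real_Lp : set (X -> R) := [set f | real_fun f \in Lp_pred mu p1].

Definition J f : E := Lp_class (real_fun f).

Lemma normc_real (x : R) : normc x%:C = `|x|.
Proof. by rewrite /= expr0n /= addr0 sqrtr_sqr. Qed.

Lemma J_repr f : real_Lp f -> \forall x \ae mu, Lp_repr (J f) x = (f x)%:C.
Proof. exact: Lp_class_repr. Qed.

Lemma measurable_real_fun f : measurable_fun [set: X] f -> measurable_cfun (real_fun f).
Proof. by move=> mf; split => //=; exact: measurable_cst. Qed.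

Lemma real_Lp_measurable f : real_Lp f -> measurable_fun [set: X] f.
Proof. by move=> /LpP[[]]. Qed.

Lemma real_Lp0 : real_Lp (fun=> 0).
Proof.
by apply: (_ : (0 : X -> R[i]) \in Lp_pred mu p1); exact: rpred0.
Qed.

Lemma real_Lp_lin a f g : real_Lp f -> real_Lp g -> real_Lp (fun x => a * f x + g x).
Proof.
move=> fL gL; rewrite /real_Lp /=.
have -> : real_fun (fun x => a * f x + g x) = a%:C *: real_fun f + real_fun g.
  by apply/funext => x; rewrite /real_fun rmorphD rmorphM.
by apply: rpredD => //; exact: rpredZ.
Qed.

Lemma real_LpD f g : real_Lp f -> real_Lp g -> real_Lp (fun x => f x + g x).
Proof.
move=> fL gL; have := real_Lp_lin 1 fL gL; congr real_Lp.
by apply/funext => x; rewrite mul1r.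
Qed.

Lemma real_LpZ a f : real_Lp f -> real_Lp (fun x => a * f x).
Proof.
move=> fL; have := real_Lp_lin a fL real_Lp0; congr real_Lp.
by apply/funext => x; rewrite addr0.
Qed.

Lemma real_LpB f g : real_Lp f -> real_Lp g -> real_Lp (fun x => f x - g x).
Proof.
move=> fL gL; have := real_Lp_lin (-1) gL fL; congr real_Lp.
by apply/funext => x; rewrite mulN1r addrC.
Qed.

Lemma real_Lp_le f g : measurable_fun [set: X] f -> real_Lp g ->
  (forall x, `|f x| <= `|g x|) -> real_Lp f.
Proof.
move=> mf gL fg; apply: Lp_pred_le gL _; first exact: measurable_real_fun.
by move=> x; rewrite !normc_real.
Qed.

Lemma real_Lp_abs f : real_Lp f -> real_Lp (fun x => `|f x|).
Proof.
move=> fL; apply: (real_Lp_le _ fL) => [|x]; last by rewrite normr_id.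
by apply: measurableT_comp => //; exact: real_Lp_measurable.
Qed.

Lemma real_Lp_pos f : real_Lp f -> real_Lp (fun x => Num.max (f x) 0).
Proof.
move=> fL; apply: (real_Lp_le _ fL) => [|x].
  by apply: measurable_maxr => //; exact: real_Lp_measurable.
by rewrite /Num.max; case: ifPn => // _; rewrite normr0.
Qed.

Lemma J_lin a f g : real_Lp f -> real_Lp g ->
  J (fun x => a * f x + g x) = a%:C *: J f + J g.
Proof.
move=> fL gL; apply: Lp_eq.
have h1 := J_repr (real_Lp_lin a fL gL); have h2 := J_repr fL; have h3 := J_repr gL.
have h4 := Lp_reprD (a%:C *: J f) (J g); have h5 := Lp_reprZ a%:C (J f).
apply: filterS5 h1 h2 h3 h4 h5 => x -> E2 E3 -> ->.
by rewrite E2 E3 rmorphD rmorphM.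
Qed.

Lemma J0 : J (fun=> 0) = 0.
Proof. by apply: Lp_eq; apply: filterS2 (J_repr real_Lp0) Lp_repr0 => x -> ->. Qed.

Lemma JD f g : real_Lp f -> real_Lp g -> J (fun x => f x + g x) = J f + J g.
Proof.
move=> fL gL; have := J_lin 1 fL gL; rewrite scale1r => <-; congr J.
by apply/funext => x; rewrite mul1r.
Qed.

Lemma JZ a f : real_Lp f -> J (fun x => a * f x) = a%:C *: J f.
Proof.
move=> fL; have := J_lin a fL real_Lp0; rewrite J0 addr0 => <-; congr J.
by apply/funext => x; rewrite addr0.
Qed.

Lemma JB f g : real_Lp f -> real_Lp g -> J (fun x => f x - g x) = J f - J g.
Proof.
move=> fL gL; have := J_lin (-1) gL fL; rewrite rmorphN1 scaleN1r addrC => <-; congr J.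
by apply/funext => x; rewrite mulN1r addrC.
Qed.

Lemma J_ae_eq f g : real_Lp f -> real_Lp g -> (\forall x \ae mu, f x = g x) -> J f = J g.
Proof.
move=> fL gL fg; apply: Lp_eq.
by apply: filterS3 (J_repr fL) (J_repr gL) fg => x -> -> ->.
Qed.

Lemma nr_J_abs f : real_Lp f -> nr (J (fun x => `|f x|)) = nr (J f).
Proof.
move=> fL; apply/eqP; rewrite eq_le.
by apply/andP; split; apply: nr_ae_le;
  apply: filterS2 (J_repr fL) (J_repr (real_Lp_abs fL)) => x -> ->; rewrite !normc_real normr_id.
Qed.

Lemma J_nonneg f : real_Lp f -> (\forall x \ae mu, 0 <= f x) -> Lp_nonneg (J f).
Proof. by move=> fL f0; apply: filterS2 (J_repr fL) f0 => x -> ?; rewrite lecR. Qed.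

Lemma nonnegD u v : Lp_nonneg u -> Lp_nonneg v -> Lp_nonneg (u + v).
Proof.
by move=> u0 v0; apply: filterS3 (Lp_reprD u v) u0 v0 => x -> ? ?; exact: addr_ge0.
Qed.

Lemma nonnegZ (a : R) u : 0 <= a -> Lp_nonneg u -> Lp_nonneg (a%:C *: u).
Proof.
move=> a0 u0; apply: filterS2 (Lp_reprZ a%:C u) u0 => x -> ?.
by rewrite mulr_ge0// lecR.
Qed.

Lemma nonneg0 : Lp_nonneg (0 : E).
Proof. by apply: filterS Lp_repr0 => x ->. Qed.

(** Two-sided domination by v forces u to be real with modulus at most v. *)
Lemma nr_le_dominated u v : Lp_nonneg (v - u) -> Lp_nonneg (v + u) -> nr u <= nr v.
Proof.
move=> h1 h2; apply: nr_ae_le.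
apply: filterS4 h1 h2 (Lp_reprB v u) (Lp_reprD v u) => x + + E1 E2; rewrite E1 E2.
case: (Lp_repr u x) (Lp_repr v x) => [a b] [c e].
rewrite !lecE /= => /andP[/eqP h3 h4] /andP[/eqP h5 h6].
have -> : b = 0 by lra.
have -> : e = 0 by lra.
by rewrite !expr0n /= !addr0 !sqrtr_sqr ler_norml [`|c|]ger0_norm; lra.
Qed.

Lemma nr_nonneg_le u v : Lp_nonneg u -> Lp_nonneg (v - u) -> nr u <= nr v.
Proof.
move=> u0 uv; apply: nr_le_dominated => //.
have -> : v + u = (v - u) + (u + u) by rewrite addrA subrK.
by apply: nonnegD => //; exact: nonnegD.
Qed.

(** Because [t `^ (p - 1)] increases with [t]. *)
Lemma powR_superadd (a b : R) : 0 <= a -> 0 <= b -> a `^ p + b `^ p <= (a + b) `^ p.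
Proof.
move=> a0 b0; have [ab0|ab0] := eqVneq (a + b) 0.
  have -> : a = 0 by lra.
  have -> : b = 0 by lra.
  by rewrite addr0 powR0 ?gt_eqF// addr0.
have E (c : R) : 0 <= c -> c `^ p = c * c `^ (p - 1).
  by move=> c0; rewrite mulr_powRB1.
have p10 : 0 <= p - 1 by rewrite subr_ge0.
rewrite !E ?addr_ge0// mulrDl; apply: lerD; rewrite ler_wpM2l//;
  by apply: ge0_ler_powR => //; rewrite ?nnegrE ?lerDl ?lerDr// addr_ge0.
Qed.

Lemma nr_superadd u v : Lp_nonneg u -> Lp_nonneg v ->
  nr u `^ p + nr v `^ p <= nr (u + v) `^ p.
Proof.
move=> u0 v0; rewrite -lee_fin EFinD !nr_pow.
have m w : measurable_fun [set: X] (fun x => (normc (Lp_repr w x) `^ p)%:E).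
  exact/measurable_normcX/measurable_repr.
rewrite -ge0_integralD//; try by move=> x _; rewrite lee_fin powR_ge0.
apply: ae_ge0_le_integral => //.
- by move=> x _; rewrite adde_ge0// lee_fin powR_ge0.
- by apply: emeasurable_funD; exact: m.
- by move=> x _; rewrite lee_fin powR_ge0.
- apply: filterS3 u0 v0 (Lp_reprD u v) => x + + -> _.
  case: (Lp_repr u x) (Lp_repr v x) => [a b] [c e].
  rewrite !lecE /= => /andP[/eqP -> h4] /andP[/eqP -> h6].
  rewrite addr0 !expr0n /= !addr0 !sqrtr_sqr -EFinD lee_fin !ger0_norm ?addr_ge0//.
  exact: powR_superadd.
Qed.

Section positive_operator.
Variable U : {linear E -> E}.
Hypothesis U0 : positive_op U.

(** The operator on real functions: positivity keeps the image of a real function real,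
    so taking the real part loses nothing; see [J_act]. *)
Definition act f : X -> R := fun x => complex.Re (Lp_repr (U (J f)) x).

Lemma Re_repr_in u : real_Lp (fun x => complex.Re (Lp_repr u x)).
Proof.
have [mu1 _] := measurable_repr u.
apply: Lp_pred_le (Lp_repr_in u) _; first exact: measurable_real_fun.
by move=> x; rewrite normc_real normc_Re.
Qed.

Lemma Im_repr_in u : real_Lp (fun x => complex.Im (Lp_repr u x)).
Proof.
have [_ mu1] := measurable_repr u.
apply: Lp_pred_le (Lp_repr_in u) _; first exact: measurable_real_fun.
by move=> x; rewrite normc_real normc_Im.
Qed.

Lemma act_real f : real_Lp f -> \forall x \ae mu, complex.Im (Lp_repr (U (J f)) x) = 0.
Proof.
move=> fL.
have fpL := real_Lp_pos fL; have fnL := real_Lp_pos (real_LpZ (-1) fL).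
have -> : J f = J (fun x => Num.max (f x) 0) - J (fun x => Num.max (-1 * f x) 0).
  rewrite -JB//; congr J; apply/funext => x; rewrite /Num.max.
  by do 2 (case: ifPn; rewrite -?leNgt => ?); lra.
rewrite linearB.
have h1 : Lp_nonneg (U (J (fun x => Num.max (f x) 0))).
  by apply: U0; apply: J_nonneg => //; apply: nearW => x; rewrite le_max lexx orbT.
have h2 : Lp_nonneg (U (J (fun x => Num.max (-1 * f x) 0))).
  by apply: U0; apply: J_nonneg => //; apply: nearW => x; rewrite le_max lexx orbT.
apply: filterS3 h1 h2 (Lp_reprB (U (J (fun x => Num.max (f x) 0))) (U (J (fun x => Num.max (-1 * f x) 0)))).
move=> x + + ->; set a := Lp_repr _ _; set b := Lp_repr _ _; case: a b => [a a'] [b b'].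
by rewrite !lecE /= => /andP[/eqP -> _] /andP[/eqP -> _]; rewrite subrr.
Qed.

Lemma act_Lp f : real_Lp (act f).
Proof. exact: Re_repr_in. Qed.

Lemma J_act f : real_Lp f -> J (act f) = U (J f).
Proof.
move=> fL; apply: Lp_eq; apply: filterS2 (J_repr (act_Lp f)) (act_real fL) => x ->.
by rewrite /act; case: (Lp_repr _ x) => a b /= ->.
Qed.

Lemma act_nonneg f : real_Lp f -> (\forall x \ae mu, 0 <= f x) ->
  \forall x \ae mu, 0 <= act f x.
Proof.
move=> fL f0; have := U0 (J_nonneg fL f0); apply: filterS => x.
by rewrite /act; case: (Lp_repr _ x) => a b; rewrite lecE => /andP[].
Qed.

Lemma act_ae_le f g : real_Lp f -> real_Lp g -> (\forall x \ae mu, f x <= g x) ->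
  \forall x \ae mu, act f x <= act g x.
Proof.
move=> fL gL fg.
have h : \forall x \ae mu, 0 <= act (fun x => g x - f x) x.
  by apply: act_nonneg; [exact: real_LpB|apply: filterS fg => x; rewrite subr_ge0].
have : \forall x \ae mu, Lp_repr (U (J (fun x => g x - f x))) x =
    Lp_repr (U (J g)) x - Lp_repr (U (J f)) x.
  by rewrite JB// linearB; exact: Lp_reprB.
move=> hB; apply: filterS2 h hB => x; rewrite /act => + E; rewrite E.
by case: (Lp_repr (U (J g)) x) (Lp_repr (U (J f)) x) => [a a'] [b b'] /=; rewrite subr_ge0.
Qed.

Lemma act_abs f : real_Lp f -> \forall x \ae mu, `|act f x| <= act (fun x => `|f x|) x.
Proof.
move=> fL; have aL := real_Lp_abs fL; have nL := real_LpZ (-1) fL.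
have h1 : \forall x \ae mu, act f x <= act (fun x => `|f x|) x.
  by apply: act_ae_le => //; apply: nearW => x; exact: ler_norm.
have h2 : \forall x \ae mu, act (fun x => -1 * f x) x <= act (fun x => `|f x|) x.
  by apply: act_ae_le => //; apply: nearW => x; rewrite mulN1r -normrN ler_norm.
have h3 : \forall x \ae mu, act (fun x => -1 * f x) x = - act f x.
  rewrite /act JZ// rmorphN1 scaleN1r linearN; apply: filterS (Lp_reprN (U (J f))) => x ->.
  by case: (Lp_repr _ x).
by apply: filterS3 h1 h2 h3 => x k1 k2 k3; rewrite ler_norml k1 andbT lerNl -k3.
Qed.

Lemma nr_act_mono f g : real_Lp f -> real_Lp g ->
  (\forall x \ae mu, `|f x| <= `|g x|) ->
  nr (U (J (fun x => `|f x|))) <= nr (U (J (fun x => `|g x|))).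
Proof.
move=> fL gL fg; have faL := real_Lp_abs fL; have gaL := real_Lp_abs gL.
apply: nr_nonneg_le; first by apply/U0/J_nonneg => //; exact: nearW.
rewrite -linearB -JB//; apply/U0/J_nonneg; first exact: real_LpB.
by apply: filterS fg => x; rewrite subr_ge0.
Qed.

End positive_operator.
End Lp_lattice.

(** * Completeness of the Lp space *)

Lemma cvg_powR (R : realType) (p : R) (T : Type) (F : set_system T) (FF : ProperFilter F)
  (f : T -> R) (l : R) : 1 <= p -> (forall t, 0 <= f t) -> f @ F --> l ->
  (fun t => f t `^ p) @ F --> l `^ p.
Proof.
move=> p1 f0 fl; have p0 : 0 < p by exact: lt_le_trans p1.
have l0 : 0 <= l by apply: (@closed_cvg _ _ F _ f (fun y => 0 <= y)) fl;
  [exact: closed_ge|exact: nearW].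
have [l00|ln0] := eqVneq l 0.
  rewrite l00 powR0 ?gt_eqF//.
  apply: (@squeeze_cvgr _ _ _ _ (cst 0) f); [|exact: cvg_cst|by rewrite -l00].
  have : \forall t \near F, `|l - f t| < 1 by move/cvgrPdist_lt : fl; exact.
  apply: filterS => t; rewrite l00 sub0r normrN ger0_norm// => ft1.
  rewrite powR_ge0/=; have [->|ft0] := eqVneq (f t) 0; first by rewrite powR0 ?gt_eqF.
  have ftp : 0 < f t by rewrite lt_neqAle eq_sym ft0 f0.
  by apply: ge1r_powR => //; rewrite ftp ltW.
have lp : 0 < l by rewrite lt_neqAle eq_sym ln0.
have -> : l `^ p = expR (p * ln l) by rewrite /powR (negbTE ln0).
apply: (@cvg_trans _ ((fun t => expR (p * ln (f t))) @ F)).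
  apply: near_eq_cvg; have : \forall t \near F, 0 < f t by exact: cvgr_gt fl _ lp.
  by apply: filterS => t ft; rewrite /powR gt_eqF.
apply: (cvg_comp (fun t => p * ln (f t)) expR); last exact: continuous_expR.
apply: cvgM; first exact: cvg_cst.
by apply: (cvg_comp _ _ fl); exact: continuous_ln.
Qed.

Section Riesz_Fischer.
Context d (X : measurableType d) (R : realType).
Variables (mu : {measure set X -> \bar R}) (p : R) (p1 : 1 <= p).
Local Notation E := (Lp mu p1).

Let p0 : 0 < p. Proof. exact: lt_le_trans p1. Qed.

(** Fatou's lemma. *)
Lemma integral_ae_limit_le (h : nat -> X -> R[i]) (g : X -> R[i]) (K : R) :
  (forall j, measurable_cfun (h j)) -> measurable_cfun g ->
  (\forall x \ae mu, (fun j => normc (h j x - g x)) @ \oo --> (0 : R)) ->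
  (forall j, (\int[mu]_x (normc (h j x) `^ p)%:E <= K%:E)%E) ->
  (\int[mu]_x (normc (g x) `^ p)%:E <= K%:E)%E.
Proof.
move=> mh mg hg hK; pose F j x := (normc (h j x) `^ p)%:E.
have mF j : measurable_fun [set: X] (F j) by exact: measurable_normcX.
have Foo : (limn_einf (fun j => \int[mu]_x F j x) <= K%:E)%E.
  apply: le_trans (limn_einf_sup _) _; rewrite limn_esup_lim.
  apply: lime_le; first exact: is_cvg_esups.
  by apply: nearW => n; apply: ge_ereal_sup => _ [k /= _ <-]; exact: hK.
have F0 j x : [set: X] x -> (0 <= F j x)%E by move=> _; rewrite lee_fin powR_ge0.
apply: le_trans Foo; apply: (le_trans _ (fatou mu measurableT mF F0)).
rewrite le_eqVlt; apply/orP; left; apply/eqP; apply: ae_eq_integral => //.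
- exact: measurable_normcX.
- rewrite (_ : (fun x => _) = (fun x => - limn_esup (fun j => - F j x))%E); last first.
    apply/funext => x; rewrite -limn_einfN; congr limn_einf.
    by apply/funext => j; rewrite /comp oppeK.
  apply: measurableT_comp => //; apply: measurable_fun_limn_esup => j.
  exact: measurableT_comp.
- apply: filterS hg => x hx _.
  have /cvg_limn_einf_sup[-> _] // : (fun j => F j x) @ \oo --> (normc (g x) `^ p)%:E.
  apply: cvg_EFin; first exact: nearW.
  suff : (fun j => normc (h j x)) @ \oo --> normc (g x).
    by apply: (@cvg_powR _ _ _ _ _ (fun j => normc (h j x)) _ p1) => j; exact: normc_ge0.
  apply/cvgrPdist_lt => e e0; have /nullP/(_ e e0)[N hN] := hx.
  exists N => // n /= /hN; rewrite ger0_norm ?normc_ge0//; apply: le_lt_trans.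
  have h1 := normcD (h n x - g x) (g x); have h2 := normcD (h n x) (- (h n x - g x)).
  by move: h1 h2; rewrite subrK subKr normcN ler_norml => *; lra.
Qed.

(** The partial sums of the moduli of the increments are bounded in norm, so by monotone
    convergence their limit is p-integrable and thus finite almost everywhere; there the
    sequence converges absolutely. An upper limit provides a measurable choice of the
    limit at the remaining points. *)
Lemma cauchy_ae_cvg (v : nat -> E) :
  (forall k, nr (v k.+1 - v k) <= (1 / 2) ^+ k) ->
  exists l : X -> R[i], measurable_cfun l /\
    \forall x \ae mu, (fun j => normc (Lp_repr (v j) x - l x)) @ \oo --> (0 : R).
Proof.
move=> vv; pose D k x : R := normc (Lp_repr (v k.+1) x - Lp_repr (v k) x).
have mD k : measurable_fun [set: X] (D k).
  apply: (@measurable_normc _ _ _ (fun x => Lp_repr (v k.+1) x - Lp_repr (v k) x)).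
  exact: measurable_cfunB (measurable_repr (v k.+1)) (measurable_repr (v k)).
have D0 k x : 0 <= D k x by exact: normc_ge0.
have Dae k : \forall x \ae mu, D k x = normc (Lp_repr (v k.+1 - v k) x).
  by apply: filterS (Lp_reprB (v k.+1) (v k)) => x ->.
have DL k : real_Lp mu p1 (D k).
  apply/LpP; split; first exact: measurable_real_fun.
  have [mu1 +] := Lp_reprP (v k.+1 - v k); apply: le_lt_trans.
  apply: Lp_norm_ae_le => //; first exact: measurable_real_fun.
  by apply: filterS (Dae k) => x Dx; rewrite normc_real ger0_norm// Dx.
have nrD' k : nr (J mu p1 (D k)) <= (1 / 2) ^+ k.
  apply: le_trans (vv k); apply: nr_ae_le.
  apply: filterS2 (J_repr (DL k)) (Dae k) => x -> Dx.
  by rewrite normc_real ger0_norm// Dx.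
pose G n x : R := \sum_(k < n) D k x.
have G0 n x : 0 <= G n x by apply: sumr_ge0.
have GL n : real_Lp mu p1 (G n) /\ nr (J mu p1 (G n)) <= 2.
  suff [h1 h2] : real_Lp mu p1 (G n) /\ nr (J mu p1 (G n)) <= \sum_(k < n) (1 / 2) ^+ k.
    split => //; apply: le_trans h2 _.
    suff -> : \sum_(k < n) (1 / 2 : R) ^+ k = 2 - 2 * (1/2) ^+ n.
      by rewrite gerBl mulr_ge0// exprn_ge0// divr_ge0.
    elim: n {h1} => [|n IH]; first by rewrite big_ord0 expr0; lra.
    by rewrite big_ord_recr /= IH exprS; lra.
  elim: n => [|n [h1 h2]].
    rewrite (_ : G 0%N = fun=> 0); last by apply/funext => x; rewrite /G big_ord0.
    by rewrite J0 nr0 big_ord0; split; [exact: real_Lp0|].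
  rewrite (_ : G n.+1 = fun x => G n x + D n x); last first.
    by apply/funext => x; rewrite /G big_ord_recr.
  split; first exact: real_LpD.
  rewrite JD// big_ord_recr /=; apply: le_trans (nrD _ _) _; exact: lerD.
have mG n : measurable_fun [set: X] (fun x => (G n x `^ p)%:E).
  apply/measurable_EFinP; apply: (measurableT_comp (measurable_powR p)).
  by apply: real_Lp_measurable (GL n).1.
have Gnd x n m : (n <= m)%N -> ((G n x `^ p)%:E <= (G m x `^ p)%:E)%E.
  move=> nm; rewrite lee_fin; apply: ge0_ler_powR; rewrite ?nnegrE ?(ltW p0)//.
  rewrite -(subnKC nm) /G big_split_ord /= lerDl; exact: sumr_ge0.
have Gint n : (\int[mu]_x (G n x `^ p)%:E <= (2 `^ p)%:E)%E.
  have -> : (\int[mu]_x (G n x `^ p)%:E = (nr (J mu p1 (G n)) `^ p)%:E)%E.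
    rewrite nr_pow; apply: ae_eq_integral => //.
    - by apply: measurable_normcX; exact: measurable_repr.
    - by apply: filterS (J_repr (GL n).1) => x -> _; rewrite normc_real ger0_norm.
  by rewrite lee_fin; apply: ge0_ler_powR; rewrite ?nnegrE ?nr_ge0 ?(ltW p0)// (GL n).2.
have Glim : \forall x \ae mu, limn (fun n => (G n x `^ p)%:E) \is a fin_num.
  have : mu.-integrable [set: X] (fun x => limn (fun n => (G n x `^ p)%:E)).
    apply/integrableP; split.
      rewrite (_ : (fun x => _) = (fun x => limn_esup (fun n => (G n x `^ p)%:E))).
        exact: measurable_fun_limn_esup.
      apply/funext => x; rewrite is_cvg_limn_esupE//.
      by apply: ereal_nondecreasing_is_cvgn => n m; exact: Gnd.
    rewrite (eq_integral (fun x => limn (fun n => (G n x `^ p)%:E))); last first.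
      move=> x _; rewrite gee0_abs//; apply: lime_ge.
        by apply: ereal_nondecreasing_is_cvgn => n m; exact: Gnd.
      by apply: nearW => n; rewrite lee_fin powR_ge0.
    rewrite (monotone_convergence mu measurableT mG)//; last 2 first.
      by move=> n x _; rewrite lee_fin powR_ge0.
      by move=> x _ n m; exact: Gnd.
    apply: (@le_lt_trans _ _ (2 `^ p)%:E); last exact: ltry.
    apply: lime_le; last exact: nearW.
    apply: ereal_nondecreasing_is_cvgn => n m nm; apply: ge0_le_integral => //.
    - by move=> x _; rewrite lee_fin powR_ge0.
    - by move=> x _; exact: Gnd.
  by move=> /(integrable_ae measurableT); apply: filterS => x; exact.
have Gbd : \forall x \ae mu, exists M, forall n, G n x <= M.
  apply: filterS Glim => x xfin.
  pose M := fine (limn (fun n => (G n x `^ p)%:E)).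
  exists (M `^ p^-1) => n.
  have : ((G n x `^ p)%:E <= M%:E)%E.
    rewrite fineK// (cvg_lim _ (@ereal_nondecreasing_cvgn _ _ (Gnd x)))//.
    by apply: ereal_sup_ubound; exists n.
  rewrite lee_fin => h; rewrite -[leLHS](powRr1 (G0 n x)) -(mulfV (lt0r_neq0 p0)) powRrM.
  by apply: ge0_ler_powR; rewrite ?nnegrE ?invr_ge0 ?powR_ge0 ?(ltW p0)// (le_trans _ h) ?powR_ge0.
have cv (c : nat -> R) x M : (forall n, G n x <= M) ->
    (forall k, `|c k.+1 - c k| <= D k x) -> cvgn c.
  move=> GM cD.
  have Sc : cvgn (series (fun k => c k.+1 - c k)).
    apply: normed_cvg; apply: nondecreasing_is_cvgn.
      apply/nondecreasing_seqP => n.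
      rewrite -[leRHS]/(\sum_(0 <= k < n.+1) `|c k.+1 - c k|).
      by rewrite [leRHS]big_nat_recr//= lerDl.
    exists M => _ [n _ <-]; apply: le_trans (GM n).
    rewrite -[leLHS]/(\sum_(0 <= k < n) `|c k.+1 - c k|) big_mkord.
    by apply: ler_sum.
  have -> : c = (fun n => c 0%N + series (fun k => c k.+1 - c k) n).
    apply/funext => n; rewrite /series /= telescope_sumr// addrC subrK//.
  by apply: is_cvgD => //; exact: is_cvg_cst.
pose lre x := fine (limn_esup (fun j => (complex.Re (Lp_repr (v j) x))%:E)).
pose lim x := fine (limn_esup (fun j => (complex.Im (Lp_repr (v j) x))%:E)).
exists (fun x => lre x +i* lim x); split.
  have ml (c : nat -> X -> R) : (forall j, measurable_fun [set: X] (c j)) ->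
      measurable_fun [set: X] (fun x => fine (limn_esup (fun j => (c j x)%:E))).
    move=> mc; apply: (measurableT_comp (f := fine)) => //.
    by apply: measurable_fun_limn_esup => j; exact/measurable_EFinP.
  by split; [apply: (ml (fun j x => complex.Re (Lp_repr (v j) x)))|
    apply: (ml (fun j x => complex.Im (Lp_repr (v j) x)))] => j;
    have [] := measurable_repr (v j).
apply: filterS Gbd => x [M GM].
have key (c : nat -> R) : cvgn c ->
    (fun j => `|c j - fine (limn_esup (fun j => (c j)%:E))|) @ \oo --> (0 : R).
  move=> /cvg_ex[/= a ca].
  have /cvg_limn_einf_sup[_ ->] : (fun j => (c j)%:E) @ \oo --> a%:E.
    by apply: cvg_EFin => //; exact: nearW.
  by apply/norm_cvg0P/subr_cvg0.
have h1 : cvgn (fun j => complex.Re (Lp_repr (v j) x)).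
  apply: (cv _ x M) => // k; apply: le_trans (normc_Re _).
  by case: (Lp_repr (v k.+1) x) (Lp_repr (v k) x) => [a b] [a' b'].
have h2 : cvgn (fun j => complex.Im (Lp_repr (v j) x)).
  apply: (cv _ x M) => // k; apply: le_trans (normc_Im _).
  by case: (Lp_repr (v k.+1) x) (Lp_repr (v k) x) => [a b] [a' b'].
have h12 : (fun j => `|complex.Re (Lp_repr (v j) x) - lre x|
    + `|complex.Im (Lp_repr (v j) x) - lim x|) @ \oo --> (0 : R).
  by rewrite -[X in _ --> X]addr0; apply: cvgD; [exact: key h1|exact: key h2].
apply: null_squeeze h12 => j; rewrite normc_ge0/=; apply: le_trans (normc_le_ReIm _) _.
by rewrite /lre /lim; case: (Lp_repr (v j) x).
Qed.

Theorem Lp_complete : @nr_complete R E.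
Proof.
move=> u uc.
have half k : 0 < (1 / 2 : R) ^+ k by rewrite exprn_gt0// divr_gt0.
have /choice[g gP] := fun k => uc _ (half k).
pose f k := (\max_(i < k.+1) g i)%N.
have fg i k : (i <= k)%N -> (g i <= f k)%N.
  by move=> ik; apply: (@leq_bigmax _ (fun j : 'I_k.+1 => g j) (Ordinal (ik : (i < k.+1)%N))).
pose v k := u (f k).
have vc k i j : (k <= i)%N -> (k <= j)%N -> nr (v i - v j) <= (1 / 2) ^+ k.
  by move=> ki kj; apply/ltW/gP; exact: fg.
have [l [ml vl]] := cauchy_ae_cvg (fun k => vc k k.+1 k (leqnSn k) (leqnn k)).
have bound k : (\int[mu]_x (normc (Lp_repr (v k) x - l x) `^ p)%:E <=
    (((1 / 2) ^+ k) `^ p)%:E)%E.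
  pose h j x := Lp_repr (v k - v (j + k)%N) x.
  apply: (@integral_ae_limit_le h (fun x => Lp_repr (v k) x - l x)).
  - by move=> j; exact: measurable_repr.
  - exact: measurable_cfunB (measurable_repr (v k)) ml.
  - have vl' : \forall x \ae mu, forall j, h j x = Lp_repr (v k) x - Lp_repr (v (j + k)%N) x.
      by apply: ae_foralln => j; exact: Lp_reprB.
    apply: filterS2 vl vl' => x vlx hx.
    apply: (@cvg_trans _ ((fun j => normc (Lp_repr (v (j + k)%N) x - l x)) @ \oo)).
      apply: near_eq_cvg; apply: nearW => j.
      by rewrite hx subrACA subrr sub0r normcN.
    by apply: (cvg_comp (fun j => (j + k)%N) _ _ vlx); apply: cvg_index => j; exact: leq_addr.
  - move=> j; rewrite -nr_pow lee_fin.
    have hv := vc k k (j + k)%N (leqnn k) (leq_addl _ _).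
    by apply: ge0_ler_powR; rewrite ?nnegrE ?nr_ge0 ?(ltW p0) ?(ltW (half k)).
have mB : measurable_cfun (fun x => Lp_repr (v 0%N) x - l x).
  exact: measurable_cfunB (measurable_repr (v 0%N)) ml.
have lL : l \in Lp_pred mu p1.
  have dL : (fun x => Lp_repr (v 0%N) x - l x) \in Lp_pred mu p1.
    apply/LpP; split => //; rewrite Lp_normE poweR_lty//.
    by apply: le_lt_trans (bound 0%N) _; exact: ltry.
  have -> : l = Lp_repr (v 0%N) - (fun x => Lp_repr (v 0%N) x - l x).
    by apply/funext => x; rewrite !fctE subKr.
  by apply: rpredB => //; exact: Lp_repr_in.
exists (Lp_class mu p1 l).
have vk k : nr (v k - Lp_class mu p1 l) <= (1 / 2) ^+ k.
  have : ((nr (v k - Lp_class mu p1 l) `^ p)%:E <= (((1 / 2) ^+ k) `^ p)%:E)%E.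
    rewrite nr_pow; apply: le_trans (bound k).
    rewrite le_eqVlt; apply/orP; left; apply/eqP; apply: ae_eq_integral => //.
    - exact/measurable_normcX/measurable_repr.
    - exact/measurable_normcX/(measurable_cfunB (measurable_repr (v k)) ml).
    - by apply: filterS2 (Lp_reprB (v k) (Lp_class mu p1 l)) (Lp_class_repr lL) => x -> -> _.
  rewrite lee_fin => h; rewrite leNgt; apply/negP => h'.
  have := gt0_ltr_powR p0 _ _ h'; rewrite !nnegrE nr_ge0 (ltW (half k)) => /(_ isT isT).
  by rewrite ltNge h.
apply/nullP => e e0; have e2 : 0 < e / 2 by rewrite divr_gt0.
have h2 : `|1 / 2 : R| < 1 by rewrite ger0_norm; lra.
have /nullP/(_ _ e2)[k /(_ k (leqnn k))] := cvg_geometric 1 h2.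
rewrite /geometric /= (mul1r ((1 / 2) ^+ k)) (ger0_norm (ltW (half k))) => hk.
exists (f k) => n fn; rewrite ger0_norm ?nr_ge0// [ltRHS]splitr.
apply: le_lt_trans (nr_triangle (v k) _ _) _; apply: ltr_leD.
  by apply: lt_trans hk; apply: (gP k); [exact: leq_trans (fg k k (leqnn k)) fn|exact: fg].
exact: le_trans (vk k) (ltW hk).
Qed.

End Riesz_Fischer.

(** * Images of the unit ball that are almost order bounded *)

Section uniform_integrability.
Context d (X : measurableType d) (R : realType).
Variables (mu : {measure set X -> \bar R}) (p : R) (p1 : 1 <= p).
Local Notation E := (Lp mu p1).
Local Notation J := (J mu p1).

Let p0 : 0 < p. Proof. exact: lt_le_trans p1. Qed.

(** The cone is closed: replacing values by their nearest point of the half-line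
    does not increase the distance to a nonnegative function. *)
Lemma nonneg_closed (u : nat -> E) (l : E) : (forall n, Lp_nonneg (u n)) ->
  (fun n => nr (u n - l)) @ \oo --> (0 : R) -> Lp_nonneg l.
Proof.
move=> u0 ul; pose g x := Num.max (complex.Re (Lp_repr l x)) 0.
have gL : real_Lp mu p1 g by apply: real_Lp_pos; exact: Re_repr_in.
suff -> : l = J g.
  by apply: J_nonneg => //; apply: nearW => x; rewrite /g le_max lexx orbT.
apply/eqP; rewrite -subr_eq0; apply/eqP; apply: nr_small_eq0 => e e0.
have /nullP/(_ e e0)[n /(_ n (leqnn n))] := ul.
rewrite ger0_norm ?nr_ge0// => /ltW; apply: le_trans; apply: nr_ae_le.
apply: filterS4 (Lp_reprB l (J g)) (Lp_reprB (u n) l) (J_repr gL) (u0 n).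
move=> x -> -> ->; rewrite /g; case: (Lp_repr l x) (Lp_repr (u n) x) => [a b] [c e'].
rewrite lecE /= => /andP[/eqP -> c0]; rewrite ler_sqrt ?addr_ge0 ?sqr_ge0//.
rewrite oppr0 add0r addr0 sqrrN lerD2r -(ler_sqrt _ (sqr_ge0 _)) !sqrtr_sqr.
rewrite /Num.max; case: ifPn => a0; first by rewrite subr0 (ltr0_norm a0) ger0_norm; lra.
by rewrite subrr normr0.
Qed.

Section positive.
Variable T : {linear E -> E}.
Hypothesis T0 : positive_op T.

Definition modulus (f : E) : X -> R := fun x => normc (Lp_repr f x).

Lemma modulus_Lp f : real_Lp mu p1 (modulus f).
Proof.
apply: Lp_pred_le (Lp_repr_in f) _.
  by apply: measurable_real_fun; apply: measurable_normc; exact: measurable_repr.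
by move=> x; rewrite normc_real ger0_norm ?normc_ge0.
Qed.

Lemma nr_modulus f : nr (J (modulus f)) = nr f.
Proof.
apply/eqP; rewrite eq_le; apply/andP; split; apply: nr_ae_le;
  by apply: filterS (J_repr (modulus_Lp f)) => x ->; rewrite normc_real ger0_norm ?normc_ge0.
Qed.

Lemma Lp_ReIm (f : E) : f = J (fun x => complex.Re (Lp_repr f x))
  + 'i *: J (fun x => complex.Im (Lp_repr f x)).
Proof.
apply: Lp_eq; set a := J _; set b := J _.
have ha := J_repr (Re_repr_in f); have hb := J_repr (Im_repr_in f).
apply: filterS4 ha hb (Lp_reprD a ('i *: b)) (Lp_reprZ 'i b) => x E1 E2 -> ->.
rewrite E1 E2; case: (Lp_repr f x) => y z; apply/eqP.
by rewrite eq_complex /= !(mul0r, mul1r, mulr0, subr0, addr0, add0r, oppr0) !eqxx.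
Qed.

(** Splitting into real and imaginary parts costs a factor 2 in |T f| <= T |f|. *)
Lemma normc_positive_op f :
  \forall x \ae mu, normc (Lp_repr (T f) x) <= 2 * act T (modulus f) x.
Proof.
set re := fun x => complex.Re (Lp_repr f x); set im := fun x => complex.Im (Lp_repr f x).
have reL : real_Lp mu p1 re := Re_repr_in f.
have imL : real_Lp mu p1 im := Im_repr_in f.
have mL := modulus_Lp f.
have aux g : real_Lp mu p1 g -> (forall x, `|g x| <= modulus f x) ->
    \forall x \ae mu, normc (Lp_repr (T (J g)) x) <= act T (modulus f) x.
  move=> gL gm.
  have h1 := act_abs T0 gL.
  have h2 : \forall x \ae mu, act T (fun x => `|g x|) x <= act T (modulus f) x.
    by apply: act_ae_le => //; [exact: real_Lp_abs|exact: nearW].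
  apply: filterS3 h1 h2 (act_real T0 gL) => x k1 k2 k3.
  apply: le_trans (normc_le_ReIm _) _; rewrite k3 normr0 addr0.
  exact: le_trans k1 k2.
have h1 := aux re reL (fun x => normc_Re _).
have h2 := aux im imL (fun x => normc_Im _).
have TE : T f = T (J re) + 'i *: T (J im).
  by rewrite {1}(Lp_ReIm f) linearD linearZ_LR.
rewrite TE; apply: filterS4 h1 h2 (Lp_reprD (T (J re)) ('i *: T (J im)))
  (Lp_reprZ 'i (T (J im))) => x k1 k2 -> ->.
apply: le_trans (normcD _ _) _; rewrite normcM.
have -> : normc ('i : R[i]) = 1 by rewrite /= expr0n expr1n add0r sqrtr1.
lra.
Qed.

Section weighted_integral.
Variables (q : R) (W : X -> R).
Hypotheses (q0 : 0 < q) (mW : measurable_fun [set: X] W) (W0 : forall x, 0 <= W x).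

Definition weighted (f : E) := (\int[mu]_x (normc (Lp_repr f x) `^ q * W x)%:E)%E.

Lemma measurable_weighted (h : X -> R) : measurable_fun [set: X] h ->
  measurable_fun [set: X] (fun x => (h x `^ q * W x)%:E).
Proof.
move=> mh; apply/measurable_EFinP; apply: measurable_funM => //.
exact: (measurableT_comp (measurable_powR q)).
Qed.

Lemma measurable_modulus f : measurable_fun [set: X] (modulus f).
Proof. exact/measurable_normc/measurable_repr. Qed.

(** If the integrals were unbounded on the ball, the sum [l] of a convergent series of
    moduli of bad vectors would have [T l] above a multiple of each of their images, by
    positivity, and so the integral of [T l] would be infinite. *)
Lemma weighted_bounded : (forall f, (weighted (T f) < +oo)%E) ->
  exists2 K : R, 0 <= K & forall f, nr f <= 1 -> (weighted (T f) <= K%:E)%E.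
Proof.
move=> fin; apply: contrapT => nK.
have /choice[f fP] : forall n : nat, exists f : E, nr f <= 1 /\
    ((n%:R * (2 * 2 ^+ n) `^ q)%:E < weighted (T f))%E.
  move=> n; apply: contrapT => nf; apply: nK; exists (n%:R * (2 * 2 ^+ n) `^ q).
    by rewrite mulr_ge0 ?powR_ge0.
  move=> f f1; rewrite leNgt; apply/negP => h; apply: nf; by exists f.
pose a n : E := ((1 / 2) ^+ n)%:C *: J (modulus (f n)).
have a0 n : Lp_nonneg (a n).
  apply: nonnegZ; first by rewrite exprn_ge0// divr_ge0.
  by apply: J_nonneg; [exact: modulus_Lp|apply: nearW => x; exact: normc_ge0].
have an n : nr (a n) <= (1 / 2) ^+ n.
  have h0 : 0 <= (1 / 2 : R) ^+ n by rewrite exprn_ge0// divr_ge0.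
  rewrite /a nrZ (normcR h0) nr_modulus -[leRHS]mulr1 ler_wpM2l//.
  by have [] := fP n.
pose s n := \sum_(i < n) a i.
have stail n m : nr (s (n + m)%N - s n) <= 2 * (1 / 2) ^+ n.
  suff h : nr (s (n + m)%N - s n) <= 2 * (1 / 2) ^+ n - 2 * (1 / 2) ^+ (n + m).
    apply: le_trans h _; rewrite gerBl mulr_ge0// exprn_ge0// divr_ge0//.
  elim: m => [|m IH]; first by rewrite addn0 !subrr nr0.
  rewrite addnS /s big_ord_recr /= -/(s _) addrAC.
  apply: le_trans (nrD _ _) _; apply: le_trans (lerD IH (an _)) _.
  by rewrite exprS; lra.
have h2 : `|1 / 2 : R| < 1 by rewrite ger0_norm; lra.
have sc : nr_cauchy s.
  move=> e e0; have /nullP/(_ (e / 2)) := cvg_geometric 2 h2.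
  rewrite divr_gt0// => /(_ isT)[N /(_ N (leqnn N))]; rewrite /geometric /=.
  have t0 : 0 <= 2 * (1 / 2 : R) ^+ N by rewrite mulr_ge0// exprn_ge0// divr_ge0.
  rewrite (ger0_norm t0) => hN.
  exists N => i j Ni Nj; apply: le_lt_trans (nr_triangle (s N) _ _) _.
  rewrite [ltRHS]splitr ltrD//; apply: le_lt_trans hN.
    by rewrite -(subnKC Ni); exact: stail.
  by rewrite nr_distC -(subnKC Nj); exact: stail.
have [l sl] := Lp_complete sc.
have la n : Lp_nonneg (l - a n).
  apply: (@nonneg_closed (fun m => s (n.+1 + m)%N - a n)).
    move=> m; rewrite /s big_split_ord /= big_ord_recr /= addrAC addrK.
    have ns (I : finType) (g : I -> E) : (forall i, Lp_nonneg (g i)) -> Lp_nonneg (\sum_i g i).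
      move=> g0; apply: big_ind => //; [exact: nonneg0|move=> u v; exact: nonnegD].
    by apply: nonnegD; apply: ns.
  rewrite (_ : (fun _ => _) = (fun m => nr (s (n.+1 + m)%N - l))); last first.
    by apply/funext => m; rewrite subrACA subrr subr0.
  by apply: (cvg_comp (fun m => (n.+1 + m)%N) _ _ sl); apply: cvg_index => m; exact: leq_addl.
have Tl n : \forall x \ae mu, normc (Lp_repr (T (f n)) x) <=
    2 * 2 ^+ n * normc (Lp_repr (T l) x).
  have h := T0 (la n); rewrite linearB /a linearZ_LR /= in h.
  set c := ((1 / 2) ^+ n)%:C in h; set b := T (J _) in h.
  apply: filterS4 (normc_positive_op (f n)) h (Lp_reprB (T l) (c *: b)) (Lp_reprZ c b).
  move=> x k1 k2 E1 E2; rewrite E1 E2 in k2; apply: le_trans k1 _.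
  rewrite -mulrA ler_wpM2l// /act -/b; move: k2; rewrite /c.
  have Nl := le_trans (ler_norm _) (normc_Re (Lp_repr (T l) x)).
  move: Nl; set N := normc _; move: N => N.
  case: (Lp_repr (T l) x) (Lp_repr b x) => [y y'] [z z'] /= yN.
  rewrite lecE /= !(mul0r, subr0) => /andP[_ k2].
  rewrite -(ler_pM2l (_ : 0 < (1 / 2 : R) ^+ n)) ?exprn_gt0 ?divr_gt0//.
  rewrite [leRHS]mulrA -exprMn div1r mulVf// expr1n mul1r.
  by rewrite div1r in k2; lra.
have wl := fin l; have wl0 : (0 <= weighted (T l))%E.
  by apply: integral_ge0 => x _; rewrite lee_fin mulr_ge0 ?powR_ge0.
have wfin : weighted (T l) = (fine (weighted (T l)))%:E by rewrite fineK// ge0_fin_numE.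
have w0 : 0 <= fine (weighted (T l)) by exact: fine_ge0.
pose n := (Num.truncn (fine (weighted (T l)))).+1.
have [_ hn] := fP n.
suff : (weighted (T (f n)) <= (n%:R * (2 * 2 ^+ n) `^ q)%:E)%E by rewrite leNgt hn.
have c0 : 0 <= (2 * 2 ^+ n : R) by rewrite mulr_ge0// exprn_ge0.
apply: (@le_trans _ _ (((2 * 2 ^+ n) `^ q)%:E * weighted (T l))%E).
  rewrite -ge0_integralZl//; last 2 first.
  - by apply: measurable_weighted; exact: measurable_modulus.
  - by move=> x _; rewrite lee_fin mulr_ge0 ?powR_ge0.
  apply: ae_ge0_le_integral => //.
  - by move=> x _; rewrite lee_fin mulr_ge0 ?powR_ge0.
  - by apply: measurable_weighted; exact: measurable_modulus.
  - by move=> x _; rewrite -EFinM lee_fin !mulr_ge0 ?powR_ge0.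
  - apply: measurable_funeM; by apply: measurable_weighted; exact: measurable_modulus.
  apply: filterS (Tl n) => x hx _; rewrite -EFinM lee_fin mulrA ler_wpM2r//.
  rewrite -powRM ?normc_ge0//; apply: ge0_ler_powR; rewrite ?nnegrE ?mulr_ge0 ?normc_ge0 ?(ltW q0)//.
rewrite wfin -EFinM lee_fin mulrC ler_wpM2r ?powR_ge0//.
by apply: ltW; have /andP[_] := truncn_itv w0.
Qed.

End weighted_integral.

(** Order boundedness up to epsilon of the image of the ball: where the weight is
    large the first integral is small, where |T f| is large the second one is, and
    what remains is below a multiple of an indicator. *)
Lemma almost_order_bounded (W : X -> R) (e1 : R) : 0 < e1 ->
  measurable_fun [set: X] W -> (forall x, 1 <= W x) ->
  (forall c : R, (mu [set x | (W x <= c)%R] < +oo)%E) ->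
  (forall f, (weighted p W (T f) < +oo)%E) ->
  (forall f, (weighted (p + e1) W (T f) < +oo)%E) ->
  forall e : R, 0 < e -> exists g : X -> R,
    [/\ real_Lp mu p1 g, forall x, 0 <= g x &
    forall f, nr f <= 1 ->
      nr (J (fun x => Num.max (`|complex.Re (Lp_repr (T f) x)| - g x) 0)) <= e].
Proof.
move=> e10 mW W1 Wfin fin1 fin2 e e0.
have W0 x : 0 <= W x by exact: le_trans (W1 x).
have pe0 : 0 < p + e1 by rewrite addr_gt0.
have [K1 K10 hK1] := weighted_bounded p0 mW W0 fin1.
have [K2 K20 hK2] := weighted_bounded pe0 mW W0 fin2.
have ep0 : 0 < e `^ p / 2 by rewrite divr_gt0// powR_gt0.
pose c := K1 / (e `^ p / 2) + 1.
have c0 : 0 < c by rewrite ltr_wpDl// divr_ge0// ltW.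
pose t := (K2 / (e `^ p / 2) + 1) `^ e1^-1.
have t1 : 0 < K2 / (e `^ p / 2) + 1 by rewrite ltr_wpDl// divr_ge0// ltW.
have t0 : 0 < t by rewrite powR_gt0.
have te : t `^ e1 = K2 / (e `^ p / 2) + 1.
  by rewrite -powRrM mulVf ?gt_eqF// powRr1// ltW.
pose B := [set x | W x <= c].
have mB : measurable B.
  rewrite -[B]setTI; have := mW measurableT [set y | y <= c] _; apply.
  by rewrite (_ : [set y | _] = `]-oo, c]%classic)//; apply/seteqP; split => y; rewrite /= in_itv.
pose g x := t * \1_B x.
have g0 x : 0 <= g x by rewrite mulr_ge0// ltW.
have gL : real_Lp mu p1 g.
  apply: real_LpZ; apply/LpP; split; first exact/measurable_real_fun/measurable_indic.
  rewrite Lp_normE poweR_lty//.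
  rewrite (eq_integral (fun x => (\1_B x)%:E)); last first.
    move=> x _; rewrite normc_real indicE; case: (x \in B) => /=.
      by rewrite normr1 powR1.
    by rewrite normr0 powR0// gt_eqF.
  by rewrite integral_indic// setIT; exact: Wfin.
exists g; split => // f f1.
set h := fun x => Num.max (`|complex.Re (Lp_repr (T f) x)| - g x) 0.
have hL : real_Lp mu p1 h.
  by apply: real_Lp_pos; apply: real_LpB => //; apply: real_Lp_abs; exact: Re_repr_in.
have h0 x : 0 <= h x by rewrite /h le_max lexx orbT.
have ew0 q : (forall x, (0 <= (normc (Lp_repr (T f) x) `^ q * W x)%:E)%E).
  by move=> x; rewrite lee_fin mulr_ge0 ?powR_ge0.
have mw q : measurable_fun [set: X] (fun x => (normc (Lp_repr (T f) x) `^ q * W x)%:E).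
  by apply: measurable_weighted => //; exact: measurable_modulus.
have : ((nr (J h) `^ p)%:E <= (e `^ p)%:E)%E.
  rewrite nr_pow; apply: (@le_trans _ _ ((c^-1)%:E * weighted p W (T f) +
      ((t `^ e1)^-1)%:E * weighted (p + e1) W (T f))%E).
    have ci : (0 <= (c^-1)%:E)%E by rewrite lee_fin invr_ge0 ltW.
    have ti : (0 <= ((t `^ e1)^-1)%:E)%E by rewrite lee_fin invr_ge0 powR_ge0.
    rewrite -ge0_integralZl// -ge0_integralZl// -ge0_integralD//; last 4 first.
    - by move=> x _; rewrite mule_ge0.
    - exact: measurable_funeM.
    - by move=> x _; rewrite mule_ge0.
    - exact: measurable_funeM.
    apply: ae_ge0_le_integral => //.
    - by move=> x _; rewrite lee_fin powR_ge0.
    - by apply: measurable_normcX; exact: measurable_repr.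
    - by move=> x _; rewrite adde_ge0// mule_ge0.
    - by apply: emeasurable_funD; exact: measurable_funeM.
    apply: filterS (J_repr hL) => x -> _; rewrite normc_real ger0_norm//.
    rewrite -!EFinM -EFinD lee_fin.
    set z := Lp_repr (T f) x; have z0 := normc_ge0 z; have zR := normc_Re z.
    have A0 : 0 <= c^-1 * (normc z `^ p * W x).
      by rewrite !mulr_ge0 ?invr_ge0 ?powR_ge0// ltW.
    have B0 : 0 <= (t `^ e1)^-1 * (normc z `^ (p + e1) * W x).
      by rewrite !mulr_ge0 ?invr_ge0 ?powR_ge0.
    have hz : h x <= normc z.
      by rewrite /h -/z ge_max z0 andbT; have := g0 x; lra.
    have hzp : h x `^ p <= normc z `^ p.
      by apply: ge0_ler_powR; rewrite ?nnegrE ?(ltW p0).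
    have [xB|xB] := leP (W x) c; last first.
      rewrite -[leLHS]addr0; apply: lerD => //; apply: le_trans hzp _.
      rewrite mulrC -mulrA ler_peMr ?powR_ge0// ler_pdivlMr// mul1r; exact: ltW.
    have [zt|zt] := leP `|complex.Re z| t.
      have -> : h x = 0.
        rewrite /h -/z /g indicE mem_set//= mulr1; apply/max_idPr; lra.
      by rewrite powR0 ?gt_eqF// addr_ge0.
    rewrite -[leLHS]add0r; apply: lerD => //; apply: le_trans hzp _.
    have zp : 0 < normc z by apply: lt_le_trans zR; exact: lt_trans zt.
    rewrite powRD; last by rewrite gt_eqF// implybT.
    rewrite -mulrA mulrCA -[leLHS]mulr1 ler_wpM2l ?powR_ge0//.
    rewrite mulrA -[leLHS]mulr1 ler_pM// mulrC ler_pdivlMr ?powR_gt0// mul1r.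
    apply: ge0_ler_powR; rewrite ?nnegrE ?(ltW e10) ?(ltW t0)//.
    exact: ltW (lt_le_trans zt zR).
  apply: (@le_trans _ _ ((c^-1)%:E * K1%:E + ((t `^ e1)^-1)%:E * K2%:E)%E).
    by apply: leeD; apply: lee_wpmul2l; rewrite ?lee_fin ?invr_ge0 ?powR_ge0 ?(ltW c0)//;
      [exact: hK1|exact: hK2].
  rewrite -!EFinM -EFinD lee_fin te [leRHS](splitr (e `^ p)); apply: lerD.
    rewrite mulrC ler_pdivrMr// mulrDr mulr1 mulrC divfK ?gt_eqF//.
    by rewrite lerDl ltW.
  rewrite mulrC ler_pdivrMr// mulrDr mulr1 mulrC divfK ?gt_eqF//.
  by rewrite lerDl ltW.
rewrite lee_fin => hh; rewrite leNgt; apply/negP => h'.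
have := gt0_ltr_powR p0 _ _ h'; rewrite !nnegrE nr_ge0 (ltW e0) => /(_ isT isT).
by rewrite ltNge hh.
Qed.

End positive.
End uniform_integrability.

(** * Ultralimits and an asymptotic seminorm *)

Section ultralimit.
Variables (R : realType) (U : set_system nat) (UU : UltraFilter U).
Hypothesis Uge : forall m, U [set n | (m <= n)%N].
Implicit Types x y : nat -> R.

Definition bounded_seq x := exists K : R, forall n, `|x n| <= K.

Definition ulim x : R := lim (x @ U).

Lemma ulimP x : bounded_seq x -> x @ U --> ulim x.
Proof.
move=> [K xK]; have [l [_ lcl]] : [set` `[- K, K]] `&` cluster (x @ U) !=set0.
  apply: (@segment_compact R (- K) K (x @ U)).
  have : U [set n | x n \in `[- K, K]].
    by apply: filterS filterT => n _; rewrite /= in_itv /= -ler_norml; exact: xK.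
  by [] .
suff : x @ U --> l by move=> /cvgP.
move=> N Nl /=; have [//|UN] := in_ultra_setVsetC (x @^-1` N) UU.
by have [y []] := lcl (~` N) N UN Nl.
Qed.

Lemma ulim_cvg x (l : R) : x @ U --> l -> ulim x = l.
Proof. exact: cvg_lim. Qed.

Lemma ulim_le x y : bounded_seq x -> bounded_seq y -> U [set n | x n <= y n] ->
  ulim x <= ulim y.
Proof.
move=> bx b_y xy; exact: ler_cvg_to (ulimP bx) (ulimP b_y) xy.
Qed.

Lemma ulim_cst (c : R) : ulim (fun=> c) = c.
Proof. by apply: ulim_cvg; exact: cvg_cst. Qed.

Lemma ulim_le_cst x (c : R) : bounded_seq x -> U [set n | x n <= c] -> ulim x <= c.
Proof.
move=> bx xc; rewrite -[leRHS]ulim_cst; apply: ulim_le => //.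
by exists `|c|.
Qed.

Lemma ulim_ge_cst x (c : R) : bounded_seq x -> U [set n | c <= x n] -> c <= ulim x.
Proof.
move=> bx xc; rewrite -[leLHS]ulim_cst; apply: ulim_le => //.
by exists `|c|.
Qed.

Lemma bounded_seqD x y : bounded_seq x -> bounded_seq y -> bounded_seq (fun n => x n + y n).
Proof.
move=> [K xK] [L yL]; exists (K + L) => n; apply: le_trans (ler_normD _ _) _; exact: lerD.
Qed.

Lemma bounded_seqZ (c : R) x : bounded_seq x -> bounded_seq (fun n => c * x n).
Proof. by move=> [K xK]; exists (`|c| * K) => n; rewrite normrM ler_wpM2l. Qed.

Lemma ulimD x y : bounded_seq x -> bounded_seq y ->
  ulim (fun n => x n + y n) = ulim x + ulim y.
Proof. by move=> bx b_y; apply: ulim_cvg; apply: cvgD; exact: ulimP. Qed.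

Lemma ulimZ (c : R) x : bounded_seq x -> ulim (fun n => c * x n) = c * ulim x.
Proof.
by move=> bx; apply: ulim_cvg; apply: cvgM; [exact: cvg_cst|exact: ulimP].
Qed.

Lemma ulim_powR (p : R) x : 1 <= p -> bounded_seq x -> (forall n, 0 <= x n) ->
  (fun n => x n `^ p) @ U --> ulim x `^ p.
Proof. by move=> p1 bx x0; apply: cvg_powR => //; exact: ulimP. Qed.

Lemma ulim_null x : x @ \oo --> (0 : R) -> ulim x = 0.
Proof.
move=> x0; apply: ulim_cvg; apply: cvg_trans x0.
by apply: cvg_app => A [N _ NA]; apply: filterS (Uge N) => n /NA.
Qed.

Lemma ulim_lt x (c : R) : bounded_seq x -> ulim x < c -> U [set n | x n < c].
Proof. by move=> bx xc; have := ulimP bx; move/cvgr_lt; exact. Qed.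

End ultralimit.

(** Sequences of real functions are functions of a pair (k, x). The operator [P a k] will
    be an average of length about [k ^ a.+1], so that for large k averages of a higher
    level are much longer than those of a lower one. *)
Section asymptotic_lattice.
Context d (X : measurableType d) (R : realType).
Variables (mu : {measure set X -> \bar R}) (p : R) (p1 : 1 <= p).
Local Notation E := (Lp mu p1).
Local Notation J := (J mu p1).
Variables (U : set_system nat) (UU : UltraFilter U).
Hypothesis Uge : forall m, U [set n | (m <= n)%N].
Variables (P : nat -> nat -> {linear E -> E}) (C : R).
Hypothesis C1 : 1 <= C.
Hypothesis P0 : forall a k, positive_op (P a k).
Hypothesis PC : forall a k v, nr (P a k v) <= C * nr v.

Let C0 : 0 < C. Proof. exact: lt_le_trans C1. Qed.

Local Notation Y := (nat * X)%type.
Implicit Types f g : Y -> R.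

Definition slice f k : X -> R := fun x => f (k, x).

Definition bounded_Lp : set (Y -> R) := [set f | (forall k, real_Lp mu p1 (slice f k)) /\
  exists K : R, forall k, nr (J (slice f k)) <= K].

Definition level f a k : R := nr (P a k (J (fun x => `|slice f k x|))).

(** The norm of the modulus seen by averages of level [a] as [k] grows, and then by
    averages of higher and higher level. The limits are taken along an ultrafilter to
    exist for all bounded sequences. *)
Definition rho f : R := ulim U (fun a => ulim U (level f a)).

Lemma bounded_Lp_lin c f g : bounded_Lp f -> bounded_Lp g ->
  bounded_Lp (fun y => c * f y + g y).
Proof.
move=> [fL [K fK]] [gL [L gK]]; split.
  by move=> k; exact: real_Lp_lin (fL k) (gL k).
exists (`|c| * K + L) => k; rewrite (J_lin c (fL k) (gL k)).
apply: le_trans (nrD _ _) _; apply: lerD => //.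
by rewrite nrZ normc_real ler_wpM2l.
Qed.

Lemma bounded_Lp0 : bounded_Lp (fun=> 0).
Proof.
split; first by move=> k; exact: real_Lp0.
by exists 0 => k; rewrite (J0 mu p1) nr0.
Qed.

Lemma bounded_LpD f g : bounded_Lp f -> bounded_Lp g -> bounded_Lp (fun y => f y + g y).
Proof.
move=> fL gL; have := bounded_Lp_lin 1 fL gL; congr bounded_Lp.
by apply/funext => y; rewrite mul1r.
Qed.

Lemma bounded_LpZ c f : bounded_Lp f -> bounded_Lp (fun y => c * f y).
Proof.
move=> fL; have := bounded_Lp_lin c fL bounded_Lp0; congr bounded_Lp.
by apply/funext => y; rewrite addr0.
Qed.

Lemma bounded_LpB f g : bounded_Lp f -> bounded_Lp g -> bounded_Lp (fun y => f y - g y).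
Proof.
move=> fL gL; have := bounded_Lp_lin (-1) gL fL; congr bounded_Lp.
by apply/funext => y; rewrite mulN1r addrC.
Qed.

Lemma bounded_Lp_abs f : bounded_Lp f -> bounded_Lp (fun y => `|f y|).
Proof.
move=> [fL [K fK]]; split; first by move=> k; exact: real_Lp_abs (fL k).
by exists K => k; rewrite (nr_J_abs (fL k)).
Qed.

Lemma bounded_Lp_min f g : bounded_Lp f -> bounded_Lp g ->
  bounded_Lp (fun y => Num.min (f y) (g y)).
Proof.
move=> fL gL.
have := bounded_LpZ 2^-1 (bounded_LpB (bounded_LpD fL gL) (bounded_Lp_abs (bounded_LpB fL gL))).
by congr bounded_Lp; apply/funext => y; rewrite minr_absE mulrC.
Qed.

Lemma bounded_Lp_pos f : bounded_Lp f -> bounded_Lp (fun y => Num.max (f y) 0).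
Proof.
move=> fL; have := bounded_LpZ 2^-1 (bounded_LpD fL (bounded_Lp_abs fL)).
by congr bounded_Lp; apply/funext => y; rewrite maxr_absE subr0 addr0 mulrC.
Qed.

Lemma bounded_Lp_sum (I : finType) (Q : pred I) (h : I -> Y -> R) :
  (forall i, Q i -> bounded_Lp (h i)) -> bounded_Lp (fun y => \sum_(i | Q i) h i y).
Proof.
move=> hL; rewrite (_ : (fun y => _) = \sum_(i | Q i) h i); last first.
  by apply/funext => y; rewrite fct_sumE.
by apply: big_ind => //; [exact: bounded_Lp0|move=> f g; exact: bounded_LpD].
Qed.

Lemma level_ge0 f a k : 0 <= level f a k. Proof. exact: nr_ge0. Qed.

Lemma level_le f a k : bounded_Lp f -> level f a k <= C * nr (J (slice f k)).
Proof.
by move=> [fL _]; apply: le_trans (PC _ _ _) _; rewrite (nr_J_abs (fL k)).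
Qed.

Lemma level_bounded f : bounded_Lp f -> exists K : R, forall a k, `|level f a k| <= K.
Proof.
move=> fL; have [_ [K fK]] := fL; exists (C * K) => a k; rewrite ger0_norm ?level_ge0//.
by apply: le_trans (level_le a k fL) _; rewrite ler_pM2l.
Qed.

Lemma level_bseq f a : bounded_Lp f -> bounded_seq (level f a).
Proof. by move=> /level_bounded[K fK]; exists K => k. Qed.

Lemma ulim_level_bseq f : bounded_Lp f -> bounded_seq (fun a => ulim U (level f a)).
Proof.
move=> fL; have [K fK] := level_bounded fL; exists K => a; rewrite ger0_norm.
  apply: ulim_le_cst; first exact: level_bseq.
  by apply: filterS filterT => k _ /=; apply: le_trans (fK a k); exact: ler_norm.
apply: ulim_ge_cst; first exact: level_bseq.
by apply: filterS filterT => k _; exact: level_ge0.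
Qed.

Lemma rho_mono_ae f g : bounded_Lp f -> bounded_Lp g ->
  (forall k, \forall x \ae mu, `|slice f k x| <= `|slice g k x|) -> rho f <= rho g.
Proof.
move=> fL gL fg; apply: ulim_le; [exact: ulim_level_bseq|exact: ulim_level_bseq|].
apply: filterS filterT => a _ /=; apply: ulim_le; [exact: level_bseq|exact: level_bseq|].
apply: filterS filterT => k _ /=; apply: (nr_act_mono (P0 a k)) => //.
  exact: fL.1.
exact: gL.1.
Qed.

Lemma rho_mono f g : bounded_Lp f -> bounded_Lp g -> (forall y, `|f y| <= `|g y|) ->
  rho f <= rho g.
Proof. by move=> fL gL fg; apply: rho_mono_ae => // k; apply: nearW => x; exact: fg. Qed.

Lemma rho_add_nonneg f g : bounded_Lp f -> bounded_Lp g -> (forall y, 0 <= f y) ->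
  (forall y, 0 <= g y) -> rho (fun y => f y + g y) <= rho f + rho g.
Proof.
move=> fL gL f0 g0; have fgL := bounded_LpD fL gL.
rewrite /rho -ulimD; [|exact: ulim_level_bseq|exact: ulim_level_bseq].
apply: ulim_le; [exact: ulim_level_bseq| |].
  by apply: bounded_seqD; exact: ulim_level_bseq.
apply: filterS filterT => a _ /=.
rewrite -ulimD; [|exact: level_bseq|exact: level_bseq].
apply: ulim_le; [exact: level_bseq|by apply: bounded_seqD; exact: level_bseq|].
apply: filterS filterT => k _ /=; apply: le_trans (nrD _ _).
have fk := fL.1 k; have gk := gL.1 k.
rewrite -linearD -JD; [|exact: real_Lp_abs|exact: real_Lp_abs].
rewrite le_eqVlt; apply/orP; left; apply/eqP; congr (nr (P a k (J _))).
by apply/funext => x; rewrite /slice !ger0_norm ?addr_ge0.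
Qed.

Lemma rho_abs f : rho (fun y => `|f y|) = rho f.
Proof.
rewrite /rho; congr ulim; apply/funext => a; congr ulim; apply/funext => k.
by rewrite /level /slice; congr (nr (P a k (J _))); apply/funext => x; rewrite normr_id.
Qed.

Lemma rhoD f g : bounded_Lp f -> bounded_Lp g ->
  rho (fun y => f y + g y) <= rho f + rho g.
Proof.
move=> fL gL; have faL := bounded_Lp_abs fL; have gaL := bounded_Lp_abs gL.
rewrite -[X in _ <= X + _](rho_abs f) -[X in _ <= _ + X](rho_abs g); apply: (le_trans _ (rho_add_nonneg faL gaL (fun y => normr_ge0 _) (fun y => normr_ge0 _))).
apply: rho_mono; [exact: bounded_LpD|exact: bounded_LpD|move=> y].
by rewrite [leRHS]ger0_norm ?addr_ge0// ler_normD.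
Qed.

Lemma rhoZ c f : bounded_Lp f -> rho (fun y => c * f y) = `|c| * rho f.
Proof.
move=> fL; rewrite /rho -ulimZ; [|exact: ulim_level_bseq].
congr ulim; apply/funext => a; rewrite -ulimZ; [|exact: level_bseq].
congr ulim; apply/funext => k; rewrite /level.
rewrite (_ : (fun x => `|slice (fun y => c * f y) k x|) =
  (fun x => `|c| * `|slice f k x|)); last by apply/funext => x; rewrite /slice normrM.
rewrite JZ; last exact/real_Lp_abs/fL.1.
by rewrite linearZ_LR nrZ normc_real normr_id.
Qed.

Lemma rho_ge0 f : bounded_Lp f -> 0 <= rho f.
Proof.
move=> fL; apply: ulim_ge_cst; first exact: ulim_level_bseq.
apply: filterS filterT => a _ /=; apply: ulim_ge_cst; first exact: level_bseq.
by apply: filterS filterT => k _ /=; exact: level_ge0.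
Qed.

Lemma rho_le_norm f c : bounded_Lp f -> U [set k | nr (J (slice f k)) <= c] ->
  rho f <= C * c.
Proof.
move=> fL fc; apply: ulim_le_cst; first exact: ulim_level_bseq.
apply: filterS filterT => a _ /=; apply: ulim_le_cst; first exact: level_bseq.
apply: filterS fc => k /= fc; apply: le_trans (level_le a k fL) _.
by rewrite ler_pM2l.
Qed.

Lemma rho_null_levels f b : bounded_Lp f ->
  (forall a, (b < a)%N -> level f a @ \oo --> (0 : R)) -> rho f = 0.
Proof.
move=> fL h; apply/eqP; rewrite eq_le rho_ge0// andbT.
apply: ulim_le_cst; first exact: ulim_level_bseq.
by apply: filterS (Uge b.+1) => a /= ba; rewrite ulim_null//; exact: h.
Qed.

Lemma rho_null_norm f : bounded_Lp f ->
  (fun k => nr (J (slice f k))) @ \oo --> (0 : R) -> rho f = 0.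
Proof.
move=> fL h; apply: (@rho_null_levels _ 0%N) => // a _.
apply: (@null_squeeze R _ (fun k => C * nr (J (slice f k)))).
  by move=> k; rewrite level_ge0 level_le.
by rewrite -[X in _ --> X](mulr0 C); apply: cvgM => //; exact: cvg_cst.
Qed.

Lemma rho_superadd f g : bounded_Lp f -> bounded_Lp g -> (forall y, 0 <= f y) ->
  (forall y, 0 <= g y) -> rho f `^ p + rho g `^ p <= rho (fun y => f y + g y) `^ p.
Proof.
move=> fL gL f0 g0; have fgL := bounded_LpD fL gL.
have in0 h a : bounded_Lp h -> 0 <= ulim U (level h a).
  move=> hL; apply: ulim_ge_cst; first exact: level_bseq.
  by apply: filterS filterT => k _; exact: level_ge0.
have lim_le (x y z : nat -> R) : bounded_seq x -> bounded_seq y -> bounded_seq z ->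
    (forall n, 0 <= x n) -> (forall n, 0 <= y n) -> (forall n, 0 <= z n) ->
    (forall n, x n `^ p + y n `^ p <= z n `^ p) ->
    ulim U x `^ p + ulim U y `^ p <= ulim U z `^ p.
  move=> bx b_y bz x0 y0 z0 h.
  apply: (@ler_cvg_to _ U _ _ (fun n => x n `^ p + y n `^ p) (fun n => z n `^ p)).
  - by apply: cvgD; exact: ulim_powR.
  - exact: ulim_powR.
  - by apply: filterS filterT => n _ /=.
apply: (lim_le _ _ _); try exact: ulim_level_bseq; try by move=> a; exact: in0.
move=> a; apply: lim_le; try exact: level_bseq; try by move=> k; exact: level_ge0.
move=> k; rewrite /level.
have fk := real_Lp_abs (fL.1 k); have gk := real_Lp_abs (gL.1 k).
have -> : J (fun x => `|slice (fun y => f y + g y) k x|) =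
    J (fun x => `|slice f k x|) + J (fun x => `|slice g k x|).
  rewrite -JD//; congr J; apply/funext => x; rewrite /slice.
  by rewrite !ger0_norm ?addr_ge0.
rewrite linearD; apply: nr_superadd; apply: P0; apply: J_nonneg => //; exact: nearW.
Qed.

Lemma rho_cst0 : rho (fun=> 0) = 0.
Proof.
have E := rhoZ 0 bounded_Lp0; rewrite normr0 [RHS]mul0r in E.
by rewrite -[RHS]E; congr rho; apply/funext => y; rewrite mul0r.
Qed.

Lemma rho_superadd_sum m (h : 'I_m -> Y -> R) : (forall i, bounded_Lp (h i)) ->
  (forall i y, 0 <= h i y) -> \sum_i rho (h i) `^ p <= rho (fun y => \sum_i h i y) `^ p.
Proof.
elim: m h => [|m IH] h hL h0.
  by rewrite big_ord0 powR_ge0.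
rewrite big_ord_recr /=.
have -> : (fun y => \sum_i h i y) =
  (fun y => \sum_(i < m) h (widen_ord (leqnSn m) i) y + h ord_max y).
  by apply/funext => y; rewrite big_ord_recr.
apply: le_trans (rho_superadd _ _ _ _) => //.
- by rewrite lerD2r; apply: IH.
- by apply: bounded_Lp_sum.
- by move=> y; apply: sumr_ge0.
Qed.

End asymptotic_lattice.

(** * The lattice of asymptotically fixed sequences *)

Lemma half_le (R : realType) (a b c : R) : 1 <= a -> b <= 1 / 2 -> a <= c + b -> 1 / 2 <= c.
Proof. by move=> *; lra. Qed.

Lemma min_perturb (R : realType) (a a' b b' g : R) :
  Num.min (Num.min a g) (Num.min a' g) <= Num.min b b' + (`|a - b| + `|a' - b'|).
Proof.
have h1 : Num.min (Num.min a g) (Num.min a' g) <= a by rewrite !ge_min lexx.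
have h2 : Num.min (Num.min a g) (Num.min a' g) <= a' by rewrite !ge_min lexx !orbT.
have := ler_norm (a - b); have := ler_norm (a' - b').
have := normr_ge0 (a - b); have := normr_ge0 (a' - b').
move: h1 h2; move: (Num.min (Num.min a g) _) => x *.
by rewrite /Num.min; case: ifPn; rewrite -?leNgt => ?; lra.
Qed.

Section asymptotically_fixed.
Context d (X : measurableType d) (R : realType).
Variables (mu : {measure set X -> \bar R}) (p : R) (p1 : 1 <= p).
Local Notation E := (Lp mu p1).
Local Notation J := (J mu p1).
Variables (U : set_system nat) (UU : UltraFilter U).
Hypothesis Uge : forall m, U [set n | (m <= n)%N].
Variables (P : nat -> nat -> {linear E -> E}) (C : R).
Hypothesis C1 : 1 <= C.
Hypothesis P0 : forall a k, positive_op (P a k).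
Hypothesis PC : forall a k v, nr (P a k v) <= C * nr v.
Hypothesis PP : forall a b, (b < a)%N -> exists2 D : nat -> R, D @ \oo --> (0 : R) &
  forall k v, nr (P a k (P b k v - v)) <= D k * nr v.

Let p0 : 0 < p. Proof. exact: lt_le_trans p1. Qed.
Let C0 : 0 < C. Proof. exact: lt_le_trans C1. Qed.

Local Notation Y := (nat * X)%type.
Local Notation bounded_Lp := (bounded_Lp mu p1).
Local Notation rho := (rho U P).
Implicit Types f g : Y -> R.

Let rho_mono_ae := @rho_mono_ae _ _ _ _ _ _ _ UU _ _ C1 P0 PC.
Let rho_mono := @rho_mono _ _ _ _ _ _ _ UU _ _ C1 P0 PC.
Let rhoD := @rhoD _ _ _ _ _ _ _ UU _ _ C1 P0 PC.
Let rhoZ := @rhoZ _ _ _ _ _ _ _ UU _ _ C1 PC.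
Let rho_ge0 := @rho_ge0 _ _ _ _ _ _ _ UU _ _ C1 PC.

Let rho_null f g : bounded_Lp f -> bounded_Lp g ->
  (forall k, \forall x \ae mu, `|slice f k x| <= `|slice g k x|) -> rho g = 0 -> rho f = 0.
Proof.
move=> fL gL fg g0; apply/eqP; rewrite eq_le rho_ge0// andbT -g0.
exact: rho_mono_ae.
Qed.

Definition act_level b f : Y -> R := fun y => act (P b y.1) (slice f y.1) y.2.

Lemma act_level_bounded b f : bounded_Lp f -> bounded_Lp (act_level b f).
Proof.
move=> [fL [K fK]]; split; first by move=> k; exact: (act_Lp (P b k) (slice f k)).
exists (C * K) => k; rewrite (J_act (P0 b k) (fL k)).
by apply: le_trans (PC _ _ _) _; rewrite ler_pM2l.
Qed.

Definition asym_fixed : set (Y -> R) := [set f | bounded_Lp f /\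
  forall b, rho (fun y => act_level b f y - f y) = 0].

Let defect_bounded b f : bounded_Lp f -> bounded_Lp (fun y => act_level b f y - f y).
Proof. by move=> fL; apply: bounded_LpB => //; exact: act_level_bounded. Qed.

Lemma asym_fixed_lin c f g : asym_fixed f -> asym_fixed g ->
  asym_fixed (fun y => c * f y + g y).
Proof.
move=> [fL fF] [gL gF]; have fgL := bounded_Lp_lin c fL gL; split; [exact: fgL|move=> b].
have dfL := defect_bounded b fL; have dgL := defect_bounded b gL.
apply: (rho_null (defect_bounded b fgL) (bounded_Lp_lin c dfL dgL)).
  move=> k; have h1 := Lp_reprD (c%:C *: P b k (J (slice f k))) (P b k (J (slice g k))).
  apply: filterS2 h1 (Lp_reprZ c%:C (P b k (J (slice f k)))) => x E1 E2.
  rewrite le_eqVlt; apply/orP; left; apply/eqP; congr `|_|.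
  rewrite {1}/slice /act_level /= /act (_ : slice (fun y => c * f y + g y) k =
    (fun x => c * slice f k x + slice g k x))// (J_lin c (fL.1 k) (gL.1 k)) linearP.
  rewrite E1 E2 /slice /=.
  case: (Lp_repr _ x) (Lp_repr _ x) => [a a'] [e e'] /=; rewrite mul0r subr0; ring.
apply/eqP; rewrite eq_le rho_ge0 ?andbT; last exact: bounded_Lp_lin.
apply: le_trans (rhoD (bounded_LpZ c dfL) dgL) _.
by rewrite rhoZ// fF gF mulr0 addr0.
Qed.

Lemma asym_fixed0 : asym_fixed (fun=> 0).
Proof.
have L0 := @bounded_Lp0 _ X R mu p p1; split => // b.
apply: (rho_null (defect_bounded b L0) L0); last exact: (rho_cst0 UU C1 PC).
move=> k; rewrite /slice /= /act_level /act /=.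
rewrite (_ : slice (fun=> 0) k = fun=> 0)// (J0 mu p1) linear0.
by apply: filterS (Lp_repr0 mu p1) => x -> /=; rewrite subr0 !normr0.
Qed.

(** Let [h] be the defect of the modulus of [f] at level [b]. By positivity the averages
    of level [b] do not decrease the modulus of [f], except by the defect of [f], so the
    negative part [hn] of [h] is null. Averages of a higher level send [h] to zero, as
    they do not see those of level [b]. Hence [h + 2 hn], the modulus of [h], is null. *)
Lemma asym_fixed_abs f : asym_fixed f -> asym_fixed (fun y => `|f y|).
Proof.
move=> [fL fF]; have aL := bounded_Lp_abs fL; split; [exact: aL|move=> b].
set h := fun y => _; have hL : bounded_Lp h by exact: defect_bounded.
pose hn y := Num.max (-1 * h y) 0.
have hnL : bounded_Lp hn by apply: bounded_Lp_pos; exact: bounded_LpZ.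
have hn0 : rho hn = 0.
  apply: (rho_null hnL (defect_bounded b fL)) => // k.
  apply: filterS (act_abs (P0 b k) (fL.1 k)) => x hx.
  have -> : slice hn k x = Num.max (`|f (k, x)| - act (P b k) (fun x => `|slice f k x|) x) 0.
    by rewrite /slice /hn /h /act_level /= mulN1r opprB.
  rewrite [X in _ <= `|X|](_ : _ = act (P b k) (slice f k) x - f (k, x))//.
  rewrite ger0_norm ?le_max ?lexx ?orbT// ge_max normr_ge0 andbT distrC.
  by apply: le_trans _ (ler_dist_dist _ _); apply: le_trans _ (ler_norm _); rewrite lerD2l lerN2.
have [_ [K fK]] := fL.
have lev a : (b < a)%N -> ulim U (level P h a) <= 2 * ulim U (level P hn a).
  move=> /PP[D D0 hD].
  have Dn : (fun k => `|D k| * K) @ \oo --> (0 : R).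
    rewrite -[X in _ --> X](mul0r K); apply: cvgM; last exact: cvg_cst.
    by rewrite -(normr0 R); exact: cvg_norm.
  have Db : bounded_seq (fun k => nr (P a k (J (slice h k)))).
    have [_ [K' hK']] := hL; exists (C * K') => k; rewrite ger0_norm ?nr_ge0//.
    by apply: le_trans (PC _ _ _) _; rewrite ler_pM2l.
  have Dnull : ulim U (fun k => nr (P a k (J (slice h k)))) = 0.
    apply: (ulim_null UU Uge); apply: null_squeeze Dn => k; rewrite nr_ge0 /=.
    have -> : J (slice h k) = P b k (J (slice (fun y => `|f y|) k)) - J (slice (fun y => `|f y|) k).
      rewrite -(J_act (P0 b k) (aL.1 k)) -JB//; last exact: aL.1.
      exact: (act_Lp (P b k) (slice (fun y => `|f y|) k)).
    apply: le_trans (hD _ _) _; rewrite (nr_J_abs (fL.1 k)).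
    apply: le_trans (ler_wpM2r (nr_ge0 _) (ler_norm _)) _.
    by apply: ler_wpM2l.
  have hnb := level_bseq C1 PC a hnL.
  rewrite -[leRHS]add0r -Dnull -ulimZ// -ulimD//; last exact: bounded_seqZ.
  apply: ulim_le; [exact: (level_bseq C1 PC a hL)|by apply: bounded_seqD => //; exact: bounded_seqZ|].
  apply: filterS filterT => k _ /=; rewrite /level.
  have -> : J (fun x => `|slice h k x|) = J (slice h k) + (2 : R)%:C *: J (fun x => `|slice hn k x|).
    have hnk := real_Lp_abs (hnL.1 k).
    rewrite addrC -(J_lin 2 hnk (hL.1 k)); congr J; apply/funext => x.
    rewrite /hn /slice /Num.max; case: ifPn => hx; last first.
      by move: hx; rewrite -leNgt => hx; rewrite ler0_norm ?ger0_norm; lra.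
    by rewrite normr0 ger0_norm; lra.
  rewrite linearD linearZ_LR; apply: le_trans (nrD _ _) _.
  by rewrite nrZ normc_real ger0_norm.
apply/eqP; rewrite eq_le rho_ge0// andbT -[leRHS](mulr0 2) -[X in 2 * X]hn0.
rewrite /rho -ulimZ; last exact: (ulim_level_bseq UU C1 PC hnL).
apply: ulim_le; first exact: (ulim_level_bseq UU C1 PC hL).
  by apply: bounded_seqZ; exact: (ulim_level_bseq UU C1 PC hnL).
by apply: filterS (Uge b.+1) => a /= ba; exact: lev.
Qed.

(** The averages [P a k] are taken along operators [T \o Q k], powers of [T]; [UI] says
    that [T] maps the unit ball into an order interval, up to [e]. *)
Section counting.
Variables (T : {linear E -> E}) (Q : nat -> {linear E -> E}).
Hypothesis QC : forall k v, nr (Q k v) <= C * nr v.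
Hypothesis PT : forall a, exists2 D : nat -> R, D @ \oo --> (0 : R) &
  forall k v, nr (P a k v - T (Q k (P a k v))) <= D k * nr v.
Hypothesis UI : forall e : R, 0 < e -> exists g : X -> R,
  [/\ real_Lp mu p1 g, forall x, 0 <= g x &
  forall f : E, nr f <= 1 ->
    nr (J (fun x => Num.max (`|complex.Re (Lp_repr (T f) x)| - g x) 0)) <= e].

(* The averaged members of a family below have norm at most 2, and [Q] maps them into
   the ball of radius [2 C]. *)
Let UI_scaled : exists g : X -> R, [/\ real_Lp mu p1 g, forall x, 0 <= g x &
  forall f : E, nr f <= 2 * C ->
    nr (J (fun x => Num.max (`|complex.Re (Lp_repr (T f) x)| - g x) 0)) <= (4 * C)^-1].
Proof.
have c0 : 0 < 2 * C by rewrite mulr_gt0.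
have e0 : 0 < (4 * C)^-1 / (2 * C) by rewrite divr_gt0// invr_gt0 mulr_gt0.
have [g [gL g0 hg]] := UI e0.
exists (fun x => 2 * C * g x); split; [exact: real_LpZ|by move=> x; rewrite mulr_ge0// ltW|].
move=> f fC; pose f' := (2 * C)^-1%:C *: f.
have ci : 0 <= (2 * C)^-1 by rewrite invr_ge0 ltW.
have f'1 : nr f' <= 1 by rewrite nrZ normcR// mulrC ler_pdivrMr// mul1r.
have fE : f = (2 * C)%:C *: f'.
  by rewrite /f' scalerA -rmorphM /= mulfV ?gt_eqF// scale1r.
have hL' : real_Lp mu p1 (fun x => Num.max (`|complex.Re (Lp_repr (T f') x)| - g x) 0).
  by apply: real_Lp_pos; apply: real_LpB => //; apply: real_Lp_abs; exact: Re_repr_in.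
have hL : real_Lp mu p1 (fun x => Num.max (`|complex.Re (Lp_repr (T f) x)| - 2 * C * g x) 0).
  apply: real_Lp_pos; apply: real_LpB; last exact: real_LpZ.
  by apply: real_Lp_abs; exact: Re_repr_in.
have := hg f' f'1; rewrite ler_pdivlMr// mulrC => h; apply: le_trans h.
rewrite -[X in _ <= X * _](gtr0_norm c0) -normc_real -nrZ -JZ//.
rewrite le_eqVlt; apply/orP; left; apply/eqP; congr nr; apply: J_ae_eq => //.
  exact: real_LpZ.
have h1 := Lp_reprZ (2 * C)%:C (T f').
rewrite fE linearZ_LR; apply: filterS h1 => x ->.
rewrite maxr_pMr ?(ltW c0)// mulr0 mulrBr; congr (Num.max (_ - _) _).
case: (Lp_repr (T f') x) => a b /=.
by rewrite mul0r subr0 normrM (gtr0_norm c0).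
Qed.

(** Asymptotically fixed sequences are nearly in the image of [T], so up to an error of
    seminorm at most 1/2 the members [e i] lie below the order bound [g]. The truncated
    members [h i] keep seminorm at least 1/2 and are disjoint, so that their sum is also
    below [g], up to a null function; superadditivity of the p-th power of [rho] then
    bounds their number. *)
Lemma disjoint_count_normalised : exists N : nat, forall m (e : 'I_m -> Y -> R),
  (forall i, [/\ asym_fixed (e i), forall y, 0 <= e i y & rho (e i) = 1]) ->
  (forall i j, i != j -> rho (fun y => Num.min (e i y) (e j y)) = 0) -> (m <= N)%N.
Proof.
have [g [gL g0 hg]] := UI_scaled.
pose B := C * nr (J g).
have B0 : 0 <= B by rewrite mulr_ge0 ?nr_ge0 ?ltW.
exists (Num.truncn ((2 * B) `^ p)) => m e eP eD.
have eF i : asym_fixed (e i) by have [] := eP i.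
have eL i : bounded_Lp (e i) by case: (eF i).
have e0 i y : 0 <= e i y by have [] := eP i.
have e1 i : rho (e i) = 1 by have [] := eP i.
(* One level must serve all members, for the averaged ones to have norm below 2. *)
have [a ha] : exists a, forall i, ulim U (level P (e i) a) < 2.
  have h i : U [set a | ulim U (level P (e i) a) < 2].
    apply: (ulim_lt UU (ulim_level_bseq UU C1 PC (eL i))).
    by rewrite -/(rho (e i)) e1 ltr1n.
  have : U [set a | forall i, ulim U (level P (e i) a) < 2].
    exact: (@filter_forall _ 'I_m (fun i a => ulim U (level P (e i) a) < 2)).
  by move=> /filter_ex[a ?]; exists a.
pose w i y := `|act_level a (e i) y|.
have wL i : bounded_Lp (w i) by apply: bounded_Lp_abs; exact: act_level_bounded.
have w0 i y : 0 <= w i y by exact: normr_ge0.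
have we i : rho (fun y => w i y - e i y) = 0.
  apply: (rho_null (bounded_LpB (wL i) (eL i)) (defect_bounded a (eL i))).
    move=> k; apply: nearW => x; rewrite /slice /w -{1}(ger0_norm (e0 i (k, x))).
    exact: ler_dist_dist.
  by have [_] := eF i.
have [D D0 hD] := PT a.
pose G : Y -> R := fun y => g y.2.
have GL : bounded_Lp G by split; [move=> k; exact: gL|exists (nr (J g)) => k].
pose r i y := Num.max (w i y - G y) 0.
have rL i : bounded_Lp (r i) by apply: bounded_Lp_pos; exact: bounded_LpB.
have r0 i y : 0 <= r i y by rewrite /r le_max lexx orbT.
have rr i : rho (r i) <= 1 / 2.
  have [_ [K eK]] := eL i.
  have K0 : 0 <= K by apply: le_trans (eK 0%N); exact: nr_ge0.
  have Dn : U [set k | `|D k| * K <= (4 * C)^-1].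
    have e4 : 0 < (4 * C)^-1 / (K + 1).
      by rewrite divr_gt0 ?invr_gt0 ?mulr_gt0// ltr_wpDl.
    have /nullP/(_ _ e4)[N hN] := D0; apply: filterS (Uge N) => k /= /hN /ltW.
    rewrite ler_pdivlMr ?ltr_wpDl// => h; apply: le_trans h.
    by rewrite ler_wpM2l// lerDl.
  have lk : U [set k | nr (P a k (J (slice (e i) k))) <= 2].
    apply: filterS (ulim_lt UU (level_bseq C1 PC a (eL i)) (ha i)) => k /= /ltW.
    rewrite /level (_ : (fun x => `|slice (e i) k x|) = slice (e i) k)//.
    by apply/funext => x; rewrite /slice ger0_norm.
  have -> : 1 / 2 = C * ((4 * C)^-1 + (4 * C)^-1) by field; rewrite gt_eqF.
  apply: (rho_le_norm UU C1 PC (rL i)).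
  apply: filterS2 Dn lk => k /= Dk lk.
  set v := P a k (J (slice (e i) k)).
  have eLk := (eL i).1 k.
  pose z x := complex.Re (Lp_repr (T (Q k v)) x).
  pose s x := Num.max (`|z x| - g x) 0.
  have zL : real_Lp mu p1 z by exact: Re_repr_in.
  have sL : real_Lp mu p1 s by apply: real_Lp_pos; apply: real_LpB => //; exact: real_Lp_abs.
  have dL := Re_repr_in (v - T (Q k v)).
  have Qv : nr (Q k v) <= 2 * C.
    by apply: le_trans (QC _ _) _; rewrite mulrC ler_pM2r.
  have h1 : nr (J (fun x => `|complex.Re (Lp_repr (v - T (Q k v)) x)|)) <= (4 * C)^-1.
    rewrite (nr_J_abs dL); apply: (@le_trans _ _ (nr (v - T (Q k v)))).
      apply: nr_ae_le; apply: filterS (J_repr dL) => x ->.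
      by rewrite normc_real normc_Re.
    apply: le_trans (hD _ _) _; apply: le_trans Dk.
    apply: le_trans (ler_wpM2r (nr_ge0 _) (ler_norm _)) _.
    by rewrite ler_wpM2l.
  apply: (@le_trans _ _ (nr (J (fun x => `|complex.Re (Lp_repr (v - T (Q k v)) x)| + s x)))).
    apply: nr_ae_le; have dsL := real_LpD (real_Lp_abs dL) sL.
    apply: filterS3 (J_repr ((rL i).1 k)) (J_repr dsL) (Lp_reprB v (T (Q k v))) => x -> -> ->.
    rewrite !normc_real /slice /r /G /w /act_level /act /= -/v /s /z.
    case: (Lp_repr v x) (Lp_repr (T (Q k v)) x) => [b b'] [c c'] /=.
    rewrite ger0_norm ?le_max ?lexx ?orbT// [leRHS]ger0_norm; last first.
      by rewrite addr_ge0// le_max lexx orbT.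
    rewrite ge_max addr_ge0 ?le_max ?lexx ?orbT//= andbT.
    have := ler_normD (b - c) c; rewrite subrK.
    have : `|c| - g x <= Num.max (`|c| - g x) 0 by rewrite le_max lexx.
    by move=> *; lra.
  rewrite (JD (real_Lp_abs dL) sL); apply: le_trans (nrD _ _) _.
  by apply: lerD => //; exact: hg.
pose h i y := Num.min (w i y) (G y).
have hL i : bounded_Lp (h i) by exact: bounded_Lp_min.
have h0 i y : 0 <= h i y by rewrite /h le_min w0 g0.
have rw i : 1 <= rho (w i).
  rewrite -(e1 i); apply: (@le_trans _ _ (rho (fun y => w i y + -1 * (w i y - e i y)))).
    apply: rho_mono => //; first by apply: bounded_LpD => //; apply/bounded_LpZ/bounded_LpB.
    by move=> y; rewrite mulN1r opprB addrC subrK.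
  apply: le_trans (rhoD (wL i) (bounded_LpZ (-1) (bounded_LpB (wL i) (eL i)))) _.
  by rewrite rhoZ ?we ?mulr0 ?addr0//; exact: bounded_LpB.
have rh i : 1 / 2 <= rho (h i).
  have : rho (w i) <= rho (h i) + rho (r i).
    apply: le_trans (rhoD (hL i) (rL i)); apply: rho_mono => //; first exact: bounded_LpD.
    move=> y; rewrite le_eqVlt; apply/orP; left; apply/eqP; congr `|_|.
    by rewrite /h /r /Num.min /Num.max; do 2 (case: ifPn; rewrite -?leNgt => ?); lra.
  exact: half_le (rw i) (rr i).
have hh i j : i != j -> rho (fun y => Num.min (h i y) (h j y)) = 0.
  move=> ij; pose q y := Num.min (e i y) (e j y) + (`|w i y - e i y| + `|w j y - e j y|).
  have dL k : bounded_Lp (fun y => `|w k y - e k y|) by apply/bounded_Lp_abs/bounded_LpB.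
  have eeL : bounded_Lp (fun y => Num.min (e i y) (e j y)) by exact: bounded_Lp_min.
  have ddL : bounded_Lp (fun y => `|w i y - e i y| + `|w j y - e j y|) by exact: bounded_LpD.
  have qL : bounded_Lp q by exact: bounded_LpD.
  apply: (rho_null (g := q)) => //; first exact: bounded_Lp_min.
    move=> k; apply: nearW => x; set y := (k, x).
    suff : `|Num.min (h i y) (h j y)| <= `|q y| by [].
    have hm : 0 <= Num.min (h i y) (h j y).
      by rewrite le_min; apply/andP; split; exact: h0.
    rewrite (ger0_norm hm); apply: le_trans (ler_norm _).
    by rewrite /q /h; exact: min_perturb.
  apply/eqP; rewrite eq_le rho_ge0// andbT.
  apply: le_trans (rhoD eeL ddL) _; rewrite eD// add0r.
  apply: le_trans (rhoD (dL i) (dL j)) _.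
  by rewrite !(rho_abs U P (fun y => w _ y - e _ y)) !we addr0.
pose S y := \sum_i h i y.
have SL : bounded_Lp S by apply: bounded_Lp_sum.
pose M y := \sum_i \sum_(j | j != i) Num.min (h i y) (h j y).
have ML : bounded_Lp M.
  by apply: bounded_Lp_sum => i _; apply: bounded_Lp_sum => j _; exact: bounded_Lp_min.
have rM : rho M = 0.
  apply/eqP; rewrite eq_le rho_ge0// andbT.
  have rs (I : finType) (q : pred I) (f : I -> Y -> R) : (forall i, q i -> bounded_Lp (f i)) ->
      (forall i, q i -> rho (f i) = 0) -> rho (fun y => \sum_(i | q i) f i y) <= 0.
    move=> fL f0; rewrite (_ : (fun y => _) = \sum_(i | q i) f i); last first.
      by apply/funext => y; rewrite fct_sumE.
    suff [//] : rho (\sum_(i | q i) f i) <= 0 /\ bounded_Lp (\sum_(i | q i) f i).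
    elim/big_ind: _ => [|x y [x1 x2] [y1 y2]|i qi].
    - by rewrite (rho_cst0 UU C1 PC); split => //; exact: bounded_Lp0.
    - split; last exact: bounded_LpD.
      have xy := lerD x1 y1; rewrite addr0 in xy.
      exact: le_trans (rhoD x2 y2) xy.
    - by rewrite f0//; split => //; exact: fL.
  apply: (rs _) => [i _|i _]; first by apply: bounded_Lp_sum => j _; exact: bounded_Lp_min.
  apply/eqP; rewrite eq_le; apply/andP; split; last first.
    by apply: rho_ge0; apply: bounded_Lp_sum => j _; exact: bounded_Lp_min.
  apply: (rs _) => j ji; first exact: bounded_Lp_min.
  by apply: hh; rewrite eq_sym.
(* At each point the largest member is below [G], and each other one is its own minimum
   with the largest, which is a term of the null function [M]. *)
have SM y : S y <= G y + M y.
  have [m0|/prednK m0] := posnP m.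
    rewrite /S big1; last by case=> i im; exfalso; move: im; rewrite m0.
    rewrite addr_ge0 ?g0//; apply: sumr_ge0 => i _; apply: sumr_ge0 => j _.
    by rewrite le_min; apply/andP; split; exact: h0.
  have i0 : 'I_m by exists 0%N; rewrite -m0.
  pose i := [arg max_(i > i0) h i y]%O.
  have imax j : h j y <= h i y by rewrite /i; case: arg_maxP => // k _; exact.
  rewrite /S (bigD1 i)//=; apply: lerD; first by rewrite /h ge_min lexx orbT.
  apply: (@le_trans _ _ (\sum_(j | j != i) Num.min (h i y) (h j y))).
    by apply: ler_sum => j _; rewrite le_min imax lexx.
  rewrite /M [X in _ <= X](bigD1 i)//= lerDl.
  by apply: sumr_ge0 => k _; apply: sumr_ge0 => j _; rewrite le_min; apply/andP; split; exact: h0.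
have S0 y : 0 <= S y by apply: sumr_ge0.
have rS : rho S <= B.
  apply: (@le_trans _ _ (rho (fun y => G y + M y))).
    apply: rho_mono => //; first exact: bounded_LpD.
    by move=> y; rewrite ger0_norm// (le_trans (SM y))// ler_norm.
  apply: le_trans (rhoD GL ML) _; rewrite rM addr0.
  by apply: (rho_le_norm UU C1 PC GL); apply: filterS filterT => k _ /=.
have := rho_superadd_sum UU C1 P0 PC hL h0.
move=> hsum.
have : m%:R * (1 / 2) `^ p <= B `^ p.
  apply: le_trans (_ : rho S `^ p <= _); last first.
    by apply: ge0_ler_powR; rewrite ?nnegrE ?rho_ge0 ?(ltW p0).
  apply: le_trans hsum; rewrite -[m in leLHS]card_ord mulr_natl -sumr_const.
  apply: ler_sum => i _; apply: ge0_ler_powR; first exact: ltW.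
  - by rewrite nnegrE.
  - by rewrite nnegrE; exact: rho_ge0.
  - exact: rh.
move=> hm; rewrite truncn_ge_nat ?powR_ge0// powRM//.
have h2 : (1 / 2 : R) `^ p * 2 `^ p = 1.
  by rewrite -powRM// ?divr_ge0// div1r mulVf// powR1.
rewrite mulrC -ler_pdivrMr ?powR_gt0//.
suff -> : m%:R / 2 `^ p = m%:R * (1 / 2) `^ p by [].
congr (_ * _); apply: (mulIf (lt0r_neq0 (powR_gt0 p (ltr0n R 2)))).
by rewrite mulVf ?h2// gt_eqF// powR_gt0.
Qed.

Lemma disjoint_count : exists N : nat, forall m (e : 'I_m -> Y -> R),
  disjoint_family asym_fixed rho e -> (m <= N)%N.
Proof.
have [N hN] := disjoint_count_normalised; exists N => m e [e1 e2].
have eL i : bounded_Lp (e i) by have [[]] := e1 i.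
pose c i := (rho (e i))^-1.
have c0 i : 0 < c i by rewrite invr_gt0; have [] := e1 i.
apply: (hN m (fun i y => c i * e i y)) => [i|i j ij].
  have [Fe e0 re] := e1 i; split.
  - have := asym_fixed_lin (c i) Fe asym_fixed0; congr asym_fixed.
    by apply/funext => y; rewrite addr0.
  - by move=> y; rewrite mulr_ge0// ltW.
  - by rewrite rhoZ// gtr0_norm// mulVf// gt_eqF.
have ijL : bounded_Lp (fun y => Num.min (e i y) (e j y)) by exact: bounded_Lp_min.
apply: (rho_null (g := fun y => (c i + c j) * Num.min (e i y) (e j y))).
- by apply: bounded_Lp_min; exact: bounded_LpZ.
- exact: bounded_LpZ.
- move=> k; apply: nearW => x; rewrite /slice; set y := (k, x).
  have [_ ei _] := e1 i; have [_ ej _] := e1 j.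
  have := ei y; have := ej y; have := c0 i; have := c0 j.
  move: (c i) (c j) (e i y) (e j y) => b b' z z' hb hb' hz hz'.
  rewrite ger0_norm ?le_min ?mulr_ge0 ?(ltW hb) ?(ltW hb')// ger0_norm; last first.
    by rewrite mulr_ge0 ?le_min ?hz ?hz' ?addr_ge0 ?ltW.
  have h1 : 0 <= b * z by rewrite mulr_ge0// ltW.
  have h2 : 0 <= b' * z by rewrite mulr_ge0// ltW.
  have h3 : 0 <= b * z' by rewrite mulr_ge0// ltW.
  have h4 : 0 <= b' * z' by rewrite mulr_ge0// ltW.
  by rewrite /Num.min; case: ifPn; rewrite -?leNgt => ?; case: ifPn; rewrite -?leNgt => ?; nra.
- by rewrite rhoZ// e2// mulr0.
Qed.

(** The sublattice is finite-dimensional, and on asymptotically fixed sequences [rho]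
    dominates the limit of the norms. *)
Lemma asym_fixed_coloring (delta : R) : 0 < delta ->
  exists (K : finType) (col : (Y -> R) -> K), forall f f',
    (forall k, real_Lp mu p1 (slice f k)) -> (forall k, real_Lp mu p1 (slice f' k)) ->
    (forall k, nr (J (slice f k)) <= 1) -> (forall k, nr (J (slice f' k)) <= 1) ->
    (forall b, (fun k => nr (P b k (J (slice f k)) - J (slice f k))) @ \oo --> (0 : R)) ->
    (forall b, (fun k => nr (P b k (J (slice f' k)) - J (slice f' k))) @ \oo --> (0 : R)) ->
    col f = col f' -> U [set k | nr (J (slice f k) - J (slice f' k)) < delta].
Proof.
move=> delta0; have [N hN] := disjoint_count.
have Fm f g : asym_fixed f -> asym_fixed g -> (forall y, `|f y| <= `|g y|) -> rho f <= rho g.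
  by move=> [fL _] [gL _]; exact: rho_mono.
have FD f g : asym_fixed f -> asym_fixed g -> rho (fun y => f y + g y) <= rho f + rho g.
  by move=> [fL _] [gL _]; exact: rhoD.
have FZ c f : asym_fixed f -> rho (fun y => c * f y) = `|c| * rho f.
  by move=> [fL _]; exact: rhoZ.
have [m [e [de emax]]] := max_disjoint_family hN.
have dC : 0 < delta / C by rewrite divr_gt0.
have [K [col colP]] := coloring_from_family asym_fixed0 asym_fixed_lin asym_fixed_abs
  Fm FD FZ de emax dC.
have Ci : 0 <= C^-1 by rewrite invr_ge0 ltW.
(* Averaging may increase the norm by the factor [C], hence the rescaling. *)
exists K, (fun f => col (fun y => C^-1 * f y)) => f f' fk fk' f1 f1' ff ff' E.
have fL : bounded_Lp f by split => //; exists 1.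
have fL' : bounded_Lp f' by split => //; exists 1.
have fix_asym g : bounded_Lp g ->
    (forall b, (fun k => nr (P b k (J (slice g k)) - J (slice g k))) @ \oo --> (0 : R)) ->
    asym_fixed g.
  move=> gL gf; split => // b; apply: (rho_null_norm UU Uge C1 PC); first exact: defect_bounded.
  rewrite (_ : (fun k => _) = (fun k => nr (P b k (J (slice g k)) - J (slice g k)))); first exact: gf.
  apply/funext => k; rewrite -(J_act (P0 b k) (gL.1 k)) -JB//; last exact: gL.1.
  exact: (act_Lp (P b k) (slice g k)).
have fF := fix_asym f fL ff; have fF' := fix_asym f' fL' ff'.
have cF g : asym_fixed g -> asym_fixed (fun y => C^-1 * g y).
  move=> gF; have := asym_fixed_lin C^-1 gF asym_fixed0; congr asym_fixed.
  by apply/funext => y; rewrite addr0.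
have c1 g : bounded_Lp g -> (forall k, nr (J (slice g k)) <= 1) -> rho (fun y => C^-1 * g y) <= 1.
  move=> gL g1; rewrite rhoZ// ger0_norm// mulrC ler_pdivrMr// mul1r -[leRHS]mulr1.
  by apply: (rho_le_norm UU C1 PC gL); apply: filterS filterT => k _ /=.
have := colP _ _ (cF f fF) (cF f' fF') (c1 f fL f1) (c1 f' fL' f1') E.
have dL : bounded_Lp (fun y => f y - f' y) by exact: bounded_LpB.
rewrite (_ : (fun y => _) = (fun y => C^-1 * (f y - f' y))); last first.
  by apply/funext => y; rewrite mulrBr.
rewrite rhoZ// ger0_norm// mulrC ltr_pM2r ?invr_gt0// => rd.
have Jd k : J (slice (fun y => f y - f' y) k) = J (slice f k) - J (slice f' k).
  by rewrite -JB.
have nb : bounded_seq (fun k => nr (J (slice f k) - J (slice f' k))).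
  exists 2 => k; rewrite ger0_norm ?nr_ge0//; apply: le_trans (nrB _ _) _.
  by rewrite -[2]/(1 + 1) lerD.
suff : ulim U (fun k => nr (J (slice f k) - J (slice f' k))) <= rho (fun y => f y - f' y).
  by move=> h; apply: (ulim_lt UU nb); exact: le_lt_trans h rd.
apply: ulim_ge_cst; first exact: (ulim_level_bseq UU C1 PC dL).
apply: filterS filterT => a _ /=.
pose t k := nr (P a k (J (slice f k)) - J (slice f k)) + nr (P a k (J (slice f' k)) - J (slice f' k)).
have t0 : t @ \oo --> (0 : R) by rewrite -[X in _ --> X]addr0; exact: cvgD.
have tb : bounded_seq t.
  exists (2 * (C + 1)) => k; rewrite ger0_norm ?addr_ge0 ?nr_ge0//.
  have h v : nr v <= 1 -> nr (P a k v - v) <= C + 1.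
    move=> v1; apply: le_trans (nrB _ _) _; apply: lerD => //.
    by apply: le_trans (PC _ _ _) _; rewrite -[leRHS]mulr1 ler_pM2l.
  by have := h _ (f1 k); have := h _ (f1' k); rewrite /t; lra.
have lb := level_bseq C1 PC a dL.
rewrite -[leRHS]addr0 -(ulim_null UU Uge t0) -ulimD//.
apply: ulim_le => //; first exact: bounded_seqD.
apply: filterS filterT => k _ /=.
apply: (@le_trans _ _ (nr (P a k (J (slice (fun y => f y - f' y) k))) + t k)).
  rewrite -Jd; set v := J _.
  apply: (@le_trans _ _ (nr (P a k v) + nr (P a k v - v))).
    by rewrite -{1}(subKr (P a k v) v) nrB.
  rewrite lerD2l /t /v Jd linearB subrACA; exact: nrB.
rewrite lerD2r /level.
have dk := dL.1 k.
apply: nr_le_dominated.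
- rewrite -linearB -JB//; last exact: real_Lp_abs.
  apply/P0/J_nonneg; first by apply: real_LpB => //; exact: real_Lp_abs.
  by apply: nearW => x; rewrite subr_ge0 ler_norm.
- rewrite -linearD -JD//; last exact: real_Lp_abs.
  apply/P0/J_nonneg; first by apply: real_LpD => //; exact: real_Lp_abs.
  by apply: nearW => x; rewrite -lerBlDr sub0r -normrN ler_norm.
Qed.

End counting.
End asymptotically_fixed.

(** * Approximate eigenvectors for unimodular numbers *)

Lemma pigeonhole (K : finType) (c : nat -> K) : exists i j, (i < j)%N /\ c i = c j.
Proof.
apply: contrapT => nij.
have inj : injective (fun i : 'I_(#|K|.+1) => c i).
  move=> i j cij; apply/val_inj/eqP; apply: contrapT => /negP; rewrite neq_ltn => /orP[h|h].
    by apply: nij; exists i, j.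
  by apply: nij; exists j, i.
by have := leq_card _ inj; rewrite card_ord ltnn.
Qed.

(** Dirichlet's argument: two powers of [l] are close to each other. *)
Lemma unimodular_recurrence (R : realType) (l : R[i]) (eta : R) : normc l = 1 -> 0 < eta ->
  exists2 n, (0 < n)%N & normc (l ^+ n - 1) <= eta.
Proof.
move=> l1 eta0; have eta2 : 0 < eta / 2 by rewrite divr_gt0.
have [M [k kP]] := bounded_coloring 1 eta2.
have ln n : normc (l ^+ n) = 1 by rewrite normcX l1 expr1n.
have [i [j [ij [/kP h1 /kP h2]]]] := pigeonhole
  (fun n => (k (complex.Re (l ^+ n)), k (complex.Im (l ^+ n)))).
exists (j - i)%N; first by rewrite subn_gt0.
have -> : normc (l ^+ (j - i) - 1) = normc (l ^+ i - l ^+ j).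
  rewrite -{2}(subnKC (ltnW ij)) exprD -{1}(mulr1 (l ^+ i)) -mulrBr normcM ln mul1r.
  by rewrite -normcN opprB.
apply: le_trans (normc_le_ReIm _) _; rewrite [leRHS]splitr.
have r1 n : `|complex.Re (l ^+ n)| <= 1 by rewrite -(ln n) normc_Re.
have r2 n : `|complex.Im (l ^+ n)| <= 1 by rewrite -(ln n) normc_Im.
apply: lerD; apply: ltW.
  by have := h1 (r1 i) (r1 j); case: (l ^+ i) (l ^+ j) => [a b] [a' b'].
by have := h2 (r2 i) (r2 j); case: (l ^+ i) (l ^+ j) => [a b] [a' b'].
Qed.

Section cesaro_estimates.
Variables (R : realType) (V : normedModType R[i]) (S : {linear V -> V}) (C : R).
Hypothesis C1 : 1 <= C.
Hypothesis SC : forall n v, nr (iter n S v) <= C * nr v.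

Let C0 : 0 <= C. Proof. exact: le_trans C1. Qed.

Lemma cesaro_potential_bound N v : nr (cesaro_potential S N v) <= C * N.+1%:R * nr v.
Proof.
rewrite /cesaro_potential nrZ normcR ?invr_ge0// mulrC ler_pdivrMr//.
apply: le_trans (nr_sum _) _.
apply: (@le_trans _ _ (\sum_(j < N.+1) N.+1%:R * (C * nr v))); last first.
  by rewrite sumr_const card_ord -mulr_natr le_eqVlt; apply/orP; left; apply/eqP; ring.
apply: ler_sum => j _; apply: le_trans (nr_sum _) _.
apply: le_trans (ler_sum _ (fun (i : 'I_j) _ => SC i v)) _.
rewrite sumr_const card_ord -(mulr_natl (C * nr v) j) ler_wpM2r ?mulr_ge0 ?nr_ge0//.
by rewrite ler_nat ltnW.
Qed.

Lemma cesaro_potential_sub N v :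
  cesaro_potential S N v - S (cesaro_potential S N v) = cesaro_potential S N (v - S v).
Proof.
have iterB n u w : iter n S (u - w) = iter n S u - iter n S w.
  by elim: n => //= n ->; rewrite linearB.
rewrite /cesaro_potential (linearZ_LR S) -scalerBr (raddf_sum S) -sumrB; congr (_ *: _).
apply: eq_bigr => j _; rewrite (raddf_sum S) -sumrB; apply: eq_bigr => i _.
by rewrite iterB -iterSr.
Qed.

Lemma cesaro_near_fixed N v : nr (cesaro_mean S N v - v) <= C * N.+1%:R * nr (v - S v).
Proof.
rewrite nr_distC cesaro_potentialE cesaro_potential_sub.
exact: cesaro_potential_bound.
Qed.

(** A much longer average cannot tell a vector from its shorter average. *)
Lemma cesaro_absorb M N v :
  nr (cesaro_mean S M (cesaro_mean S N v - v)) <= (1 + C) * (C * N.+1%:R * nr v) / M.+1%:R.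
Proof.
rewrite cesaroB -nrN opprB -cesaroB cesaro_potentialE cesaroB cesaro_comm.
apply: le_trans (cesaro_sub SC _ _) _; rewrite ler_pM2r ?invr_gt0//.
by rewrite ler_wpM2l ?addr_ge0// cesaro_potential_bound.
Qed.

End cesaro_estimates.

Lemma iter_near_eigen (R : realType) (V : normedModType R[i]) (T : {linear V -> V}) (C : R)
    (l : R[i]) n v : (forall n v, nr (iter n T v) <= C * nr v) -> normc l = 1 ->
  nr (iter n T v - l ^+ n *: v) <= n%:R * (C * nr (l *: v - T v)).
Proof.
move=> TC l1; elim: n => [|n IH]; first by rewrite expr0 scale1r subrr nr0 mul0r.
have -> : iter n.+1 T v - l ^+ n.+1 *: v =
    - iter n T (l *: v - T v) + l *: (iter n T v - l ^+ n *: v).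
  have iterB u w : iter n T (u - w) = iter n T u - iter n T w.
    by elim: n {IH} => //= n ->; rewrite linearB.
  have iterZ a u : iter n T (a *: u) = a *: iter n T u.
    by elim: n {IH iterB} => //= n ->; rewrite linearZ_LR.
  rewrite iterSr iterB iterZ opprB scalerBr scalerA -exprS.
  by rewrite addrA subrK.
apply: le_trans (nrD _ _) _; rewrite nrN nrZ l1 mul1r -natr1 mulrDl mul1r addrC.
by apply: lerD.
Qed.

Section approximate_eigenvectors.
Context d (X : measurableType d) (R : realType).
Variables (mu : {measure set X -> \bar R}) (p : R) (p1 : 1 <= p).
Local Notation E := (Lp mu p1).
Local Notation J := (J mu p1).
Variables (T : {linear E -> E}) (C : R).
Hypothesis C1 : 1 <= C.
Hypothesis T0 : positive_op T.
Hypothesis TC : forall n v, nr (iter n T v) <= C * nr v.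
Hypothesis UI : forall e : R, 0 < e -> exists g : X -> R,
  [/\ real_Lp mu p1 g, forall x, 0 <= g x &
  forall f : E, nr f <= 1 ->
    nr (J (fun x => Num.max (`|complex.Re (Lp_repr (T f) x)| - g x) 0)) <= e].

Let C0 : 0 < C. Proof. exact: lt_le_trans C1. Qed.

Lemma positive_iter n : positive_op (iter n T).
Proof. by elim: n => // n IH u u0 /=; apply/T0/IH. Qed.

Lemma positive_cesaro (S : {linear E -> E}) N :
  (forall n, positive_op (iter n S)) -> positive_op (cesaro_mean S N).
Proof.
move=> S0 u u0; rewrite /cesaro_mean; apply: nonnegZ; first by rewrite invr_ge0.
by apply: big_ind => [|x y|j _]; [exact: nonneg0|exact: nonnegD|exact: S0].
Qed.

Let Re f x := complex.Re (Lp_repr (f : E) x).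
Let Im f x := complex.Im (Lp_repr (f : E) x).

(** A positive operator acts separately on the real and imaginary parts. *)
Lemma nr_ReIm_defect (P : {linear E -> E}) w : positive_op P ->
  nr (P (J (Re w)) - J (Re w)) <= nr (P w - w) /\ nr (P (J (Im w)) - J (Im w)) <= nr (P w - w).
Proof.
move=> P0; have reL : real_Lp mu p1 (Re w) := Re_repr_in w.
have imL : real_Lp mu p1 (Im w) := Im_repr_in w.
set a := J (Re w); set b := J (Im w).
have E1 : P w - w = (P a - a) + 'i *: (P b - b).
  by rewrite {1 2}(Lp_ReIm w) -/a -/b linearD linearZ_LR scalerBr opprD addrACA.
have ra : \forall x \ae mu, complex.Im (Lp_repr (P a - a) x) = 0.
  apply: filterS3 (act_real P0 reL) (J_repr reL) (Lp_reprB (P a) a) => x h1 h2 ->.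
  rewrite -/a in h1; rewrite h2; move: h1; case: (Lp_repr (P a) x) => y z /= ->.
  by rewrite subrr.
have rb : \forall x \ae mu, complex.Im (Lp_repr (P b - b) x) = 0.
  apply: filterS3 (act_real P0 imL) (J_repr imL) (Lp_reprB (P b) b) => x h1 h2 ->.
  rewrite -/b in h1; rewrite h2; move: h1; case: (Lp_repr (P b) x) => y z /= ->.
  by rewrite subrr.
have h1 := Lp_reprD (P a - a) ('i *: (P b - b)); have h2 := Lp_reprZ 'i (P b - b).
rewrite E1; split; apply: nr_ae_le; apply: filterS4 h1 h2 ra rb => x -> ->;
  case: (Lp_repr (P a - a) x) (Lp_repr (P b - b) x) => [y y'] [z z'] /= -> ->;
  rewrite !(mul0r, mul1r, mulr0, subr0, addr0, add0r, oppr0, expr0n) /= ?addr0 ler_sqrt ?addr_ge0 ?sqr_ge0//.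
- by rewrite lerDl sqr_ge0.
- by rewrite lerDr sqr_ge0.
Qed.

Lemma nr_Re w : nr (J (Re w)) <= nr w.
Proof.
by apply: nr_ae_le; apply: filterS (J_repr (Re_repr_in w)) => x ->; rewrite normc_real normc_Re.
Qed.

Lemma nr_Im w : nr (J (Im w)) <= nr w.
Proof.
by apply: nr_ae_le; apply: filterS (J_repr (Im_repr_in w)) => x ->; rewrite normc_real normc_Im.
Qed.

(** The n-th power of [T], for [n] such that [l ^+ n] is nearly 1, almost fixes the vectors
    [w i] of large index. So the sequences [k |-> w (m k + i)], for [i] in [nat], are
    asymptotically fixed when [n k] and [m k] are chosen with increasing precision.
    Infinitely many sequences and finitely many colours give two of the same colour. *)
Theorem approximate_eigenvectors_close (l : R[i]) (w : nat -> E) : normc l = 1 ->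
  (forall k, nr (w k) <= 1) ->
  (fun k => nr (l *: w k - T (w k))) @ \oo --> (0 : R) ->
  forall delta : R, 0 < delta -> exists i j, (i < j)%N /\ nr (w i - w j) < delta.
Proof.
move=> l1 w1 wl delta delta0.
have [U [UU Uge]] := free_ultrafilter_exists.
pose len b k := (k.+1 ^ b.+1)%N.
have len_gt0 b k : (0 < len b k)%N by rewrite expn_gt0.
(* This precision leaves an error of order 1 / k after averaging over a length up to
   [len k k], and each level [b] is below [k] eventually. *)
pose eta k : R := (k.+1%:R * (len k k)%:R)^-1.
have eta0 k : 0 < eta k by rewrite invr_gt0 mulr_gt0 ?ltr0n.
have /choice[n nP] : forall k, exists n, (0 < n)%N /\ normc (l ^+ n - 1) <= eta k / 2.
  move=> k; have [||n n0 hn] := @unimodular_recurrence R l (eta k / 2) => //.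
    by rewrite divr_gt0.
  by exists n.
have /choice[m mP] : forall k, exists m, forall i, (m <= i)%N ->
    (n k)%:R * (C * nr (l *: w i - T (w i))) <= eta k / 2.
  move=> k; have nC : 0 < (n k)%:R * C by rewrite mulr_gt0// ltr0n; have [] := nP k.
  have e0 : 0 < eta k / 2 / ((n k)%:R * C) by rewrite !divr_gt0.
  have /nullP/(_ _ e0)[m hm] := wl; exists m => i /hm.
  by rewrite ger0_norm ?nr_ge0// ltr_pdivlMr// mulrC mulrA => /ltW.
have /choice[S SE] : forall k, exists S : {linear E -> E}, S = iter (n k) T :> (E -> E).
  by move=> k; apply: linear_pack => a u v; exact: iter_lin.
have Siter k j : iter j (S k) = iter (j * n k)%N T.
  elim: j => [|j IH]; first by [].
  by apply/funext => v; rewrite iterS IH SE mulSn iterD.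
have SC k j v : nr (iter j (S k) v) <= C * nr v by rewrite Siter; exact: TC.
have S0 k j : positive_op (iter j (S k)) by rewrite Siter; exact: positive_iter.
(* The averages act along [T \o Q k], to bring in the integrability of the image of [T]. *)
have /choice[Q QE] : forall k, exists Q : {linear E -> E}, Q = iter (n k).-1 T :> (E -> E).
  by move=> k; apply: linear_pack => a u v; exact: iter_lin.
have TQ k v : T (Q k v) = S k v.
  by rewrite QE SE -iterS prednK//; have [] := nP k.
pose N b k := (len b k).-1.
have NE b k : (N b k).+1 = len b k by rewrite prednK.
have /choice[P' P'E] : forall bk : nat * nat, exists P : {linear E -> E},
    P = cesaro_mean (S bk.2) (N bk.1 bk.2) :> (E -> E).
  by move=> bk; apply: linear_pack => a u v; exact: cesaro_lin.
pose P b k := P' (b, k).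
have PE b k v : P b k v = cesaro_mean (S k) (N b k) v by rewrite /P P'E.
have P0 b k : positive_op (P b k).
  by move=> u u0; rewrite PE; exact: positive_cesaro.
have PC b k v : nr (P b k v) <= C * nr v by rewrite PE; exact: cesaro_bound.
have QC k v : nr (Q k v) <= C * nr v by rewrite QE.
have len1 b k : k.+1%:R <= (len b k)%:R :> R by rewrite ler_nat /len expnS leq_pmulr// expn_gt0.
have PP a b : (b < a)%N -> exists2 D : nat -> R, D @ \oo --> (0 : R) &
    forall k v, nr (P a k (P b k v - v)) <= D k * nr v.
  move=> ba; exists (fun k => (1 + C) * C / k.+1%:R); first exact: null_cst_div.
  move=> k v; rewrite !PE; apply: le_trans (cesaro_absorb C1 (SC k) _ _ _) _.
  rewrite !NE.
  have ab : (len b k)%:R / (len a k)%:R <= k.+1%:R^-1 :> R.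
    rewrite ler_pdivrMr ?ltr0n// mulrC ler_pdivlMr ?ltr0n// -natrM ler_nat /len.
    by rewrite mulnC -expnS leq_pexp2l.
  have -> : (1 + C) * (C * (len b k)%:R * nr v) / (len a k)%:R =
      (1 + C) * C * nr v * ((len b k)%:R / (len a k)%:R) by ring.
  have -> : (1 + C) * C / k.+1%:R * nr v = (1 + C) * C * nr v * k.+1%:R^-1 by ring.
  by rewrite ler_wpM2l// !mulr_ge0 ?nr_ge0 ?addr_ge0 ?(ltW C0).
have PT a : exists2 D : nat -> R, D @ \oo --> (0 : R) &
    forall k v, nr (P a k v - T (Q k (P a k v))) <= D k * nr v.
  exists (fun k => (1 + C) / k.+1%:R); first exact: null_cst_div.
  move=> k v; rewrite TQ !PE; apply: le_trans (cesaro_sub (SC k) _ _) _.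
  rewrite NE mulrAC ler_wpM2r ?nr_ge0// ler_wpM2l ?addr_ge0 ?(ltW C0)//.
  by rewrite lef_pV2 ?posrE ?ltr0n.
have delta2 : 0 < delta / 2 by rewrite divr_gt0.
have [K [col colP]] := asym_fixed_coloring UU Uge C1 P0 PC PP QC PT UI delta2.
pose re i (y : nat * X) := Re (w (m y.1 + i)%N) y.2.
pose im i (y : nat * X) := Im (w (m y.1 + i)%N) y.2.
have wS k i : nr (w (m k + i)%N - S k (w (m k + i)%N)) <= eta k.
  set v := w _; rewrite nr_distC.
  have -> : S k v - v = (iter (n k) T v - l ^+ n k *: v) + (l ^+ n k - 1) *: v.
    by rewrite SE scalerBl scale1r addrA subrK.
  apply: le_trans (nrD _ _) _; rewrite [leRHS]splitr; apply: lerD.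
    by apply: le_trans (iter_near_eigen _ _ TC l1) _; apply: mP; exact: leq_addr.
  rewrite nrZ -[leRHS]mulr1; have [_ h] := nP k.
  by apply: ler_pM => //; [exact: normc_ge0|exact: nr_ge0|exact: w1].
have wP b i : (fun k => nr (P b k (w (m k + i)%N) - w (m k + i)%N)) @ \oo --> (0 : R).
  apply/nullP => e e0; have /nullP/(_ e e0)[N0 hN0] := null_cst_div C.
  exists (maxn N0 b) => k; rewrite geq_max => /andP[/hN0 h bk].
  rewrite ger0_norm ?nr_ge0//; apply: le_lt_trans h.
  rewrite PE; apply: le_trans (cesaro_near_fixed C1 (SC k) _ _) _; rewrite NE.
  apply: le_trans (ler_norm _); rewrite -mulrA ler_wpM2l ?(ltW C0)//.
  apply: le_trans (ler_wpM2l _ (wS k i)) _ => //.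
  rewrite /eta invfM mulrCA -[leRHS]mulr1 ler_wpM2l ?invr_ge0//.
  rewrite ler_pdivrMr ?ltr0n// mul1r ler_nat /len leq_pexp2l//.
have rew b i : (fun k => nr (P b k (J (slice (re i) k)) - J (slice (re i) k))) @ \oo --> (0 : R).
  apply: null_squeeze (wP b i) => k; rewrite nr_ge0 /=.
  by have [h _] := nr_ReIm_defect (w (m k + i)%N) (P0 b k).
have imw b i : (fun k => nr (P b k (J (slice (im i) k)) - J (slice (im i) k))) @ \oo --> (0 : R).
  apply: null_squeeze (wP b i) => k; rewrite nr_ge0 /=.
  by have [_ h] := nr_ReIm_defect (w (m k + i)%N) (P0 b k).
have reL i k : real_Lp mu p1 (slice (re i) k) := Re_repr_in (w (m k + i)%N).
have imL i k : real_Lp mu p1 (slice (im i) k) := Im_repr_in (w (m k + i)%N).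
have re1 i k : nr (J (slice (re i) k)) <= 1 by exact: le_trans (nr_Re (w (m k + i)%N)) (w1 _).
have im1 i k : nr (J (slice (im i) k)) <= 1 by exact: le_trans (nr_Im (w (m k + i)%N)) (w1 _).
have [i [j [ij [cre cim]]]] := pigeonhole (fun i => (col (re i), col (im i))).
have Ure := colP _ _ (reL i) (reL j) (re1 i) (re1 j) (fun b => rew b i) (fun b => rew b j) cre.
have Uim := colP _ _ (imL i) (imL j) (im1 i) (im1 j) (fun b => imw b i) (fun b => imw b j) cim.
have [k [hre him]] := filter_ex (filterI Ure Uim).
exists (m k + i)%N, (m k + j)%N; split; first by rewrite ltn_add2l.
rewrite (Lp_ReIm (w (m k + i)%N)) (Lp_ReIm (w (m k + j)%N)) opprD addrACA -scalerBr.
apply: le_lt_trans (nrD _ _) _; rewrite nrZ.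
have -> : normc ('i : R[i]) = 1 by rewrite /= expr0n expr1n add0r sqrtr1.
by rewrite mul1r [ltRHS]splitr ltrD.
Qed.

End approximate_eigenvectors.

(** * Lebesgue measure on a subset of Euclidean space *)

Lemma ge0_integral_mrestr d (X : measurableType d) (R : realType)
    (mu : {measure set X -> \bar R}) (D : set X) (mD : measurable D) (f : X -> \bar R) :
  measurable_fun [set: X] f -> (forall x, (0 <= f x)%E) ->
  (\int[mrestr mu mD]_x f x = \int[mu]_(x in D) f x)%E.
Proof.
move=> mf f0; have NE : mrestr mu mD (~` D) = 0%E by rewrite /mrestr setICl measure0.
rewrite (ge0_negligible_integral (measurableC mD) measurableT mf (fun x _ => f0 x) NE).
rewrite setTD setCK; apply: eq_measure_integral => A mA AD.
by rewrite /= /mrestr setIidl.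
Qed.

Lemma sublevel_measurable d (X : measurableType d) (R : realType) (g : X -> R) (r : R) :
  measurable_fun [set: X] g -> measurable [set x | g x <= r].
Proof.
move=> /(_ measurableT _ (measurable_itv `]-oo, r])); rewrite setTI.
by congr (measurable _); apply/seteqP; split => x /=; rewrite in_itv.
Qed.

Section euclidean.
Variables (R : realType) (d : nat).
Local Notation Rd := (d.-tuple (measurableTypeR R)).

Lemma measurable_euclidean_norm : measurable_fun [set: Rd] (@euclidean_norm R d).
Proof.
rewrite (_ : @euclidean_norm R d =
    (@powR R ^~ 2^-1) \o (fun x : Rd => \sum_(i < d) (tnth x i : R) ^+ 2)); last first.
  by apply/funext => x /=; rewrite powR12_sqrt ?sumr_ge0// => i _; rewrite sqr_ge0.
apply: measurableT_comp; first exact: measurable_powR.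
apply: measurable_sum => i; apply: measurable_funX.
exact: (@measurable_tnth _ (measurableTypeR R) d i).
Qed.

Lemma euclidean_norm_ge0 (x : Rd) : 0 <= euclidean_norm x.
Proof. exact: sqrtr_ge0. Qed.

Lemma tnth_le_euclidean_norm (x : Rd) i : `|(tnth x i : R)| <= euclidean_norm x.
Proof.
rewrite -sqrtr_sqr ler_sqrt; last by apply: sumr_ge0 => j _; rewrite sqr_ge0.
by rewrite (bigD1 i)//= lerDl; apply: sumr_ge0 => j _; rewrite sqr_ge0.
Qed.

(** A ball sits in a cube. *)
Lemma ball_finite_measure (r : R) :
  (lebesgue_measureRn R d [set x : Rd | (euclidean_norm x <= r)%R] < +oo)%E.
Proof.
pose A (i : 'I_d) : set (measurableTypeR R) := `[- r, r]%classic.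
have mA i : measurable (A i) by exact: measurable_itv.
have boxE := lebesgue_measureRn_box mA.
have mbox : measurable [set x : Rd | forall i, A i (tnth x i)].
  rewrite (_ : mkset _ =
      \bigcap_(i in [set: 'I_d]) ((@tnth d (measurableTypeR R))^~ i @^-1` A i)).
    apply: fin_bigcap_measurable => // i _; rewrite -[X in measurable X]setTI.
    exact: measurable_tnth.
  by apply/seteqP; split => t /= h i; [move=> _; exact: h|exact: h].
have mball : measurable [set x : Rd | euclidean_norm x <= r].
  exact: sublevel_measurable measurable_euclidean_norm.
apply: (@le_lt_trans _ _ (lebesgue_measureRn R d [set x : Rd | forall i, A i (tnth x i)])).
  apply: le_measure; rewrite ?inE// => x /= xr i.
  by rewrite /A /= in_itv /= -ler_norml; apply: le_trans xr; exact: tnth_le_euclidean_norm.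
rewrite boxE; suff [] : (\prod_(i < d) lebesgue_measure (A i) < +oo /\
    0 <= \prod_(i < d) lebesgue_measure (A i))%E by [].
apply: (big_ind (fun x : \bar R => (x < +oo)%E /\ (0 <= x)%E))
  => [|x y [x1 x0] [y1 y0]|i _].
- by split; [exact: ltry|exact: lee01].
- by split; [rewrite lte_mul_pinfty// ge0_fin_numE|exact: mule_ge0].
- split; last by rewrite measure_ge0.
  by rewrite lebesgue_measure_itv /=; case: ifP => _; rewrite ?ltry// -EFinB ltry.
Qed.

End euclidean.

Lemma power_bounded_constant (R : realType) (V : normedModType R[i]) (T : {linear V -> V}) :
  power_bounded T -> exists2 C : R, 1 <= C & forall n v, nr (iter n T v) <= C * nr v.
Proof.
rewrite /power_bounded; set s := ereal_sup _ => s_lty.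
have s0 : (0 <= s)%E.
  apply: le_trans (opnorm_ge0 (iter 0 T)) _; apply: ereal_sup_ubound; by exists 0%N.
have sE : s = (fine s)%:E by rewrite fineK// ge0_fin_numE.
exists (Num.max 1 (fine s)); first by rewrite le_max lexx.
move=> n; apply: opnorm_bound.
  by move=> a v; elim: n => //= n ->; rewrite linearZ_LR.
apply: (@le_trans _ _ s); first by apply: ereal_sup_ubound; exists n.
by rewrite sE lee_fin le_max lexx orbT.
Qed.

Theorem corollary4p4 (R : realType) (d : nat)
    (Omega : set (d.-tuple (measurableTypeR R))) (mOmega : measurable Omega)
    (p : R) (p1 : 1 <= p)
    (T : {linear Lp (mrestr (lebesgue_measureRn R d) mOmega) p1 ->
                 Lp (mrestr (lebesgue_measureRn R d) mOmega) p1})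
    (Tpos : positive_op T) (Tpb : power_bounded T)
    (eps1 eps2 : R) (eps1_gt0 : 0 < eps1) (eps2_gt0 : 0 < eps2)
    (Tint : forall f : Lp (mrestr (lebesgue_measureRn R d) mOmega) p1,
      (\int[lebesgue_measureRn R d]_(x in Omega)
        (normc (Lp_repr (T f) x) `^ p * (1 + euclidean_norm x) `^ eps2)%:E < +oo)%E /\
      (\int[lebesgue_measureRn R d]_(x in Omega)
        (normc (Lp_repr (T f) x) `^ (p + eps1) * (1 + euclidean_norm x) `^ eps2)%:E
          < +oo)%E) :
  (ess_spectral_radius T < 1)%E.
Proof.
have [C C1 TC] := power_bounded_constant Tpb.
pose W (x : d.-tuple (measurableTypeR R)) : R := (1 + euclidean_norm x) `^ eps2.
have E1 (x : d.-tuple (measurableTypeR R)) : 1 <= 1 + euclidean_norm x.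
  by rewrite lerDl euclidean_norm_ge0.
have mW : measurable_fun [set: d.-tuple (measurableTypeR R)] W.
  apply: (measurableT_comp (measurable_powR eps2)).
  by apply: measurable_funD => //; exact: measurable_euclidean_norm.
have W1 x : 1 <= W x.
  by rewrite -(powRr0 (1 + euclidean_norm x)); apply: ler_powR => //; exact: ltW.
have Wfin c : (mrestr (lebesgue_measureRn R d) mOmega [set x | (W x <= c)%R] < +oo)%E.
  have mWc : measurable [set x | W x <= c].
    exact: sublevel_measurable mW.
  apply: le_lt_trans (ball_finite_measure d (c `^ eps2^-1)).
  rewrite /= /mrestr; apply: le_measure; rewrite ?inE; first exact: measurableI.
    exact: sublevel_measurable (@measurable_euclidean_norm R d).
  move=> x [/= Wxc _]; have x0 := euclidean_norm_ge0 x.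
  have xE : 1 + euclidean_norm x = W x `^ eps2^-1.
    by rewrite /W -powRrM mulfV ?gt_eqF// powRr1// addr_ge0.
  apply: (@le_trans _ _ (1 + euclidean_norm x)); first by rewrite lerDr.
  rewrite xE; apply: ge0_ler_powR; rewrite ?nnegrE ?invr_ge0 ?(ltW eps2_gt0)//.
    exact: le_trans (W1 x).
  by apply: le_trans Wxc; exact: le_trans (W1 x).
have mrE q f : weighted q W (T f) = (\int[lebesgue_measureRn R d]_(x in Omega)
    (normc (Lp_repr (T f) x) `^ q * W x)%:E)%E.
  apply: ge0_integral_mrestr.
    by apply: measurable_weighted => //; exact: measurable_modulus.
  by move=> x; rewrite lee_fin mulr_ge0 ?powR_ge0.
have fin1 f : (weighted p W (T f) < +oo)%E by rewrite mrE; exact: (Tint f).1.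
have fin2 f : (weighted (p + eps1) W (T f) < +oo)%E by rewrite mrE; exact: (Tint f).2.
have UI := almost_order_bounded Tpos eps1_gt0 mW W1 Wfin fin1 fin2.
apply: (ess_spectral_radius_lt1 (@Lp_complete _ _ _ _ _ p1) C1 TC).
by move=> l l1 w w1 wl delta delta0; exact: (approximate_eigenvectors_close C1 Tpos TC UI l1).
Qed.
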